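(* Let $\mathfrak{C}$ be an $A$-coring, $\mathfrak{D}$ a $B$-coring, $X\in{}^{\mathfrak{C}}\mathcal{M}^{\mathfrak{D}}$ and $\Lambda\in{}^{\mathfrak{D}}\mathcal{M}^{\mathfrak{C}}$. Assume that at least one of the following conditions holds: (1) ${}_A\mathfrak{C}$, ${}_B\mathfrak{D}$, $\mathfrak{C}_A$ and $\mathfrak{D}_B$ are flat, and ${}_{\mathfrak{C}}X$ and ${}_{\mathfrak{D}}\Lambda$ are coflat; or (2) $A$ and $B$ are von Neumann regular rings; or (3) ${}_A\mathfrak{C}$, ${}_B\mathfrak{D}$ are flat, and $\mathfrak{C}$ and $\mathfrak{D}$ are coseparable corings. Suppose there exist bicolinear maps $\psi:\mathfrak{C}\to X\square_{\mathfrak{D}}\Lambda$ in ${}^{\mathfrak{C}}\mathcal{M}^{\mathfrak{C}}$ and $\omega:\Lambda\square_{\mathfrak{C}}X\to\mathfrak{D}$ in ${}^{\mathfrak{D}}\mathcal{M}^{\mathfrak{D}}$ such that the composite $\Lambda\simeq\Lambda\square_{\mathfrak{C}}\mathfrak{C}\xrightarrow{\Lambda\square_{\mathfrak{C}}\psi}\Lambda\square_{\mathfrak{C}}X\square_{\mathfrak{D}}\Lambda\xrightarrow{\omega\square_{\mathfrak{D}}\Lambda}\mathfrak{D}\square_{\mathfrak{D}}\Lambda$ equals the canonical isomorphism $\Lambda\simeq\mathfrak{D}\square_{\mathfrak{D}}\Lambda$, and the composite $X\simeq\mathfrak{C}\square_{\mathfrak{C}}X\xrightarrow{\psi\square_{\mathfrak{C}}X}X\square_{\mathfrak{D}}\Lambda\square_{\mathfrak{C}}X\xrightarrow{X\square_{\mathfrak{D}}\omega}X\square_{\mathfrak{D}}\mathfrak{D}$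 equals the canonical isomorphism $X\simeq X\square_{\mathfrak{D}}\mathfrak{D}$. Then $\Lambda\square_{\mathfrak{C}}X$ is a $B$-coring with coproduct the composite $$\Delta:\Lambda\square_{\mathfrak{C}}X\simeq\Lambda\square_{\mathfrak{C}}(\mathfrak{C}\square_{\mathfrak{C}}X)\xrightarrow{\Lambda\square_{\mathfrak{C}}(\psi\square_{\mathfrak{C}}X)}\Lambda\square_{\mathfrak{C}}((X\square_{\mathfrak{D}}\Lambda)\square_{\mathfrak{C}}X)\simeq(\Lambda\square_{\mathfrak{C}}X)\square_{\mathfrak{D}}(\Lambda\square_{\mathfrak{C}}X)\hookrightarrow(\Lambda\square_{\mathfrak{C}}X)\otimes_B(\Lambda\square_{\mathfrak{C}}X)$$ and counit $\epsilon=\epsilon_{\mathfrak{D}}\circ\omega:\Lambda\square_{\mathfrak{C}}X\to B$.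
   Context: $k$ is a commutative ring; $A,B$ are associative unital $k$-algebras. An $A$-coring is an $A$-bimodule $\mathfrak{C}$ with $A$-bimodule maps $\Delta_{\mathfrak C}:\mathfrak{C}\to\mathfrak{C}\otimes_A\mathfrak{C}$ (coassociative) and $\epsilon_{\mathfrak C}:\mathfrak{C}\to A$ (counit). A right $\mathfrak{C}$-comodule is a right $A$-module $M$ with a coassociative, counital right $A$-linear coaction $\rho_M:M\to M\otimes_A\mathfrak{C}$; left comodules are symmetric (coaction $\lambda$). A $(\mathfrak{C},\mathfrak{D})$-bicomodule (category ${}^{\mathfrak{C}}\mathcal{M}^{\mathfrak{D}}$) is an $(A,B)$-bimodule that is a left $\mathfrak{C}$-comodule with $B$-linear coaction $\lambda$ and a right $\mathfrak{D}$-comodule with $A$-linear coaction $\rho$, with $(\lambda\otimes_B\mathfrak{D})\rho=(\mathfrak{C}\otimes_A\rho)\lambda$. Cotensor product: $M\square_{\mathfrak{C}}N=\ker(\rho_M\otimes_AN-M\otimes_A\lambda_N: M\otimes_AN\to M\otimes_A\mathfrak{C}\otimes_AN)$. Under each of the conditions (1)-(3) the cotensor products involved are bicomodules and are associative up to canonical isomorphism, and $M\square_{\mathfrak C}\mathfrak C\simeq M$ via $\rho_M$, $\mathfrak C\square_{\mathfrak C}N\simeq N$ via $\lambda_N$. When ${}_A\mathfrak C$ is flat, a left $\mathfrak C$-comodule $N$ is coflat if $-\square_{\mathfrak C}N:\mathcal M^{\mathfrak C}\to\mathcal M_k$ is exact. $\mathfrak C$ is coseparable if $\Delta_{\mathfrak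 C}$ is a split monomorphism of $\mathfrak C$-bicomodules. *)

(* Defs.v *)
(* boolp serves for the quotient by an undecidable congruence in the tensor
   product and for the definite description in [corestr]. *)
From HB Require Import structures.
From mathcomp Require Import all_boot all_algebra.
From mathcomp Require Import boolp.

Set Implicit Arguments.
Unset Strict Implicit.
Unset Printing Implicit Defensive.

Import GRing.Theory.
Local Open Scope ring_scope.
Local Open Scope quotient_scope.

Declare Scope bimod_scope.
Delimit Scope bimod_scope with bim.
Local Open Scope bimod_scope.

Local Obligation Tactic := idtac.

Reserved Notation "a *> x" (at level 40, left associativity).
Reserved Notation "x <* b" (at level 40, left associativity).
Reserved Notation "M ⊗ N" (at level 40, left associativity).
Reserved Notation "x ⊗' y" (at level 40, left associativity).
Reserved Notation "f ⊗₁ g" (at level 40, left associativity).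
Reserved Notation "M □ N" (at level 40, left associativity).
Reserved Notation "f □₁ g" (at level 40, left associativity).
Reserved Notation "g ∘ f" (at level 45, right associativity).

(* MathComp's algType is restricted to nonzero algebras; here an algebra is a
   possibly zero ring with a structure morphism from k to its centre. *)
Record kalg (k : comPzRingType) := KAlg {
  kalg_ring :> pzRingType;
  kalg_map : {rmorphism k -> kalg_ring};
  kalg_central : forall (c : k) (x : kalg_ring),
    kalg_map c * x = x * kalg_map c
}.
Arguments kalg_map {k} _.

Fact base_kalg_central (k : comPzRingType) (c x : k) : idfun c * x = x * idfun c.
Proof. exact: mulrC. Qed.
Definition base_kalg (k : comPzRingType) : kalg k :=
  @KAlg k k idfun (@base_kalg_central k).

Definition bimod_axioms (k : comPzRingType) (A B : kalg k) (M : zmodType)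
    (la : A -> M -> M) (ra : M -> B -> M) : Prop :=
  [/\ [/\ forall a, {morph la a : x y / x + y},
          forall a b x, la (a + b) x = la a x + la b x,
          forall a b x, la (a * b) x = la a (la b x)
        & forall x, la 1 x = x],
      [/\ forall b, {morph ra^~ b : x y / x + y},
          forall x b c, ra x (b + c) = ra x b + ra x c,
          forall x b c, ra x (b * c) = ra (ra x b) c
        & forall x, ra x 1 = x],
      forall a x b, la a (ra x b) = ra (la a x) b
    & forall (c : k) x, la (kalg_map A c) x = ra x (kalg_map B c)].

(* The last axiom says that the two induced actions of k agree, so that
   (A, B)-bimodules are left modules over A (x)_k B^op, right A-modules are the
   (k, A)-bimodules and left A-modules the (A, k)-bimodules. *)
Record bimod (k : comPzRingType) (A B : kalg k) := Bimod {
  bimod_zmod :> zmodType;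
  lact : A -> bimod_zmod -> bimod_zmod;
  ract : bimod_zmod -> B -> bimod_zmod;
  bimodP : bimod_axioms lact ract
}.
Notation "a *> x" := (lact a x) : bimod_scope.
Notation "x <* b" := (ract x b) : bimod_scope.
Bind Scope bimod_scope with bimod.

Section BimodTheory.
Variables (k : comPzRingType) (A B : kalg k) (M : bimod A B).
Implicit Types (a : A) (b : B) (x y : M).

Lemma lactDr a x y : a *> (x + y) = a *> x + a *> y.
Proof. by case: (bimodP M) => -[h _ _ _] _ _ _; exact: h. Qed.
Lemma lactDl a a' x : (a + a') *> x = a *> x + a' *> x.
Proof. by case: (bimodP M) => -[_ h _ _] _ _ _; exact: h. Qed.
Lemma lactM a a' x : (a * a') *> x = a *> (a' *> x).
Proof. by case: (bimodP M) => -[_ _ h _] _ _ _; exact: h. Qed.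
Lemma lact1 x : 1 *> x = x.
Proof. by case: (bimodP M) => -[_ _ _ h] _ _ _; exact: h. Qed.
Lemma ractDl b x y : (x + y) <* b = x <* b + y <* b.
Proof. by case: (bimodP M) => _ [h _ _ _] _ _; exact: h. Qed.
Lemma ractDr b b' x : x <* (b + b') = x <* b + x <* b'.
Proof. by case: (bimodP M) => _ [_ h _ _] _ _; exact: h. Qed.
Lemma ractM b b' x : x <* (b * b') = x <* b <* b'.
Proof. by case: (bimodP M) => _ [_ _ h _] _ _; exact: h. Qed.
Lemma ract1 x : x <* 1 = x.
Proof. by case: (bimodP M) => _ [_ _ _ h] _ _; exact: h. Qed.
Lemma lractA a x b : a *> (x <* b) = a *> x <* b.
Proof. by case: (bimodP M) => _ _ h _; exact: h. Qed.
Lemma lract_base (c : k) x : kalg_map A c *> x = x <* kalg_map B c.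
Proof. by case: (bimodP M) => _ _ _ h; exact: h. Qed.
Lemma lact0 a : a *> (0 : M) = 0.
Proof. by apply: (addrI (a *> 0)); rewrite -lactDr !addr0. Qed.
Lemma ract0 b : (0 : M) <* b = 0.
Proof. by apply: (addrI (0 <* b)); rewrite -ractDl !addr0. Qed.
Lemma lactN a x : a *> (- x) = - (a *> x).
Proof. by apply: (addrI (a *> x)); rewrite -lactDr !subrr lact0. Qed.
Lemma ractN b x : (- x) <* b = - (x <* b).
Proof. by apply: (addrI (x <* b)); rewrite -ractDl !subrr ract0. Qed.
End BimodTheory.

Record bihom (k : comPzRingType) (A B : kalg k) (M N : bimod A B) :=
  Bihom {
    bihom_fun :> M -> N;
    bihomD : {morph bihom_fun : x y / x + y};
    bihom_lact : forall a x, bihom_fun (a *> x) = a *> bihom_fun x;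
    bihom_ract : forall x b, bihom_fun (x <* b) = bihom_fun x <* b
  }.

Fact bihom_zmod (k : comPzRingType) (A B : kalg k) (M N : bimod A B)
  (f : bihom M N) : zmod_morphism f.
Proof.
by move=> x y; apply: (addIr (f y)); rewrite -bihomD !subrK.
Qed.
HB.instance Definition _ (k : comPzRingType) (A B : kalg k)
    (M N : bimod A B) (f : bihom M N) :=
  GRing.isZmodMorphism.Build M N f (bihom_zmod f).
Lemma bihomB (k : comPzRingType) (A B : kalg k) (M N : bimod A B)
  (f : bihom M N) : {morph f : x y / x - y}.
Proof. exact: bihom_zmod. Qed.

Section BihomOps.
Variables (k : comPzRingType) (A B : kalg k).
Implicit Types M N P : bimod A B.

Program Definition idb M : bihom M M := @Bihom _ _ _ M M id _ _ _.
Next Obligation. by []. Qed.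
Next Obligation. by []. Qed.
Next Obligation. by []. Qed.

Program Definition bicomp M N P (g : bihom N P) (f : bihom M N) : bihom M P :=
  @Bihom _ _ _ M P (fun x => g (f x)) _ _ _.
Next Obligation. by move=> M N P g f x y /=; rewrite !raddfD. Qed.
Next Obligation. by move=> M N P g f a x /=; rewrite !bihom_lact. Qed.
Next Obligation. by move=> M N P g f x b /=; rewrite !bihom_ract. Qed.

Program Definition bihom0 M N : bihom M N := @Bihom _ _ _ M N (fun=> 0) _ _ _.
Next Obligation. by move=> M N x y /=; rewrite addr0. Qed.
Next Obligation. by move=> M N a x /=; rewrite lact0. Qed.
Next Obligation. by move=> M N x b /=; rewrite ract0. Qed.

Program Definition bihom_sub M N (f g : bihom M N) : bihom M N :=
  @Bihom _ _ _ M N (fun x => f x - g x) _ _ _.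
Next Obligation. by move=> M N f g x y /=; rewrite !bihomD opprD addrACA. Qed.
Next Obligation.
by move=> M N f g a x /=; rewrite !bihom_lact lactDr lactN. Qed.
Next Obligation.
by move=> M N f g x b /=; rewrite !bihom_ract ractDl ractN. Qed.

(* The corestriction of f along i: the h with i \o h =1 f, unique when i is
   injective. If no such h exists, the value is the (junk) zero map. *)
Definition corestr K L M (i : bihom K M) (f : bihom L M) : bihom L K :=
  if pselect (exists h : bihom L K, i \o h =1 f) is left e
  then projT1 (cid e) else bihom0 L K.

Lemma corestrE K L M (i : bihom K M) (f : bihom L M) :
  (exists h : bihom L K, i \o h =1 f) -> i \o corestr i f =1 f.
Proof. by rewrite /corestr; case: pselect => // e _; case: cid. Qed.

Lemma corestr_uniq K L M (i : bihom K M) (f : bihom L M) (h : bihom L K) :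
  injective i -> i \o h =1 f -> corestr i f =1 h.
Proof.
move=> inj_i hE x; apply: inj_i.
by rewrite [LHS](corestrE _ x) ?[RHS]hE//; exists h.
Qed.
End BihomOps.
Notation "g ∘ f" := (bicomp g f) : bimod_scope.
Arguments bihom_sub {k A B M N}.
Arguments idb {k A B} M.

Definition exact_pair (T : Type) (U V : zmodType) (f : T -> U) (g : U -> V) :=
  forall y, g y = 0 <-> exists x, f x = y.

Section Kernel.
Variables (k : comPzRingType) (A B : kalg k) (M N : bimod A B).
Variable h : bihom M N.

Definition ker_pred : {pred M} := fun x => h x == 0.
Fact ker_pred_closed : zmod_closed ker_pred.
Proof.
split=> [|x y]; rewrite !unfold_in ?raddf0 //= => /eqP hx /eqP hy.
by rewrite raddfB /= hx hy subrr.
Qed.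
HB.instance Definition _ := GRing.isZmodClosed.Build M ker_pred ker_pred_closed.

Record ker_sort := KerElt { ker_val : M; _ : ker_val \in ker_pred }.
HB.instance Definition _ := [isSub for ker_val].
HB.instance Definition _ := [Choice of ker_sort by <:].
HB.instance Definition _ := [SubChoice_isSubZmodule of ker_sort by <:].

Lemma ker_valK (x : ker_sort) : h (val x) = 0.
Proof. by apply/eqP; exact: (valP x). Qed.

Fact ker_lact_subproof a (x : ker_sort) : a *> val x \in ker_pred.
Proof. by rewrite unfold_in bihom_lact ker_valK lact0. Qed.
Fact ker_ract_subproof (x : ker_sort) b : val x <* b \in ker_pred.
Proof. by rewrite unfold_in bihom_ract ker_valK ract0. Qed.
Definition ker_lact a x := KerElt (ker_lact_subproof a x).
Definition ker_ract x b := KerElt (ker_ract_subproof x b).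

Fact ker_bimodP : bimod_axioms ker_lact ker_ract.
Proof.
split; [split|split| |].
- by move=> a x y; apply: val_inj; rewrite /= lactDr.
- by move=> a b x; apply: val_inj; rewrite /= lactDl.
- by move=> a b x; apply: val_inj; rewrite /= lactM.
- by move=> x; apply: val_inj; rewrite /= lact1.
- by move=> a x y; apply: val_inj; rewrite /= ractDl.
- by move=> a b x; apply: val_inj; rewrite /= ractDr.
- by move=> a b x; apply: val_inj; rewrite /= ractM.
- by move=> x; apply: val_inj; rewrite /= ract1.
- by move=> a x b; apply: val_inj; rewrite /= lractA.
- by move=> c x; apply: val_inj; rewrite /= lract_base.
Qed.

Definition ker : bimod A B := Bimod ker_bimodP.

Program Definition ker_incl : bihom ker M := @Bihom _ _ _ ker M val _ _ _.
Next Obligation. by []. Qed.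
Next Obligation. by []. Qed.
Next Obligation. by []. Qed.

Lemma ker_incl_inj : injective ker_incl.
Proof. exact: val_inj. Qed.

Lemma corestr_kerE L (f : bihom L M) :
  (forall x, h (f x) = 0) -> ker_incl \o corestr ker_incl f =1 f.
Proof.
move=> hf0; apply: corestrE.
have hf x : f x \in ker_pred by rewrite unfold_in hf0.
have fD : {morph (fun x => KerElt (hf x) : ker) : x y / x + y}.
  by move=> x y; apply: val_inj; rewrite /= bihomD.
have fl a x : KerElt (hf (a *> x)) = a *> (KerElt (hf x) : ker).
  by apply: val_inj; rewrite /= bihom_lact.
have fr x b : KerElt (hf (x <* b)) = (KerElt (hf x) : ker) <* b.
  by apply: val_inj; rewrite /= bihom_ract.
by exists (@Bihom _ _ _ L ker _ fD fl fr).
Qed.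
End Kernel.

Section Tensor.
Variables (k : comPzRingType) (A B D : kalg k).
Variables (M : bimod A B) (N : bimod B D).

(* A sequence of pairs stands for the formal sum of its entries. The congruence
   is the one generated by biadditivity and B-balancedness; opposites come for
   free, as (-x, y) + (x, y) is congruent to (0, y). *)
Inductive tens_eqv : seq (M * N) -> seq (M * N) -> Prop :=
| tens_refl s : tens_eqv s s
| tens_sym s t : tens_eqv s t -> tens_eqv t s
| tens_trans s t u : tens_eqv s t -> tens_eqv t u -> tens_eqv s u
| tens_cat s s' t t' :
    tens_eqv s s' -> tens_eqv t t' -> tens_eqv (s ++ t) (s' ++ t')
| tens_comm s t : tens_eqv (s ++ t) (t ++ s)
| tens_zero y : tens_eqv [:: (0, y)] [::]
| tens_addl x x' y : tens_eqv [:: (x + x', y)] [:: (x, y); (x', y)]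
| tens_addr x y y' : tens_eqv [:: (x, y + y')] [:: (x, y); (x, y')]
| tens_bal x b y : tens_eqv [:: (x <* b, y)] [:: (x, b *> y)].

Definition tens_rel s t := `[< tens_eqv s t >].
Fact tens_rel_refl : reflexive tens_rel.
Proof. by move=> s; apply/asboolP; apply: tens_refl. Qed.
Fact tens_rel_sym : symmetric tens_rel.
Proof. by move=> s t; apply/asboolP/asboolP => /tens_sym. Qed.
Fact tens_rel_trans : transitive tens_rel.
Proof.
by move=> s t u /asboolP h /asboolP h'; apply/asboolP; apply: tens_trans h h'.
Qed.
Canonical tens_equiv :=
  EquivRel tens_rel tens_rel_refl tens_rel_sym tens_rel_trans.

Definition tens_sort := {eq_quot tens_equiv}.
HB.instance Definition _ := Choice.on tens_sort.
HB.instance Definition _ := EqQuotient.on tens_sort.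

Lemma tens_piP s t : tens_eqv s t <-> \pi_tens_sort s = \pi_tens_sort t.
Proof. by split=> [h|/eqmodP/asboolP//]; apply/eqmodP/asboolP. Qed.
Lemma tens_reprP s : tens_eqv (repr (\pi_tens_sort s)) s.
Proof. by apply/tens_piP; rewrite reprK. Qed.

Definition tens0 : tens_sort := \pi_tens_sort [::].
Definition tensD (s t : tens_sort) : tens_sort := \pi_tens_sort (repr s ++ repr t).
Definition tensN (s : tens_sort) : tens_sort :=
  \pi_tens_sort [seq (- p.1, p.2) | p <- repr s].

Lemma tensD_pi s t :
  tensD (\pi_tens_sort s) (\pi_tens_sort t) = \pi_tens_sort (s ++ t).
Proof. by apply/tens_piP; apply: tens_cat; apply: tens_reprP. Qed.

Fact tensDA : associative tensD.
Proof.
move=> s t u; elim/quotW: s => s; elim/quotW: t => t; elim/quotW: u => u.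
by rewrite (tensD_pi t u) (tensD_pi s t) (tensD_pi s) (tensD_pi _ u) catA.
Qed.
Fact tensDC : commutative tensD.
Proof.
move=> s t; elim/quotW: s => s; elim/quotW: t => t.
rewrite (tensD_pi s t) (tensD_pi t s).
by apply/tens_piP; apply: tens_comm.
Qed.
Fact tens0D : left_id tens0 tensD.
Proof. by move=> s; elim/quotW: s => s; rewrite (tensD_pi [::] s). Qed.
Fact tensND : left_inverse tens0 tensN tensD.
Proof.
move=> t; rewrite -{2}[t]reprK /tensN tensD_pi.
apply/tens_piP; elim: (repr t) => [|[x y] s IHs] /=; first exact: tens_refl.
set s' := map _ _ in IHs *.
apply: tens_trans (_ : tens_eqv ([:: (- x, y); (x, y)] ++ (s' ++ s)) _).
  rewrite -[_ ++ _ in X in tens_eqv _ X]/([:: (- x, y)] ++ ([:: _] ++ (s' ++ s))).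
  apply: (@tens_cat [:: _] [:: _]); first exact: tens_refl.
  rewrite -[_ :: s]cat1s !catA; apply: tens_cat; last exact: tens_refl.
  exact: tens_comm.
rewrite -[X in tens_eqv _ X]cats0.
apply: (tens_trans (tens_comm _ _)); apply: tens_cat => //.
apply: tens_trans (tens_zero y).
by rewrite -(addNr x); apply: tens_sym; apply: tens_addl.
Qed.
HB.instance Definition _ :=
  GRing.isZmodule.Build tens_sort tensDA tensDC tens0D tensND.

Definition pure_tens (x : M) (y : N) : tens_sort := \pi_tens_sort [:: (x, y)].

Lemma tens_piE s : \pi_tens_sort s = \sum_(p <- s) pure_tens p.1 p.2.
Proof.
elim: s => [|[x y] s IHs]; first by rewrite big_nil.
rewrite big_cons -IHs; exact: esym (tensD_pi [:: (x, y)] s).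
Qed.
Lemma tens_reprE t : t = \sum_(p <- repr t) pure_tens p.1 p.2.
Proof. by rewrite -tens_piE reprK. Qed.
Lemma tens_ind (P : tens_sort -> Prop) :
  P 0 -> (forall s t, P s -> P t -> P (s + t)) ->
  (forall x y, P (pure_tens x y)) -> forall t, P t.
Proof. by move=> P0 PD Pp t; rewrite (tens_reprE t); apply: big_ind. Qed.

Lemma pure_tensDl x x' y :
  pure_tens (x + x') y = pure_tens x y + pure_tens x' y.
Proof.
apply: etrans (esym (tensD_pi [:: _] [:: _])).
by apply/tens_piP/tens_addl.
Qed.
Lemma pure_tensDr x y y' :
  pure_tens x (y + y') = pure_tens x y + pure_tens x y'.
Proof.
apply: etrans (esym (tensD_pi [:: _] [:: _])).
by apply/tens_piP/tens_addr.
Qed.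
Lemma pure_tens0l y : pure_tens 0 y = 0.
Proof. by apply: (addrI (pure_tens 0 y)); rewrite -pure_tensDl !addr0. Qed.
Lemma pure_tens0r x : pure_tens x 0 = 0.
Proof. by apply: (addrI (pure_tens x 0)); rewrite -pure_tensDr !addr0. Qed.
Lemma pure_tens_bal x b y : pure_tens (x <* b) y = pure_tens x (b *> y).
Proof. by apply/tens_piP/tens_bal. Qed.

Definition balanced (G : zmodType) (f : M -> N -> G) :=
  [/\ forall x x' y, f (x + x') y = f x y + f x' y,
      forall x y y', f x (y + y') = f x y + f x y'
    & forall x b y, f (x <* b) y = f x (b *> y)].

Definition tens_lift (G : zmodType) (f : M -> N -> G) (t : tens_sort) : G :=
  \sum_(p <- repr t) f p.1 p.2.

Section Lift.
Variables (G : zmodType) (f : M -> N -> G) (f_bal : balanced f).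

Lemma tens_lift_pi s :
  tens_lift f (\pi_tens_sort s) = \sum_(p <- s) f p.1 p.2.
Proof.
case: f_bal => fDl fDr fB; rewrite /tens_lift.
have sumE u v : tens_eqv u v ->
    \sum_(p <- u) f p.1 p.2 = \sum_(p <- v) f p.1 p.2.
  elim=> // {u v} [s1 t u _ -> _ -> //|s1 s' t t' _ es _ et|s1 t
    |y|x x' y|x y y'|x b y]; rewrite ?big_cat /= ?big_cons ?big_nil ?addr0 //=.
  - by rewrite es et.
  - by rewrite addrC.
  - by apply: (addrI (f 0 y)); rewrite -fDl !addr0.
exact: sumE (tens_reprP s).
Qed.
Lemma tens_liftD : {morph tens_lift f : s t / s + t}.
Proof.
move=> s t; elim/quotW: s => s; elim/quotW: t => t.
by rewrite [_ + _](tensD_pi s t) !tens_lift_pi big_cat.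
Qed.
Lemma tens_liftE x y : tens_lift f (pure_tens x y) = f x y.
Proof. by rewrite tens_lift_pi big_seq1. Qed.
Lemma tens_lift0 : tens_lift f 0 = 0.
Proof. by rewrite [LHS](tens_lift_pi [::]) big_nil. Qed.
End Lift.

Lemma tens_lact_bal a : balanced (fun x y => pure_tens (a *> x) y).
Proof.
split=> [x x' y|x y y'|x b y].
- by rewrite lactDr pure_tensDl.
- exact: pure_tensDr.
- by rewrite lractA pure_tens_bal.
Qed.
Lemma tens_ract_bal d : balanced (fun x y => pure_tens x (y <* d)).
Proof.
split=> [x x' y|x y y'|x b y].
- exact: pure_tensDl.
- by rewrite ractDl pure_tensDr.
- by rewrite -lractA pure_tens_bal.
Qed.
Definition tens_lact (a : A) := tens_lift (fun x y => pure_tens (a *> x) y).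
Definition tens_ract t (d : D) := tens_lift (fun x y => pure_tens x (y <* d)) t.

Let lactE a x y : tens_lact a (pure_tens x y) = pure_tens (a *> x) y.
Proof. exact: tens_liftE (tens_lact_bal a) x y. Qed.
Let ractE x y d : tens_ract (pure_tens x y) d = pure_tens x (y <* d).
Proof. exact: tens_liftE (tens_ract_bal d) x y. Qed.
Let lactD a : {morph tens_lact a : s t / s + t}.
Proof. exact: tens_liftD (tens_lact_bal a). Qed.
Let ractD d : {morph tens_ract^~ d : s t / s + t}.
Proof. exact: tens_liftD (tens_ract_bal d). Qed.
Let lact0 a : tens_lact a 0 = 0.
Proof. exact: tens_lift0 (tens_lact_bal a). Qed.
Let ract0 d : tens_ract 0 d = 0.
Proof. exact: tens_lift0 (tens_ract_bal d). Qed.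

Fact tensor_bimodP : bimod_axioms tens_lact tens_ract.
Proof.
split; [split|split| |] => //.
- move=> a b; elim/tens_ind => [|s t es et|x y]; rewrite ?lact0 ?addr0 //.
    by rewrite !lactD es et addrACA.
  by rewrite !lactE lactDl pure_tensDl.
- move=> a b; elim/tens_ind => [|s t es et|x y]; rewrite ?lact0 //.
    by rewrite !lactD es et.
  by rewrite !lactE lactM.
- elim/tens_ind => [|s t es et|x y]; rewrite ?lact0 //.
    by rewrite lactD es et.
  by rewrite lactE lact1.
- move=> + a b; elim/tens_ind => [|s t es et|x y]; rewrite ?ract0 ?addr0 //.
    by rewrite !ractD es et addrACA.
  by rewrite !ractE ractDr pure_tensDr.
- move=> + a b; elim/tens_ind => [|s t es et|x y]; rewrite ?ract0 //.
    by rewrite !ractD es et.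
  by rewrite !ractE ractM.
- elim/tens_ind => [|s t es et|x y]; rewrite ?ract0 //.
    by rewrite ractD es et.
  by rewrite ractE ract1.
- move=> a + b; elim/tens_ind => [|s t es et|x y].
  + by rewrite ract0 !lact0 ract0.
  + by rewrite !(ractD, lactD) es et.
  + by rewrite ractE !lactE ractE.
- move=> c; elim/tens_ind => [|s t es et|x y]; rewrite ?ract0 ?lact0 //.
    by rewrite ractD lactD es et.
  by rewrite ractE lactE lract_base pure_tens_bal lract_base.
Qed.

Definition tensor : bimod A D := Bimod tensor_bimodP.

Lemma tensor_lactE a x y :
  a *> (pure_tens x y : tensor) = pure_tens (a *> x) y.
Proof. exact: lactE. Qed.
Lemma tensor_ractE x y d :
  (pure_tens x y : tensor) <* d = pure_tens x (y <* d).
Proof. exact: ractE. Qed.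
End Tensor.
Notation "M ⊗ N" := (tensor M N) : bimod_scope.
Notation "x ⊗' y" := (pure_tens x y : _ ⊗ _) : bimod_scope.

Section TensorHom.
Variables (k : comPzRingType) (A B D : kalg k).
Variables (M : bimod A B) (N : bimod B D) (P : bimod A D) (f : M -> N -> P).
Hypothesis f_bal : balanced f.
Hypothesis f_lact : forall a x y, f (a *> x) y = a *> f x y.
Hypothesis f_ract : forall x y d, f x (y <* d) = f x y <* d.

Fact tens_lift_lact a (t : M ⊗ N) : tens_lift f (a *> t) = a *> tens_lift f t.
Proof.
elim/tens_ind: t => [|s t es et|x y].
- by rewrite lact0 (tens_lift0 f_bal) lact0.
- by rewrite lactDr !(tens_liftD f_bal) lactDr es et.
- by rewrite tensor_lactE !(tens_liftE f_bal).
Qed.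
Fact tens_lift_ract (t : M ⊗ N) d : tens_lift f (t <* d) = tens_lift f t <* d.
Proof.
elim/tens_ind: t => [|s t es et|x y].
- by rewrite ract0 (tens_lift0 f_bal) ract0.
- by rewrite ractDl !(tens_liftD f_bal) ractDl es et.
- by rewrite tensor_ractE !(tens_liftE f_bal).
Qed.
Definition tens_hom : bihom (M ⊗ N) P :=
  @Bihom _ _ _ (M ⊗ N) P (tens_lift f)
    (tens_liftD f_bal) tens_lift_lact tens_lift_ract.
Lemma tens_homE x y : tens_hom (x ⊗' y) = f x y.
Proof. exact: tens_liftE. Qed.
End TensorHom.

Section TensorMap.
Variables (k : comPzRingType) (A B D : kalg k).
Variables (M M' : bimod A B) (N N' : bimod B D).
Variables (f : bihom M M') (g : bihom N N').

Let fg (x : M) (y : N) : M' ⊗ N' := f x ⊗' g y.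
Fact tens_map_bal : balanced fg.
Proof.
split=> [x x' y|x y y'|x b y]; rewrite /fg.
- by rewrite raddfD; exact: pure_tensDl.
- by rewrite raddfD; exact: pure_tensDr.
- by rewrite bihom_ract bihom_lact; exact: pure_tens_bal.
Qed.
Fact tens_map_lact a x y : fg (a *> x) y = a *> fg x y.
Proof. by rewrite /fg tensor_lactE bihom_lact. Qed.
Fact tens_map_ract x y d : fg x (y <* d) = fg x y <* d.
Proof. by rewrite /fg tensor_ractE bihom_ract. Qed.
Definition tens_map : bihom (M ⊗ N) (M' ⊗ N') :=
  tens_hom tens_map_bal tens_map_lact tens_map_ract.
Lemma tens_mapE x y : tens_map (x ⊗' y) = f x ⊗' g y.
Proof. exact: tens_homE. Qed.
End TensorMap.
Notation "f ⊗₁ g" := (tens_map f g) : bimod_scope.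

Section Associator.
Variables (k : comPzRingType) (A B D E : kalg k).
Variables (M : bimod A B) (N : bimod B D) (P : bimod D E).

Let r (z : P) (x : M) (y : N) : M ⊗ (N ⊗ P) := x ⊗' (y ⊗' z).
Let r_bal z : balanced (r z).
Proof.
split=> [x x' y|x y y'|x b y]; rewrite /r.
- exact: pure_tensDl.
- by rewrite (pure_tensDl y y' z); exact: pure_tensDr.
- by rewrite pure_tens_bal tensor_lactE.
Qed.
Let R (t : M ⊗ N) (z : P) : M ⊗ (N ⊗ P) := tens_lift (r z) t.
Let RE x y z : R (x ⊗' y) z = x ⊗' (y ⊗' z).
Proof. exact: tens_liftE (r_bal z) x y. Qed.
Let RD z : {morph R^~ z : s t / s + t}.
Proof. exact: tens_liftD (r_bal z). Qed.
Let R0 z : R 0 z = 0.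
Proof. exact: tens_lift0 (r_bal z). Qed.
Fact tassoc_bal : balanced R.
Proof.
split=> [s t z|t z z'|t d z]; first exact: RD.
  elim/tens_ind: t => [|s t es et|x y]; rewrite ?R0 ?addr0 //.
    by rewrite !RD es et addrACA.
  by rewrite !RE pure_tensDr (pure_tensDr x).
elim/tens_ind: t => [|s t es et|x y]; rewrite ?ract0 ?R0 //.
  by rewrite ractDl !RD es et.
by rewrite tensor_ractE !RE (pure_tens_bal y).
Qed.
Fact tassoc_lact a t z : R (a *> t) z = a *> R t z.
Proof.
elim/tens_ind: t => [|s t es et|x y]; rewrite ?lact0 ?R0 ?lact0 //.
  by rewrite lactDr !RD es et lactDr.
by rewrite tensor_lactE !RE tensor_lactE.
Qed.
Fact tassoc_ract t z e : R t (z <* e) = R t z <* e.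
Proof.
elim/tens_ind: t => [|s t es et|x y]; rewrite ?R0 ?ract0 //.
  by rewrite !RD es et ractDl.
by rewrite !RE !tensor_ractE.
Qed.
Definition tassoc : bihom (M ⊗ N ⊗ P) (M ⊗ (N ⊗ P)) :=
  tens_hom tassoc_bal tassoc_lact tassoc_ract.
Lemma tassocE x y z : tassoc ((x ⊗' y) ⊗' z) = x ⊗' (y ⊗' z).
Proof. by rewrite [LHS]tens_homE RE. Qed.

Let l (x : M) (y : N) (z : P) : M ⊗ N ⊗ P := (x ⊗' y) ⊗' z.
Let l_bal x : balanced (l x).
Proof.
split=> [y y' z|y z z'|y d z]; rewrite /l.
- by rewrite (pure_tensDr x y y'); exact: pure_tensDl.
- exact: pure_tensDr.
- by rewrite -tensor_ractE; exact: pure_tens_bal.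
Qed.
Let L (x : M) (t : N ⊗ P) : M ⊗ N ⊗ P := tens_lift (l x) t.
Let LE x y z : L x (y ⊗' z) = (x ⊗' y) ⊗' z.
Proof. exact: tens_liftE (l_bal x) y z. Qed.
Let LD x : {morph L x : s t / s + t}.
Proof. exact: tens_liftD (l_bal x). Qed.
Let L0 x : L x 0 = 0.
Proof. exact: tens_lift0 (l_bal x). Qed.
Fact tassocV_bal : balanced L.
Proof.
split=> [x x' t|x s t|x b t]; last 2 [exact: LD] => //.
  elim/tens_ind: t => [|s t es et|y z]; rewrite ?L0 ?addr0 //.
    by rewrite !LD es et addrACA.
  by rewrite !LE pure_tensDl (pure_tensDl _ _ z).
elim/tens_ind: t => [|s t es et|y z]; rewrite ?lact0 ?L0 //.
  by rewrite lactDr !LD es et.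
by rewrite tensor_lactE !LE (pure_tens_bal x).
Qed.
Fact tassocV_lact a x t : L (a *> x) t = a *> L x t.
Proof.
elim/tens_ind: t => [|s t es et|y z]; rewrite ?L0 ?lact0 //.
  by rewrite !LD es et lactDr.
by rewrite !LE !tensor_lactE.
Qed.
Fact tassocV_ract x t e : L x (t <* e) = L x t <* e.
Proof.
elim/tens_ind: t => [|s t es et|y z]; rewrite ?ract0 ?L0 ?ract0 //.
  by rewrite ractDl !LD es et ractDl.
by rewrite tensor_ractE !LE tensor_ractE.
Qed.
Definition tassocV : bihom (M ⊗ (N ⊗ P)) (M ⊗ N ⊗ P) :=
  tens_hom tassocV_bal tassocV_lact tassocV_ract.
Lemma tassocVE x y z : tassocV (x ⊗' (y ⊗' z)) = (x ⊗' y) ⊗' z.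
Proof. by rewrite [LHS]tens_homE LE. Qed.
End Associator.

Section Unitors.
Variables (k : comPzRingType).

Section Regular.
Variable A : kalg k.
Fact regular_bimodP :
  @bimod_axioms k A A A (fun a x => a * x) (fun x b => x * b).
Proof.
split; [split|split| |].
- by move=> a x y; rewrite mulrDr.
- by move=> a b x; rewrite mulrDl.
- by move=> a b x; rewrite mulrA.
- by move=> x; rewrite mul1r.
- by move=> b x y; rewrite mulrDl.
- by move=> x b c; rewrite mulrDr.
- by move=> x b c; rewrite mulrA.
- by move=> x; rewrite mulr1.
- by move=> a x b; rewrite mulrA.
- by move=> c x; exact: kalg_central.
Qed.
Definition regular_bimod : bimod A A := Bimod regular_bimodP.
End Regular.

Variables (A B : kalg k) (M : bimod A B).

Fact lunit_bal : balanced (fun (a : regular_bimod A) (x : M) => (a : A) *> x).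
Proof.
by split=> *; [exact: lactDl | exact: lactDr | exact: lactM].
Qed.
Definition lunit : bihom (regular_bimod A ⊗ M) M :=
  tens_hom lunit_bal (fun a b x => lactM a b x) (fun a x b => lractA a x b).

Fact runit_bal : balanced (fun (x : M) (b : regular_bimod B) => x <* (b : B)).
Proof.
by split=> *; [exact: ractDl | exact: ractDr | symmetry; exact: ractM].
Qed.
Definition runit : bihom (M ⊗ regular_bimod B) M :=
  tens_hom runit_bal (fun a x b => esym (lractA a x b)) (fun x b c => ractM b c x).
End Unitors.

Definition lflat (k : comPzRingType) (A B : kalg k) (M : bimod A B) : Prop :=
  forall (P Q S : bimod (base_kalg k) A) (f : bihom P Q) (g : bihom Q S),
    exact_pair f g -> exact_pair (f ⊗₁ idb M) (g ⊗₁ idb M).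

Definition rflat (k : comPzRingType) (A B : kalg k) (M : bimod A B) : Prop :=
  forall (P Q S : bimod B (base_kalg k)) (f : bihom P Q) (g : bihom Q S),
    exact_pair f g -> exact_pair (idb M ⊗₁ f) (idb M ⊗₁ g).

Definition von_neumann_regular (A : pzRingType) : Prop :=
  forall a : A, exists b : A, a * b * a = a.

Definition is_coring (k : comPzRingType) (A : kalg k) (C : bimod A A)
    (Delta : bihom C (C ⊗ C)) (eps : bihom C (regular_bimod A)) : Prop :=
  [/\ tassoc C C C ∘ (Delta ⊗₁ idb C) ∘ Delta =1 (idb C ⊗₁ Delta) ∘ Delta,
      lunit C ∘ (eps ⊗₁ idb C) ∘ Delta =1 idb C
    & runit C ∘ (idb C ⊗₁ eps) ∘ Delta =1 idb C].

Record coring (k : comPzRingType) (A : kalg k) := Coring {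
  coring_bimod :> bimod A A;
  cdelta : bihom coring_bimod (coring_bimod ⊗ coring_bimod);
  ceps : bihom coring_bimod (regular_bimod A);
  coringP : is_coring cdelta ceps
}.
Arguments cdelta {k A} c.
Arguments ceps {k A} c.

Section Coactions.
Variables (k : comPzRingType) (A B : kalg k).

Definition is_rcoaction (C : coring B) (M : bimod A B)
    (rho : bihom M (M ⊗ C)) : Prop :=
  tassoc M C C ∘ (rho ⊗₁ idb C) ∘ rho =1 (idb M ⊗₁ cdelta C) ∘ rho
  /\ runit M ∘ (idb M ⊗₁ ceps C) ∘ rho =1 idb M.

Definition is_lcoaction (C : coring A) (M : bimod A B)
    (lam : bihom M (C ⊗ M)) : Prop :=
  tassoc C C M ∘ (cdelta C ⊗₁ idb M) ∘ lam =1 (idb C ⊗₁ lam) ∘ lam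
  /\ lunit M ∘ (ceps C ⊗₁ idb M) ∘ lam =1 idb M.

Definition is_rcolinear (C : coring B) (M N : bimod A B)
    (rhoM : bihom M (M ⊗ C)) (rhoN : bihom N (N ⊗ C)) (f : bihom M N) : Prop :=
  rhoN ∘ f =1 (f ⊗₁ idb C) ∘ rhoM.

Definition is_lcolinear (C : coring A) (M N : bimod A B)
    (lamM : bihom M (C ⊗ M)) (lamN : bihom N (C ⊗ N)) (f : bihom M N) : Prop :=
  lamN ∘ f =1 (idb C ⊗₁ f) ∘ lamM.
End Coactions.

(* Coaction data without the comodule axioms: a cotensor product always has such
   data, but it is a bicomodule only under flatness or coseparability
   assumptions. *)
Record prebicomod (k : comPzRingType) (A B : kalg k)
    (C : coring A) (D : coring B) := Prebicomod {
  prebicomod_bimod :> bimod A B;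
  lcoact : bihom prebicomod_bimod (C ⊗ prebicomod_bimod);
  rcoact : bihom prebicomod_bimod (prebicomod_bimod ⊗ D)
}.
Arguments lcoact {k A B C D} p.
Arguments rcoact {k A B C D} p.

Definition is_bicomod (k : comPzRingType) (A B : kalg k)
    (C : coring A) (D : coring B) (M : prebicomod C D) : Prop :=
  [/\ is_lcoaction (lcoact M), is_rcoaction (rcoact M)
    & tassoc C M D ∘ (lcoact M ⊗₁ idb D) ∘ rcoact M
        =1 (idb C ⊗₁ rcoact M) ∘ lcoact M].

Record bicomod (k : comPzRingType) (A B : kalg k)
    (C : coring A) (D : coring B) := Bicomod {
  bicomod_pre :> prebicomod C D;
  bicomodP : is_bicomod bicomod_pre
}.

Definition is_bicolinear (k : comPzRingType) (A B : kalg k)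
    (C : coring A) (D : coring B) (M N : prebicomod C D) (f : bihom M N) : Prop :=
  is_lcolinear (lcoact M) (lcoact N) f /\ is_rcolinear (rcoact M) (rcoact N) f.

Section CoringBicomod.
Variables (k : comPzRingType) (A : kalg k) (C : coring A).

Fact coring_bicomodP : is_bicomod (Prebicomod (cdelta C) (cdelta C)).
Proof. by case: (coringP C). Qed.
Definition coring_bicomod : bicomod C C := Bicomod coring_bicomodP.

Definition coring_square : prebicomod C C :=
  @Prebicomod _ _ _ C C (C ⊗ C)
    (tassoc C C C ∘ (cdelta C ⊗₁ idb C))
    (tassocV C C C ∘ (idb C ⊗₁ cdelta C)).

Definition coseparable : Prop :=
  exists2 p : bihom (C ⊗ C) C,
    is_bicolinear (M := coring_square) (N := coring_bicomod) p
    & p ∘ cdelta C =1 idb C.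
End CoringBicomod.

Section CotensorKernel.
Variables (k : comPzRingType) (A B D : kalg k) (C : coring B).

Section Object.
Variables (M : bimod A B) (N : bimod B D).
Variables (rho : bihom M (M ⊗ C)) (lam : bihom N (C ⊗ N)).
Definition cotens_diff : bihom (M ⊗ N) (M ⊗ (C ⊗ N)) :=
  bihom_sub (tassoc M C N ∘ (rho ⊗₁ idb N)) (idb M ⊗₁ lam).
Definition cotens_bimod : bimod A D := ker cotens_diff.
Definition cotens_incl : bihom cotens_bimod (M ⊗ N) := ker_incl cotens_diff.
End Object.

(* When f and g are colinear, this is the restriction of [f ⊗₁ g]. *)
Definition cotens_map_of (M M' : bimod A B) (N N' : bimod B D)
    (rho : bihom M (M ⊗ C)) (rho' : bihom M' (M' ⊗ C))
    (lam : bihom N (C ⊗ N)) (lam' : bihom N' (C ⊗ N'))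
    (f : bihom M M') (g : bihom N N') :
    bihom (cotens_bimod rho lam) (cotens_bimod rho' lam') :=
  corestr (cotens_incl rho' lam') ((f ⊗₁ g) ∘ cotens_incl rho lam).

Lemma cotens_map_ofE (M M' : bimod A B) (N N' : bimod B D)
    (rho : bihom M (M ⊗ C)) (rho' : bihom M' (M' ⊗ C))
    (lam : bihom N (C ⊗ N)) (lam' : bihom N' (C ⊗ N'))
    (f : bihom M M') (g : bihom N N') :
    is_rcolinear rho rho' f -> is_lcolinear lam lam' g ->
  cotens_incl rho' lam' \o cotens_map_of rho rho' lam lam' f g
    =1 (f ⊗₁ g) ∘ cotens_incl rho lam.
Proof.
move=> fP gP; apply: corestr_kerE => -[t /= t_ker].
have t0 : cotens_diff rho lam t = 0 by apply/eqP; exact: t_ker.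
suff sq u : cotens_diff rho' lam' ((f ⊗₁ g) u)
    = (f ⊗₁ (idb C ⊗₁ g)) (cotens_diff rho lam u).
  by apply: etrans (sq t) _; rewrite t0 raddf0.
elim/tens_ind: u => [|u v eu ev|x y]; first by rewrite !raddf0.
  by rewrite (bihomD (cotens_diff rho lam)) 3!bihomD eu ev.
have diffE M1 N1 (r : bihom M1 (M1 ⊗ C)) (l : bihom N1 (C ⊗ N1)) z :
    cotens_diff r l z = tassoc _ _ _ ((r ⊗₁ idb _) z) - (idb _ ⊗₁ l) z by [].
rewrite !diffE bihomB !tens_mapE [rho' (f x)]fP [lam' (g y)]gP.
congr (_ - _).
change (tassoc M' C N' ((f ⊗₁ idb C) (rho x) ⊗' g y)
  = (f ⊗₁ (idb C ⊗₁ g)) (tassoc M C N (rho x ⊗' y))).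
elim/tens_ind: (rho x) => [|u v eu ev|m c].
- by rewrite (raddf0 (f ⊗₁ idb C)) !pure_tens0l !raddf0.
- by rewrite (bihomD (f ⊗₁ idb C)) !pure_tensDl !(bihomD (tassoc _ _ _)) eu ev bihomD.
- by rewrite !tens_mapE !tassocE !tens_mapE.
Qed.
End CotensorKernel.

(* Exactness in the category of right C-comodules is exactness of the underlying
   modules when C is flat as a left A-module, the setting of this definition. *)
Definition coflat (k : comPzRingType) (A B : kalg k) (C : coring A)
    (N : bimod A B) (lam : bihom N (C ⊗ N)) : Prop :=
  forall (P Q S : bimod (base_kalg k) A)
    (rhoP : bihom P (P ⊗ C)) (rhoQ : bihom Q (Q ⊗ C)) (rhoS : bihom S (S ⊗ C))
    (f : bihom P Q) (g : bihom Q S),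
    is_rcoaction rhoP -> is_rcoaction rhoQ -> is_rcoaction rhoS ->
    is_rcolinear rhoP rhoQ f -> is_rcolinear rhoQ rhoS g ->
    exact_pair f g ->
    exact_pair (cotens_map_of rhoP rhoQ lam lam f (idb N))
               (cotens_map_of rhoQ rhoS lam lam g (idb N)).

Section Cotensor.
Variables (k : comPzRingType) (A B E : kalg k).
Variables (C : coring A) (D : coring B) (F : coring E).
Variables (M : prebicomod C D) (N : prebicomod D F).

Let incl := cotens_incl (rcoact M) (lcoact N).

(* The coactions are induced by the left coaction of M and the right coaction
   of N: they are the corestrictions along C ⊗ (M □ N) -> C ⊗ (M ⊗ N) and along
   (M □ N) ⊗ F -> (M ⊗ N) ⊗ F, which are monomorphisms when C and F are flat on
   the appropriate sides, or when D is coseparable. *)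
Definition cotens : prebicomod C F :=
  @Prebicomod _ _ _ C F (cotens_bimod (rcoact M) (lcoact N))
    (corestr (idb C ⊗₁ incl) (tassoc C M N ∘ (lcoact M ⊗₁ idb N) ∘ incl))
    (corestr (incl ⊗₁ idb F) (tassocV M N F ∘ (idb M ⊗₁ rcoact N) ∘ incl)).

Definition cot_incl : bihom cotens (M ⊗ N) := incl.
End Cotensor.
Notation "M □ N" := (cotens M N) : bimod_scope.

Definition cotens_map (k : comPzRingType) (A B E : kalg k)
    (C : coring A) (D : coring B) (F : coring E)
    (M M' : prebicomod C D) (N N' : prebicomod D F)
    (f : bihom M M') (g : bihom N N') : bihom (M □ N) (M' □ N') :=
  cotens_map_of (rcoact M) (rcoact M') (lcoact N) (lcoact N') f g.
Notation "f □₁ g" := (cotens_map f g) : bimod_scope.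

Section CotensorAssoc.
Variables (k : comPzRingType) (A B E G : kalg k).
Variables (C : coring A) (D : coring B) (F : coring E) (H : coring G).
Variables (M : prebicomod C D) (N : prebicomod D F) (P : prebicomod F H).

Definition cot_incl_r : bihom (M □ (N □ P)) (M ⊗ (N ⊗ P)) :=
  (idb M ⊗₁ cot_incl N P) ∘ cot_incl M (N □ P).
Definition cot_incl_l : bihom ((M □ N) □ P) (M ⊗ (N ⊗ P)) :=
  tassoc M N P ∘ (cot_incl M N ⊗₁ idb P) ∘ cot_incl (M □ N) P.

(* The canonical isomorphisms are the ones compatible with the maps to the
   triple tensor product. *)
Definition cot_assoc : bihom ((M □ N) □ P) (M □ (N □ P)) :=
  corestr cot_incl_r cot_incl_l.
Definition cot_assocV : bihom (M □ (N □ P)) ((M □ N) □ P) :=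
  corestr cot_incl_l cot_incl_r.
End CotensorAssoc.

Section CotensorUnit.
Variables (k : comPzRingType) (A B : kalg k).
Variables (C : coring A) (D : coring B) (M : prebicomod C D).

Definition cot_runit : bihom M (M □ coring_bicomod D) :=
  corestr (cot_incl M (coring_bicomod D)) (rcoact M).
Definition cot_lunit : bihom M (coring_bicomod C □ M) :=
  corestr (cot_incl (coring_bicomod C) M) (lcoact M).
End CotensorUnit.

Lemma cot_runitE (k : comPzRingType) (A B : kalg k) (C : coring A) (D : coring B)
    (M : bicomod C D) :
  cot_incl M (coring_bicomod D) \o cot_runit M =1 rcoact M.
Proof.
have [_ [coassoc _] _] := bicomodP M.
by apply: corestr_kerE => x; apply/eqP; rewrite subr_eq0; apply/eqP/coassoc.
Qed.

Lemma cot_lunitE (k : comPzRingType) (A B : kalg k) (C : coring A) (D : coring B)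
    (M : bicomod C D) :
  cot_incl (coring_bicomod C) M \o cot_lunit M =1 lcoact M.
Proof.
have [[coassoc _] _ _] := bicomodP M.
by apply: corestr_kerE => x; apply/eqP; rewrite subr_eq0; apply/eqP/coassoc.
Qed.

(* Main.v *)
(* Write i for the inclusion of E = Λ □ X into Λ ⊗ X. The bicolinear map psi makes
   X a right E-comodule through x |-> psi(x_(-1)) ⊗ x_(0), which takes values in
   X ⊗ E, and the coproduct of E is the restriction of Λ ⊗ (this coaction). After
   embedding E ⊗ E ⊗ E into the tensor power of Λ ⊗ X, coassociativity is left
   colinearity of psi; the two counit laws are the two triangle identities.

   All of this requires that tensoring preserve the kernels defining E and
   X □ Λ, and that E, X and Λ be admissible right factors. Under (3) these kernels
   are split by the cointegral of the coseparable coring. Under (2) every module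
   is flat. Under (1), coflatness of X yields P ⊗ (Λ □ X) = (P ⊗ Λ) □ X for every
   P, by comparison with finite free modules. *)
Require Import Defs.
From HB Require Import structures.
From mathcomp Require Import all_boot all_algebra.
From mathcomp Require Import boolp.

Set Implicit Arguments.
Unset Strict Implicit.
Unset Printing Implicit Defensive.

Import GRing.Theory.
Local Open Scope ring_scope.
Local Open Scope bimod_scope.

(** * Calculus of tensor products of bimodules *)

(** The coactions of a cotensor product, the associators and the maps [f □₁ g] are all
    corestrictions, with a meaningless default when no corestriction exists. So no arrow of the
    coproduct can be computed before the kernels concerned are known to survive tensoring and the
    maps under [□₁] are known to be colinear. After that, identities are compared under injective
    maps into iterated tensor products, where coactions on different factors commute and naturality
    and the pentagon do the rest. Cotensor products remain prebicomodules throughout, described by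
    formulas for their coactions.

    The three conditions are reconciled by an asymmetry between the sides: kernels have to survive
    arbitrary bimodules on the left, but on the right only C, D, X, Λ, E and tensor products of
    these. Splitting gives this, and so does purity combined with left flatness. Flatness and purity
    are tested on one-sided modules, so further actions are absorbed by reassociating or by
    restricting scalars to k. *)

Section TensorCalculus.
Variable k : comPzRingType.

Lemma tens_ext (A B D : kalg k) (M : bimod A B) (N : bimod B D) (G : zmodType)
    (f g : M ⊗ N -> G) :
    {morph f : s t / s + t} -> {morph g : s t / s + t} ->
  (forall x y, f (x ⊗' y) = g (x ⊗' y)) -> f =1 g.
Proof.
move=> fD gD fg; have f0 (h : M ⊗ N -> G) : {morph h : s t / s + t} -> h 0 = 0.
  by move=> hD; apply: (addrI (h 0)); rewrite -hD !addr0.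
by elim/tens_ind=> [|s t es et|x y]; rewrite ?f0 ?fD ?gD ?es ?et ?fg.
Qed.

Lemma bicompD (A B : kalg k) (M N P : bimod A B) (f : bihom M N) (g : bihom N P) :
  {morph (fun x => g (f x)) : s t / s + t}.
Proof. by move=> s t; rewrite !bihomD. Qed.

Lemma bihom_tens_ext (A B D : kalg k) (M : bimod A B) (N : bimod B D)
    (P : bimod A D) (f g : bihom (M ⊗ N) P) :
  (forall x y, f (x ⊗' y) = g (x ⊗' y)) -> f =1 g.
Proof. exact: tens_ext (bihomD f) (bihomD g). Qed.

Lemma bicompE (A B : kalg k) (M N P : bimod A B) (f : bihom M N) (g : bihom N P) x :
  (g ∘ f) x = g (f x).
Proof. by []. Qed.

Lemma pure_tensBl (A B D : kalg k) (M : bimod A B) (N : bimod B D) (x x' : M) (y : N) :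
  (x - x') ⊗' y = x ⊗' y - x' ⊗' y.
Proof. by apply: (addIr (x' ⊗' y)); rewrite subrK -[LHS]pure_tensDl subrK. Qed.

Lemma pure_tensBr (A B D : kalg k) (M : bimod A B) (N : bimod B D) (x : M) (y y' : N) :
  x ⊗' (y - y') = x ⊗' y - x ⊗' y'.
Proof. by apply: (addIr (x ⊗' y')); rewrite subrK -[LHS]pure_tensDr subrK. Qed.

Lemma bihomN (A B : kalg k) (M N : bimod A B) (f : bihom M N) : {morph f : x / - x}.
Proof. exact: raddfN. Qed.

Section MapComp.
Variables A B D : kalg k.
Variables (M M' M'' : bimod A B) (N N' N'' : bimod B D).

Lemma tens_map_comp (f : bihom M M') (f' : bihom M' M'')
    (g : bihom N N') (g' : bihom N' N'') t :
  (f' ⊗₁ g') ((f ⊗₁ g) t) = ((f' ∘ f) ⊗₁ (g' ∘ g)) t.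
Proof.
apply: (bihom_tens_ext (f := (f' ⊗₁ g') ∘ (f ⊗₁ g))) => x y.
by rewrite bicompE !tens_mapE.
Qed.

End MapComp.

Section Maps1.
Variables A B D : kalg k.
Variables (M M' : bimod A B) (N N' : bimod B D).

Lemma tens_map_id (t : M ⊗ N) : (idb M ⊗₁ idb N) t = t.
Proof.
by apply: (bihom_tens_ext (g := idb (M ⊗ N))) => x y; rewrite !tens_mapE.
Qed.

Lemma eq_tens_map (f f' : bihom M M') (g g' : bihom N N') :
  f =1 f' -> g =1 g' -> f ⊗₁ g =1 f' ⊗₁ g'.
Proof. by move=> ef eg; apply: bihom_tens_ext=> x y; rewrite !tens_mapE ef eg. Qed.

Lemma tens_mapl (g : bihom N N') (f f' : bihom M M') t :
  f =1 f' -> (f ⊗₁ g) t = (f' ⊗₁ g) t.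
Proof. by move=> ef; apply: eq_tens_map. Qed.

Lemma tens_mapr (f : bihom M M') (g g' : bihom N N') t :
  g =1 g' -> (f ⊗₁ g) t = (f ⊗₁ g') t.
Proof. by move=> ef; apply: eq_tens_map. Qed.

Lemma tens_map_swap (f : bihom M M') (g : bihom N N') t :
  (f ⊗₁ idb N') ((idb M ⊗₁ g) t) = (idb M' ⊗₁ g) ((f ⊗₁ idb N) t).
Proof. by rewrite !tens_map_comp; apply: eq_tens_map. Qed.

Lemma tens_map_lr (f : bihom M M') (g : bihom N N') t :
  (f ⊗₁ g) t = (f ⊗₁ idb N') ((idb M ⊗₁ g) t).
Proof. by rewrite !tens_map_comp; apply: eq_tens_map. Qed.

Lemma tens_mapl0 (f : bihom M M') (g : bihom N N') t :
  (forall x, f x = 0) -> (f ⊗₁ g) t = 0.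
Proof.
move=> f0; move: t; apply: tens_ext => [||x y]; [exact: bihomD|by move=> *; rewrite addr0|].
by rewrite tens_mapE f0; exact: pure_tens0l.
Qed.

Lemma tens_mapr0 (f : bihom M M') (g : bihom N N') t :
  (forall y, g y = 0) -> (f ⊗₁ g) t = 0.
Proof.
move=> g0; move: t; apply: tens_ext => [||x y]; [exact: bihomD|by move=> *; rewrite addr0|].
by rewrite tens_mapE g0; exact: pure_tens0r.
Qed.

Lemma tens_map_subl (f f' : bihom M M') (g : bihom N N') t :
  (bihom_sub f f' ⊗₁ g) t = (f ⊗₁ g) t - (f' ⊗₁ g) t.
Proof.
move: t; apply: tens_ext => [s t|s t|x y]; first exact: bihomD.
  by rewrite !bihomD opprD addrACA.
by rewrite !tens_mapE; exact: pure_tensBl.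
Qed.

Lemma tens_map_subr (f : bihom M M') (g g' : bihom N N') t :
  (f ⊗₁ bihom_sub g g') t = (f ⊗₁ g) t - (f ⊗₁ g') t.
Proof.
move: t; apply: tens_ext => [s t|s t|x y]; first exact: bihomD.
  by rewrite !bihomD opprD addrACA.
by rewrite !tens_mapE; exact: pure_tensBr.
Qed.

End Maps1.

Section Comp1.
Variables A B D : kalg k.
Variables (M M' M'' : bimod A B) (N N' N'' : bimod B D).

Lemma tens_compl (f : bihom M M') (f' : bihom M' M'') (t : M ⊗ N) :
  ((f' ∘ f) ⊗₁ idb N) t = (f' ⊗₁ idb N) ((f ⊗₁ idb N) t).
Proof. by rewrite tens_map_comp; apply: eq_tens_map. Qed.

Lemma tens_compr (g : bihom N N') (g' : bihom N' N'') (t : M ⊗ N) :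
  (idb M ⊗₁ (g' ∘ g)) t = (idb M ⊗₁ g') ((idb M ⊗₁ g) t).
Proof. by rewrite tens_map_comp; apply: eq_tens_map. Qed.

Lemma tens_complE (f : bihom M M') (f' : bihom M' M'') (h : bihom M M'') (t : M ⊗ N) :
  (forall x, f' (f x) = h x) -> (f' ⊗₁ idb N) ((f ⊗₁ idb N) t) = (h ⊗₁ idb N) t.
Proof. by move=> e; rewrite tens_map_comp; apply: eq_tens_map. Qed.

Lemma tens_comprE (g : bihom N N') (g' : bihom N' N'') (h : bihom N N'') (t : M ⊗ N) :
  (forall x, g' (g x) = h x) -> (idb M ⊗₁ g') ((idb M ⊗₁ g) t) = (idb M ⊗₁ h) t.
Proof. by move=> e; rewrite tens_map_comp; apply: eq_tens_map. Qed.
End Comp1.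

Lemma tens_ext3 (A B D E : kalg k) (M : bimod A B) (N : bimod B D)
    (P : bimod D E) (G : zmodType) (f g : M ⊗ N ⊗ P -> G) :
    {morph f : s t / s + t} -> {morph g : s t / s + t} ->
  (forall x y z, f ((x ⊗' y) ⊗' z) = g ((x ⊗' y) ⊗' z)) -> f =1 g.
Proof.
move=> fD gD fg; apply: tens_ext => // t z.
pose f' (t : M ⊗ N) := f (t ⊗' z); pose g' (t : M ⊗ N) := g (t ⊗' z).
suff: f' =1 g' by apply.
by apply: tens_ext=> [s u|s u|x y]; rewrite /f' /g' ?pure_tensDl ?fD ?gD.
Qed.

Lemma tens_ext3r (A B D E : kalg k) (M : bimod A B) (N : bimod B D)
    (P : bimod D E) (G : zmodType) (f g : M ⊗ (N ⊗ P) -> G) :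
    {morph f : s t / s + t} -> {morph g : s t / s + t} ->
  (forall x y z, f (x ⊗' (y ⊗' z)) = g (x ⊗' (y ⊗' z))) -> f =1 g.
Proof.
move=> fD gD fg; apply: tens_ext => // x t.
pose f' (t : N ⊗ P) := f (x ⊗' t); pose g' (t : N ⊗ P) := g (x ⊗' t).
suff: f' =1 g' by apply.
by apply: tens_ext=> [s u|s u|y z]; rewrite /f' /g' ?pure_tensDr ?fD ?gD.
Qed.

Lemma tens_ext4 (A B D E F : kalg k) (M : bimod A B) (N : bimod B D)
    (P : bimod D E) (Q : bimod E F) (G : zmodType) (f g : M ⊗ N ⊗ P ⊗ Q -> G) :
    {morph f : s t / s + t} -> {morph g : s t / s + t} ->
  (forall x y z u, f ((x ⊗' y) ⊗' z ⊗' u) = g ((x ⊗' y) ⊗' z ⊗' u)) -> f =1 g.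
Proof.
move=> fD gD fg; apply: tens_ext => // t z.
pose f' (t : M ⊗ N ⊗ P) := f (t ⊗' z); pose g' (t : M ⊗ N ⊗ P) := g (t ⊗' z).
suff: f' =1 g' by apply.
by apply: tens_ext3=> [s u|s u|x y]; rewrite /f' /g' ?pure_tensDl ?fD ?gD.
Qed.

Section Assoc.
Variables A B D E : kalg k.
Variables (M : bimod A B) (N : bimod B D) (P : bimod D E).

Lemma tassocK : cancel (tassoc M N P) (tassocV M N P).
Proof.
apply: tens_ext3=> [||x y z]; [exact: bicompD | by [] | ].
by rewrite tassocE tassocVE.
Qed.

Lemma tassocVK : cancel (tassocV M N P) (tassoc M N P).
Proof.
apply: tens_ext3r=> [||x y z]; [exact: bicompD | by [] | ].
by rewrite tassocVE tassocE.
Qed.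

Lemma tassoc_inj : injective (tassoc M N P).
Proof. exact: can_inj tassocK. Qed.
End Assoc.

Section AssocNat.
Variables A B D E : kalg k.
Variables (M M' : bimod A B) (N N' : bimod B D) (P P' : bimod D E).

Lemma tassoc_nat (f : bihom M M') (g : bihom N N') (h : bihom P P') t :
  tassoc M' N' P' (((f ⊗₁ g) ⊗₁ h) t) = (f ⊗₁ (g ⊗₁ h)) (tassoc M N P t).
Proof.
move: t; apply: tens_ext3=> [||x y z]; [exact: bicompD..|].
by rewrite tassocE !tens_mapE tassocE.
Qed.

Lemma tassocV_nat (f : bihom M M') (g : bihom N N') (h : bihom P P') t :
  tassocV M' N' P' ((f ⊗₁ (g ⊗₁ h)) t) = ((f ⊗₁ g) ⊗₁ h) (tassocV M N P t).
Proof. by apply: tassoc_inj; rewrite tassoc_nat !tassocVK. Qed.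
End AssocNat.

Lemma tassoc_pentagon (A B D E F : kalg k) (M : bimod A B) (N : bimod B D)
    (P : bimod D E) (Q : bimod E F) (t : M ⊗ N ⊗ P ⊗ Q) :
  tassoc M N (P ⊗ Q) (tassoc (M ⊗ N) P Q t) =
  (idb M ⊗₁ tassoc N P Q)
    (tassoc M (N ⊗ P) Q ((tassoc M N P ⊗₁ idb Q) t)).
Proof.
move: t; apply: tens_ext4=> [||x y z u].
- exact: bicompD.
- by move=> s t; rewrite !bihomD.
- by rewrite !(tens_mapE, tassocE).
Qed.

End TensorCalculus.

(** * Kernels preserved by tensoring *)

Definition iskernel (T : Type) (U V : zmodType) (j : T -> U) (h : U -> V) :=
  injective j /\ exact_pair j h.

(** Plain functions rather than bimodule maps, since some of the isomorphisms it serves, such as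
    [regular_act] and [forget_tens], join bimodules over different algebras. *)
Lemma iskernel_iso (T T' : Type) (U U' V V' : zmodType)
    (j : T -> U) (h : U -> V) (j' : T' -> U') (h' : U' -> V')
    (a : T -> T') (a' : T' -> T) (b : U -> U') (b' : U' -> U) (c : V -> V') :
    cancel a' a -> cancel b b' -> cancel b' b -> injective c -> c 0 = 0 ->
    (forall x, j' (a x) = b (j x)) -> (forall y, h' (b y) = c (h y)) ->
  iskernel j h -> iskernel j' h'.
Proof.
move=> aK bK bVK inj_c c0 jE hE [inj_j ex]; split.
  move=> x y; rewrite -(aK x) -(aK y) !jE => /(can_inj bK) /inj_j ->.
  by [].
move=> y; rewrite -(bVK y) hE; split.
  rewrite -[X in _ = X]c0 => /inj_c /ex [x <-]; exists (a x); exact: jE.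
by case=> x; rewrite -(aK x) jE => /(can_inj bK) jx; rewrite (ex _).2 //; exists (a' x).
Qed.

Section BihomKernel.
Variables (k : comPzRingType) (A B : kalg k).
Implicit Types K L M N : bimod A B.

Lemma bihom_inj K M (j : bihom K M) : (forall x, j x = 0 -> x = 0) -> injective j.
Proof.
by move=> j0 x y exy; apply/eqP; rewrite -subr_eq0 (j0 (x - y)) // bihomB exy subrr.
Qed.

(** Preimages need only exist pointwise: injectivity of [j] forces any chosen function to be a
    bimodule map. *)
Lemma corestr_lift K L M (j : bihom K M) (f : bihom L M) :
    injective j -> (forall x, exists y, j y = f x) ->
  forall x, j (corestr j f x) = f x.
Proof.
move=> inj_j ex; apply: corestrE.
have /choice[g gE] := ex.
have gD : {morph g : x y / x + y}.
  by move=> x y; apply: inj_j; rewrite gE !bihomD !gE.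
have gl a x : g (a *> x) = a *> g x.
  by apply: inj_j; rewrite gE !bihom_lact gE.
have gr x b : g (x <* b) = g x <* b.
  by apply: inj_j; rewrite gE !bihom_ract gE.
by exists (Bihom gD gl gr).
Qed.

Lemma ker_iskernel M N (h : bihom M N) : iskernel (ker_incl h) h.
Proof.
split=> [|x]; first exact: ker_incl_inj.
split=> [hx|[y <-]]; last exact: ker_valK.
have xP : x \in ker_pred h by rewrite unfold_in; exact/eqP.
by exists (KerElt xP).
Qed.

(** [ker (idb K)] is a zero bimodule, so injectivity becomes exactness at one place, the form in
    which flatness can be applied to it. *)
Lemma exact_pair0_inj K M (j : bihom K M) :
  exact_pair (ker_incl (idb K)) j <-> injective j.
Proof.
have ker0 (z : ker (idb K)) : ker_incl (idb K) z = 0 by exact: (ker_valK z).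
split=> [ex|inj_j x].
  by apply: bihom_inj => x /(ex x) [z <-].
split=> [jx|[z <-]]; last by rewrite ker0 raddf0.
by exists 0; rewrite ker0; apply: inj_j; rewrite jx raddf0.
Qed.
End BihomKernel.

Section GoodKernel.
Variable k : comPzRingType.

(** A contracting homotopy by bimodule maps: being a set of equations, it is kept by every additive
    functor. *)
Definition split_kernel (A B : kalg k) (K M N : bimod A B)
    (j : bihom K M) (h : bihom M N) : Prop :=
  exists r : bihom M K, exists s : bihom N M,
    [/\ forall x, r (j x) = x, forall x, j (r x) + s (h x) = x
      & forall x, h (j x) = 0].

(** Right modules are enough as tests: if T is a right module and P a bimodule, T ⊗ P is again a
    right module, which is how [good_kernel_tensl] reaches bimodules. *)
Definition pure_kernel (A B : kalg k) (K M N : bimod A B)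
    (j : bihom K M) (h : bihom M N) : Prop :=
  forall P : bimod (base_kalg k) A, iskernel (idb P ⊗₁ j) (idb P ⊗₁ h).

(* The two ways of being stable under tensoring on both sides: with [b = true]
   the kernel is split, so any bimodule may be tensored on the right; with
   [b = false] it is pure on the left, and only flat bimodules may be. *)
Definition good_kernel (b : bool) (A B : kalg k) (K M N : bimod A B)
    (j : bihom K M) (h : bihom M N) : Prop :=
  if b then split_kernel j h else pure_kernel j h.

Definition good_left (b : bool) (A B : kalg k) (Q : bimod A B) : Prop :=
  b \/ lflat Q.

Lemma lflat_inj (A B : kalg k) (Q : bimod A B)
    (K M : bimod (base_kalg k) A) (j : bihom K M) :
  lflat Q -> injective j -> injective (j ⊗₁ idb Q).
Proof.
move=> flQ inj_j.
have zeroT (t : ker (idb K) ⊗ Q) : t = 0.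
  elim/tens_ind: t => // [s t -> ->|z x]; first by rewrite addr0.
  suff -> : z = 0 by exact: pure_tens0l.
  by apply: val_inj; exact: (ker_valK z).
apply: bihom_inj => x /((flQ _ _ _ _ _ ((exact_pair0_inj j).2 inj_j)) x) [z <-].
by rewrite (zeroT z) raddf0.
Qed.

Lemma rflat_inj (A B : kalg k) (Q : bimod A B)
    (K M : bimod B (base_kalg k)) (j : bihom K M) :
  rflat Q -> injective j -> injective (idb Q ⊗₁ j).
Proof.
move=> flQ inj_j.
have zeroT (t : Q ⊗ ker (idb K)) : t = 0.
  elim/tens_ind: t => // [s t -> ->|x z]; first by rewrite addr0.
  suff -> : z = 0 by exact: pure_tens0r.
  by apply: val_inj; exact: (ker_valK z).
apply: bihom_inj => x /((flQ _ _ _ _ _ ((exact_pair0_inj j).2 inj_j)) x) [z <-].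
by rewrite (zeroT z) raddf0.
Qed.

Lemma lflat_iskernel (A B : kalg k) (Q : bimod A B)
    (K M N : bimod (base_kalg k) A) (j : bihom K M) (h : bihom M N) :
  lflat Q -> iskernel j h -> iskernel (j ⊗₁ idb Q) (h ⊗₁ idb Q).
Proof. by move=> flQ [inj_j ex]; split; [exact: lflat_inj | exact: flQ]. Qed.

Lemma lflat_tensor (A B D : kalg k) (Q : bimod A B) (R : bimod B D) :
  lflat Q -> lflat R -> lflat (Q ⊗ R).
Proof.
move=> flQ flR U V W f g ex t.
have := flR _ _ _ _ _ (flQ _ _ _ _ _ ex) (tassocV V Q R t).
have natE (S T : bimod (base_kalg k) A) (f0 : bihom S T) s :
    tassoc T Q R (((f0 ⊗₁ idb Q) ⊗₁ idb R) s) = (f0 ⊗₁ idb (Q ⊗ R)) (tassoc S Q R s).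
  by rewrite tassoc_nat; apply: eq_tens_map => // u; rewrite tens_map_id.
move=> exV; split=> [gt|[s <-]].
- have [|s sE] := exV.1; last first.
    by exists (tassoc _ _ _ s); rewrite -natE sE tassocVK.
  by apply: tassoc_inj; rewrite natE tassocVK gt raddf0.
- apply: (can_inj (@tassocVK _ _ _ _ _ W Q R)); rewrite raddf0.
  have -> : (f ⊗₁ idb (Q ⊗ R)) s =
      tassoc _ _ _ (((f ⊗₁ idb Q) ⊗₁ idb R) (tassocV _ _ _ s)).
    by rewrite natE tassocVK.
  rewrite -natE tassocK.
  by apply: (flR _ _ _ _ _ (flQ _ _ _ _ _ ex) _).2; exists (tassocV _ _ _ s).
Qed.

Lemma good_left_tensor b (A B D : kalg k) (Q : bimod A B) (R : bimod B D) :
  good_left b Q -> good_left b R -> good_left b (Q ⊗ R).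
Proof.
by case=> [?|flQ] [?|flR]; [left..|right; exact: lflat_tensor].
Qed.

(** Purity is tested on (k, A)-bimodules, whereas [regular_bimod] is an (A, A)-bimodule; this is the
    same module with the left action restricted to k. *)
Fact regular_right_bimodP (A : kalg k) :
  @bimod_axioms k (base_kalg k) A A (fun a x => kalg_map A a * x) (fun x b => x * b).
Proof.
split; [split|split| |].
- by move=> a x y; rewrite mulrDr.
- by move=> a b x; rewrite raddfD mulrDl.
- by move=> a b x; rewrite rmorphM mulrA.
- by move=> x; rewrite rmorph1 mul1r.
- by move=> b x y; rewrite mulrDl.
- by move=> x b c; rewrite mulrDr.
- by move=> x b c; rewrite mulrA.
- by move=> x; rewrite mulr1.
- by move=> a x b; rewrite mulrA.
- by move=> c x; exact: kalg_central.
Qed.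
Definition regular_right (A : kalg k) := Bimod (regular_right_bimodP A).

Section RegularRight.
Variables (A B : kalg k).
Fact regular_act_bal (M : bimod A B) :
  balanced (fun (a : regular_right A) (x : M) => (a : A) *> x).
Proof.
by split=> *; [exact: lactDl | exact: lactDr | exact: lactM].
Qed.
Definition regular_act (M : bimod A B) (t : regular_right A ⊗ M) : M :=
  tens_lift (fun (a : regular_right A) (x : M) => (a : A) *> x) t.
Definition regular_one (M : bimod A B) (x : M) : regular_right A ⊗ M :=
  @pure_tens k _ A B (regular_right A) M (1 : A) x.
Lemma regular_oneK (M : bimod A B) : cancel (@regular_one M) (@regular_act M).
Proof.
move=> x; rewrite /regular_act (tens_liftE (regular_act_bal M)); exact: lact1.
Qed.
Lemma regular_actK (M : bimod A B) : cancel (@regular_act M) (@regular_one M).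
Proof.
have actD := tens_liftD (regular_act_bal M).
apply: tens_ext => // [s t|a x].
  rewrite /regular_act actD; exact: pure_tensDr.
rewrite /regular_act (tens_liftE (regular_act_bal M)) /regular_one -pure_tens_bal.
by congr pure_tens; exact: mul1r.
Qed.
Lemma regular_act_nat (M N : bimod A B) (f : bihom M N) t :
  f (regular_act t) = regular_act ((idb _ ⊗₁ f) t).
Proof.
have actD L := tens_liftD (regular_act_bal L).
move: t; apply: tens_ext => [s t|s t|a x].
- by rewrite /regular_act actD bihomD.
- by rewrite bihomD /regular_act actD.
by rewrite tens_mapE /regular_act !(tens_liftE (regular_act_bal _)) bihom_lact.
Qed.
End RegularRight.

Section Closure.
Variables (b : bool) (A B D E : kalg k) (K M N : bimod A B).
Variables (j : bihom K M) (h : bihom M N).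

(** Test purity on A itself, where A ⊗ M is M. *)
Lemma pure_kernel_iskernel : pure_kernel j h -> iskernel j h.
Proof.
move/(_ (regular_right A)).
apply: (@iskernel_iso _ _ _ _ _ _ _ _ _ _ (@regular_act A B K) (@regular_one A B K)
  (@regular_act A B M) (@regular_one A B M) (@regular_act A B N)).
- exact: regular_oneK.
- exact: regular_actK.
- exact: regular_oneK.
- exact: can_inj (@regular_actK _ _ _).
- exact: tens_lift0 (regular_act_bal _).
- exact: regular_act_nat.
- exact: regular_act_nat.
Qed.

Lemma split_kernel_iskernel : split_kernel j h -> iskernel j h.
Proof.
move=> [r [s [rj jr hj]]]; split; first exact: can_inj rj.
move=> x; split=> [hx|[y <-]]; last exact: hj.
by exists (r x); rewrite -[RHS]jr hx raddf0 addr0.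
Qed.

Lemma good_kernel_iskernel : good_kernel b j h -> iskernel j h.
Proof.
by rewrite /good_kernel; case: b; [exact: split_kernel_iskernel | exact: pure_kernel_iskernel].
Qed.

Lemma split_kernel_tensl (P : bimod D A) :
  split_kernel j h -> split_kernel (idb P ⊗₁ j) (idb P ⊗₁ h).
Proof.
move=> [r [s [rj jr hj]]]; exists (idb P ⊗₁ r), (idb P ⊗₁ s); split=> t.
- by rewrite tens_map_comp -[RHS]tens_map_id; apply: eq_tens_map.
- move: t; apply: tens_ext => [t u|//|x y]; first by rewrite !bihomD addrACA.
  rewrite !tens_mapE; apply: etrans (esym (pure_tensDr x _ _)) _.
  by congr pure_tens; exact: jr.
- move: t; apply: tens_ext => [||x y]; [exact: bicompD|by move=> * /=; rewrite addr0|].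
  by rewrite !tens_mapE hj; exact: pure_tens0r.
Qed.

Lemma split_kernel_tensr (Q : bimod B E) :
  split_kernel j h -> split_kernel (j ⊗₁ idb Q) (h ⊗₁ idb Q).
Proof.
move=> [r [s [rj jr hj]]]; exists (r ⊗₁ idb Q), (s ⊗₁ idb Q); split=> t.
- by rewrite tens_map_comp -[RHS]tens_map_id; apply: eq_tens_map.
- move: t; apply: tens_ext => [t u|//|x y]; first by rewrite !bihomD addrACA.
  rewrite !tens_mapE; apply: etrans (esym (pure_tensDl _ _ y)) _.
  by congr pure_tens; exact: jr.
- move: t; apply: tens_ext => [||x y]; [exact: bicompD|by move=> * /=; rewrite addr0|].
  by rewrite !tens_mapE hj; exact: pure_tens0l.
Qed.
End Closure.

Section Closure2.
Variables (b : bool) (A B D E : kalg k) (K M N : bimod A B).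
Variables (j : bihom K M) (h : bihom M N).

Lemma good_kernel_tensl (P : bimod D A) :
  good_kernel b j h -> good_kernel b (idb P ⊗₁ j) (idb P ⊗₁ h).
Proof.
rewrite /good_kernel; case: b; first exact: split_kernel_tensl.
move=> jh T; have := jh (T ⊗ P).
apply: (@iskernel_iso _ _ _ _ _ _ _ _ _ _ (tassoc T P K) (tassocV T P K)
  (tassoc T P M) (tassocV T P M) (tassoc T P N)).
- exact: tassocVK.
- exact: tassocK.
- exact: tassocVK.
- exact: tassoc_inj.
- exact: raddf0.
- by move=> x; rewrite -tassoc_nat; congr (tassoc _ _ _ _); apply: eq_tens_map => // u;
    rewrite tens_map_id.
- by move=> x; rewrite -tassoc_nat; congr (tassoc _ _ _ _); apply: eq_tens_map => // u;
    rewrite tens_map_id.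
Qed.

(** In the pure case T ⊗ (K ⊗ Q) is (T ⊗ K) ⊗ Q; purity makes T ⊗ K a kernel of right modules, and
    left flatness of Q preserves it. *)
Lemma good_kernel_tensr (Q : bimod B E) :
  good_left b Q -> good_kernel b j h -> good_kernel b (j ⊗₁ idb Q) (h ⊗₁ idb Q).
Proof.
rewrite /good_left /good_kernel; case: b => [_|]; first exact: split_kernel_tensr.
case=> // flQ jh T; have := lflat_iskernel flQ (jh T).
apply: (@iskernel_iso _ _ _ _ _ _ _ _ _ _ (tassoc T K Q) (tassocV T K Q)
  (tassoc T M Q) (tassocV T M Q) (tassoc T N Q)).
- exact: tassocVK.
- exact: tassocK.
- exact: tassocVK.
- exact: tassoc_inj.
- exact: raddf0.
- by move=> x; rewrite -tassoc_nat.
- by move=> x; rewrite -tassoc_nat.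
Qed.
End Closure2.
End GoodKernel.

(** * Cotensor products *)

Section AssocOneSided.
Variables (k : comPzRingType) (A B D E : kalg k).
Variables (M M' : bimod A B) (N N' : bimod B D) (P P' : bimod D E).

Lemma tassoc_natl (f : bihom M M') t :
  tassoc M' N P (((f ⊗₁ idb N) ⊗₁ idb P) t) = (f ⊗₁ idb (N ⊗ P)) (tassoc M N P t).
Proof. by rewrite tassoc_nat; apply: eq_tens_map => // u; rewrite tens_map_id. Qed.

Lemma tassoc_natm (g : bihom N N') t :
  tassoc M N' P (((idb M ⊗₁ g) ⊗₁ idb P) t) = (idb M ⊗₁ (g ⊗₁ idb P)) (tassoc M N P t).
Proof. exact: tassoc_nat. Qed.

Lemma tassoc_natr (h : bihom P P') t :
  tassoc M N P' ((idb (M ⊗ N) ⊗₁ h) t) = (idb M ⊗₁ (idb N ⊗₁ h)) (tassoc M N P t).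
Proof.
rewrite -tassoc_nat; congr (tassoc _ _ _ _).
by apply: eq_tens_map => // u; rewrite tens_map_id.
Qed.

Lemma tassocV_natl (f : bihom M M') t :
  tassocV M' N P ((f ⊗₁ idb (N ⊗ P)) t) = ((f ⊗₁ idb N) ⊗₁ idb P) (tassocV M N P t).
Proof. by apply: tassoc_inj; rewrite tassoc_natl !tassocVK. Qed.

Lemma tassocV_natm (g : bihom N N') t :
  tassocV M N' P ((idb M ⊗₁ (g ⊗₁ idb P)) t) = ((idb M ⊗₁ g) ⊗₁ idb P) (tassocV M N P t).
Proof. exact: tassocV_nat. Qed.

Lemma tassocV_natr (h : bihom P P') t :
  tassocV M N P' ((idb M ⊗₁ (idb N ⊗₁ h)) t) = (idb (M ⊗ N) ⊗₁ h) (tassocV M N P t).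
Proof. by apply: tassoc_inj; rewrite tassoc_natr !tassocVK. Qed.
End AssocOneSided.

Lemma tassocV_pentagon (k : comPzRingType) (A B D E F : kalg k) (M : bimod A B)
    (N : bimod B D) (P : bimod D E) (Q : bimod E F) (t : M ⊗ N ⊗ (P ⊗ Q)) :
  tassoc M (N ⊗ P) Q ((tassoc M N P ⊗₁ idb Q) (tassocV (M ⊗ N) P Q t)) =
  (idb M ⊗₁ tassocV N P Q) (tassoc M N (P ⊗ Q) t).
Proof.
rewrite -{2}[t](tassocVK (M := M ⊗ N)) tassoc_pentagon -tens_compr.
rewrite -[LHS]tens_map_id; apply: eq_tens_map => // u.
by rewrite bicompE tassocK.
Qed.

Section CotensorBasics.
Variables (k : comPzRingType) (A B E : kalg k).
Variables (C : coring A) (D : coring B) (F : coring E).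
Variables (M : prebicomod C D) (N : prebicomod D F).

Definition cot_diff : bihom (M ⊗ N) (M ⊗ (D ⊗ N)) :=
  cotens_diff (rcoact M) (lcoact N).

Lemma cot_diffE t :
  cot_diff t = tassoc M D N ((rcoact M ⊗₁ idb N) t) - (idb M ⊗₁ lcoact N) t.
Proof. by []. Qed.

Lemma cot_incl_iskernel : iskernel (cot_incl M N) cot_diff.
Proof. exact: ker_iskernel. Qed.

Lemma cot_inclE (t : M □ N) :
  tassoc M D N ((rcoact M ⊗₁ idb N) (cot_incl M N t)) =
  (idb M ⊗₁ lcoact N) (cot_incl M N t).
Proof.
have [_ /(_ (cot_incl M N t))] := cot_incl_iskernel.
by case=> _ h; apply/eqP; rewrite -subr_eq0 -cot_diffE h //; exists t.
Qed.
End CotensorBasics.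

(** Isolated from the other bicomodule axioms so that it can be asked of cotensor products, which
    are only prebicomodules; it is what identifies the coactions induced on the next cotensor
    product. *)
Definition coact_compat (k : comPzRingType) (A B : kalg k)
    (C : coring A) (D : coring B) (M : prebicomod C D) : Prop :=
  forall x, tassoc C M D ((lcoact M ⊗₁ idb D) (rcoact M x)) =
    (idb C ⊗₁ rcoact M) (lcoact M x).

Section CotensorCoact.
Variables (k : comPzRingType) (A B E : kalg k).
Variables (C : coring A) (D : coring B) (F : coring E).
Variables (M : prebicomod C D) (N : prebicomod D F).

(** The default value of [corestr] is excluded here: since the two coactions of M commute, λ_M ⊗ N
    maps M □ N into the kernel of C ⊗ [cot_diff M N], which by hypothesis is C ⊗ (M □ N). *)
Lemma lcoact_cotensE t :
    coact_compat M ->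
    iskernel (idb C ⊗₁ cot_incl M N) (idb C ⊗₁ cot_diff M N) ->
  (idb C ⊗₁ cot_incl M N) (lcoact (M □ N) t) =
  tassoc C M N ((lcoact M ⊗₁ idb N) (cot_incl M N t)).
Proof.
move=> compat [inj_i ex]; move: t; apply: corestr_lift inj_i _ => t.
apply/ex; rewrite /cot_diff; set u := cot_incl M N t.
have diffE v : (idb C ⊗₁ cotens_diff (rcoact M) (lcoact N)) v =
    (idb C ⊗₁ tassoc M D N) ((idb C ⊗₁ (rcoact M ⊗₁ idb N)) v)
    - (idb C ⊗₁ (idb M ⊗₁ lcoact N)) v.
  by rewrite [LHS]tens_map_subr ?tens_compr.
rewrite diffE; apply/eqP; rewrite subr_eq0; apply/eqP.
have -> : (idb C ⊗₁ (rcoact M ⊗₁ idb N)) (tassoc C M N ((lcoact M ⊗₁ idb N) u))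
   = tassoc _ _ _ ((tassoc C M D ⊗₁ idb N) (((lcoact M ⊗₁ idb D) ⊗₁ idb N)
       ((rcoact M ⊗₁ idb N) u))).
  rewrite -tassoc_natm; congr (tassoc _ _ _ _).
  by rewrite !tens_map_comp; apply: eq_tens_map => // x; rewrite !bicompE compat.
by rewrite -tassoc_pentagon tassoc_natl cot_inclE tens_map_swap tassoc_natr.
Qed.

Lemma rcoact_cotensE t :
    coact_compat N ->
    iskernel (cot_incl M N ⊗₁ idb F) (cot_diff M N ⊗₁ idb F) ->
  (cot_incl M N ⊗₁ idb F) (rcoact (M □ N) t) =
  tassocV M N F ((idb M ⊗₁ rcoact N) (cot_incl M N t)).
Proof.
move=> compat [inj_i ex]; move: t; apply: corestr_lift inj_i _ => t.
apply/ex; rewrite /cot_diff; set u := cot_incl M N t.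
have diffE v : (cotens_diff (rcoact M) (lcoact N) ⊗₁ idb F) v =
    (tassoc M D N ⊗₁ idb F) (((rcoact M ⊗₁ idb N) ⊗₁ idb F) v)
    - ((idb M ⊗₁ lcoact N) ⊗₁ idb F) v.
  by rewrite [LHS]tens_map_subl ?tens_compl.
rewrite diffE; apply/eqP; rewrite subr_eq0; apply/eqP.
apply: tassoc_inj; rewrite tassoc_natm tassocVK.
have -> : (idb M ⊗₁ (lcoact N ⊗₁ idb F)) ((idb M ⊗₁ rcoact N) u) =
    (idb M ⊗₁ tassocV D N F) ((idb M ⊗₁ (idb D ⊗₁ rcoact N)) ((idb M ⊗₁ lcoact N) u)).
  rewrite !tens_map_comp; apply: eq_tens_map => // x; rewrite !bicompE.
  by rewrite -compat tassocK.
rewrite -cot_inclE -tassoc_natr -tens_map_swap -tassocV_pentagon.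
by congr (tassoc _ _ _ _); congr (_ _); rewrite tassocV_natl.
Qed.
End CotensorCoact.

Section UnitorNat.
Variables (k : comPzRingType) (A B : kalg k).
Implicit Types (M : bimod A B).

Lemma lunitE M (a : A) (x : M) :
  lunit M (@pure_tens k _ _ _ (regular_bimod A) M a x) = a *> x.
Proof. exact: tens_homE. Qed.

Lemma runitE M (x : M) (b : B) :
  runit M (@pure_tens k _ _ _ M (regular_bimod B) x b) = x <* b.
Proof. exact: tens_homE. Qed.

Lemma lunit_nat M M' (f : bihom M M') t : f (lunit M t) = lunit M' ((idb _ ⊗₁ f) t).
Proof.
move: t; apply: tens_ext => [||a x]; [exact: bicompD..|].
by rewrite tens_mapE !lunitE bihom_lact.
Qed.

Lemma runit_nat M M' (f : bihom M M') t : f (runit M t) = runit M' ((f ⊗₁ idb _) t).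
Proof.
move: t; apply: tens_ext => [||x b]; [exact: bicompD..|].
by rewrite tens_mapE !runitE bihom_ract.
Qed.

End UnitorNat.

Section UnitorCalculus.
Variables (k : comPzRingType) (A B D : kalg k).
Implicit Types (M : bimod A B) (N : bimod B D).

Lemma lunit_tassoc M N t :
  lunit (M ⊗ N) (tassoc _ M N t) = (lunit M ⊗₁ idb N) t.
Proof.
move: t; apply: tens_ext3 => [||a x y]; [exact: bicompD|exact: bihomD|].
by rewrite tassocE lunitE tens_mapE lunitE tensor_lactE.
Qed.

Lemma runit_tassoc M N t :
  (idb M ⊗₁ runit N) (tassoc M N _ t) = runit (M ⊗ N) t.
Proof.
move: t; apply: tens_ext3 => [||x y a]; [exact: bicompD|exact: bihomD|].
by rewrite tassocE runitE tens_mapE runitE tensor_ractE.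
Qed.

Lemma unit_triangle M N t :
  (idb M ⊗₁ lunit N) (tassoc M _ N t) = (runit M ⊗₁ idb N) t.
Proof.
move: t; apply: tens_ext3 => [||x a y]; [exact: bicompD|exact: bihomD|].
by rewrite tassocE !tens_mapE lunitE runitE; exact/esym/pure_tens_bal.
Qed.
End UnitorCalculus.

(** The homotopy identity is the one to check: that [r] retracts [j] follows from it by injectivity
    of [j]. *)
Lemma split_kernelI (k : comPzRingType) (A B : kalg k) (K M N : bimod A B)
    (j : bihom K M) (h : bihom M N) (r : bihom M K) (s : bihom N M) :
  iskernel j h -> (forall x, j (r x) + s (h x) = x) -> split_kernel j h.
Proof.
move=> [inj_j ex] jr; have hj x : h (j x) = 0 by apply/ex; exists x.
exists r, s; split=> // x; apply: inj_j.
by rewrite -[RHS]jr hj raddf0 addr0.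
Qed.

(** * Bicomodules and the unit isomorphism *)

Section Bicomodules.
Variables (k : comPzRingType) (A B : kalg k) (C : coring A) (D : coring B).

Lemma bicomod_compat (M : bicomod C D) : coact_compat M.
Proof. by case: (bicomodP M) => _ _ h x; exact: h. Qed.

Lemma rcoactA (M : bicomod C D) x :
  tassoc M D D ((rcoact M ⊗₁ idb D) (rcoact M x)) = (idb M ⊗₁ cdelta D) (rcoact M x).
Proof. by case: (bicomodP M) => _ [h _] _; exact: h. Qed.

Lemma lcoactA (M : bicomod C D) x :
  tassoc C C M ((cdelta C ⊗₁ idb M) (lcoact M x)) = (idb C ⊗₁ lcoact M) (lcoact M x).
Proof. by case: (bicomodP M) => [[h _] _ _]; exact: h. Qed.

Lemma lcoact_counit (M : bicomod C D) x :
  lunit M ((ceps C ⊗₁ idb M) (lcoact M x)) = x.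
Proof. by case: (bicomodP M) => [[_ h] _ _]; exact: h. Qed.

Lemma rcoact_counit (M : bicomod C D) x :
  runit M ((idb M ⊗₁ ceps D) (rcoact M x)) = x.
Proof. by case: (bicomodP M) => _ [_ h] _; exact: h. Qed.

Lemma cdelta_counitl (c : C) : lunit C ((ceps C ⊗₁ idb C) (cdelta C c)) = c.
Proof. by case: (coringP C) => _ h _; exact: h. Qed.

Lemma cot_lunit_incl (M : bicomod C D) x :
  cot_incl (coring_bicomod C) M (cot_lunit M x) = lcoact M x.
Proof. exact: cot_lunitE. Qed.

Lemma cot_runit_incl (M : bicomod C D) x :
  cot_incl M (coring_bicomod D) (cot_runit M x) = rcoact M x.
Proof. exact: cot_runitE. Qed.

(** The counit on the first factor contracts the cobar complex of M: it sends Δ(c) ⊗ m to c ⊗ m and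
    c ⊗ λ(m) to λ(ε(c) m). So C □ M stays a kernel under every tensor product, for an arbitrary
    coring. *)
Lemma cot_lunit_split (M : bicomod C D) :
  split_kernel (cot_incl (coring_bicomod C) M) (cot_diff (coring_bicomod C) M).
Proof.
pose e (N : bimod A B) : bihom (C ⊗ N) N := lunit N ∘ (ceps C ⊗₁ idb N).
apply: (@split_kernelI _ _ _ _ _ _ _ _ (cot_lunit M ∘ e M) (e _)).
  exact: cot_incl_iskernel.
move=> t.
have e1 : e _ (tassoc C C M ((cdelta C ⊗₁ idb M) t)) = t.
  rewrite bicompE -tassoc_natl lunit_tassoc !tens_map_comp -[RHS]tens_map_id.
  by apply: eq_tens_map => // c; exact: cdelta_counitl.
have e2 : e _ ((idb C ⊗₁ lcoact M) t) = lcoact M (e M t).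
  by rewrite !bicompE lunit_nat -tens_map_swap.
rewrite cot_diffE bihomB e1 e2 bicompE cot_lunit_incl.
by rewrite addrC subrK.
Qed.
End Bicomodules.

Lemma tens_tassoc_inj (k : comPzRingType) (A B D E F : kalg k) (L : bimod A B)
    (M : bimod B D) (N : bimod D E) (P : bimod E F) :
  injective (idb L ⊗₁ tassoc M N P).
Proof.
apply: (can_inj (g := idb L ⊗₁ tassocV M N P)) => t.
rewrite -tens_compr -[RHS]tens_map_id; apply: eq_tens_map => // u.
exact: tassocK.
Qed.

(** * Associativity of the cotensor product *)

Section CotensorAssociator.
Variables (k : comPzRingType) (A B E G : kalg k).
Variables (C : coring A) (D : coring B) (F : coring E) (H : coring G).
Variables (M : prebicomod C D) (N : prebicomod D F) (P : prebicomod F H).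

Lemma cot_incl_rE t :
  cot_incl_r M N P t = (idb M ⊗₁ cot_incl N P) (cot_incl M (N □ P) t).
Proof. by []. Qed.

Lemma cot_incl_lE t :
  cot_incl_l M N P t = tassoc M N P ((cot_incl M N ⊗₁ idb P) (cot_incl (M □ N) P t)).
Proof. by []. Qed.

Hypothesis lcoactE : forall t,
  (idb D ⊗₁ cot_incl N P) (lcoact (N □ P) t) =
  tassoc D N P ((lcoact N ⊗₁ idb P) (cot_incl N P t)).
Hypothesis rcoactE : forall t,
  (cot_incl M N ⊗₁ idb F) (rcoact (M □ N) t) =
  tassocV M N F ((idb M ⊗₁ rcoact N) (cot_incl M N t)).

(** The right coaction of M □ N is that of N, so inside M ⊗ N ⊗ F ⊗ P the equation cutting out (M □
    N) □ P becomes that of N □ P, tensored by M. [cot_diff_natr] is its mirror image. *)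
Lemma cot_diff_natl t :
  tassoc M N (F ⊗ P) ((cot_incl M N ⊗₁ idb _) (cot_diff (M □ N) P t)) =
  (idb M ⊗₁ cot_diff N P) (tassoc M N P ((cot_incl M N ⊗₁ idb P) t)).
Proof.
move: t; apply: tens_ext => [||t p]; [by move=> s u; rewrite !bihomD..|].
rewrite cot_diffE !bihomB.
have -> : tassoc M N (F ⊗ P) ((cot_incl M N ⊗₁ idb (F ⊗ P))
     ((idb (M □ N) ⊗₁ lcoact P) (t ⊗' p))) =
   (idb M ⊗₁ (idb N ⊗₁ lcoact P)) (tassoc M N P ((cot_incl M N ⊗₁ idb P) (t ⊗' p))).
  by rewrite tens_map_swap tassoc_natr.
have -> : tassoc M N (F ⊗ P) ((cot_incl M N ⊗₁ idb (F ⊗ P))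
     (tassoc (M □ N) F P ((rcoact (M □ N) ⊗₁ idb P) (t ⊗' p)))) =
   (idb M ⊗₁ (tassoc N F P ∘ (rcoact N ⊗₁ idb P)))
     (tassoc M N P ((cot_incl M N ⊗₁ idb P) (t ⊗' p))).
  rewrite -tassoc_natl tassoc_pentagon tens_compr; congr (_ _).
  rewrite -tassoc_natm; congr (tassoc _ _ _ _).
  rewrite !tens_mapE; congr (_ ⊗' p).
  by rewrite rcoactE tassocVK.
have diffE v : (idb M ⊗₁ cot_diff N P) v =
    (idb M ⊗₁ (tassoc N F P ∘ (rcoact N ⊗₁ idb P))) v
    - (idb M ⊗₁ (idb N ⊗₁ lcoact P)) v.
  by rewrite [LHS]tens_map_subr ?tens_compr.
by rewrite diffE.
Qed.

Lemma cot_diff_natr t :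
  (idb M ⊗₁ (idb D ⊗₁ cot_incl N P)) (cot_diff M (N □ P) t) =
  (idb M ⊗₁ tassoc D N P) (tassoc M (D ⊗ N) P
    ((cot_diff M N ⊗₁ idb P) (tassocV M N P ((idb M ⊗₁ cot_incl N P) t)))).
Proof.
rewrite cot_diffE bihomB; set s := (idb M ⊗₁ cot_incl N P) t.
have -> : (idb M ⊗₁ (idb D ⊗₁ cot_incl N P))
     (tassoc M D (N □ P) ((rcoact M ⊗₁ idb (N □ P)) t)) =
   (idb M ⊗₁ tassoc D N P) (tassoc M (D ⊗ N) P
    ((tassoc M D N ⊗₁ idb P) (((rcoact M ⊗₁ idb N) ⊗₁ idb P) (tassocV M N P s)))).
  rewrite -tassoc_pentagon tassoc_natl tassocVK /s tens_map_swap.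
  by rewrite tassoc_natr.
have -> : (idb M ⊗₁ (idb D ⊗₁ cot_incl N P)) ((idb M ⊗₁ lcoact (N □ P)) t) =
   (idb M ⊗₁ tassoc D N P) (tassoc M (D ⊗ N) P
    (((idb M ⊗₁ lcoact N) ⊗₁ idb P) (tassocV M N P s))).
  by rewrite tassoc_natm tassocVK /s !tens_map_comp; apply: eq_tens_map.
have diffE v : (cot_diff M N ⊗₁ idb P) v =
    (tassoc M D N ⊗₁ idb P) (((rcoact M ⊗₁ idb N) ⊗₁ idb P) v)
    - ((idb M ⊗₁ lcoact N) ⊗₁ idb P) v.
  by rewrite [LHS]tens_map_subl ?tens_compl.
by rewrite diffE !bihomB.
Qed.

(** Both nestings are cut out of M ⊗ N ⊗ P by the same two equations. The equation of M □ N lifts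
    the element to (M □ N) ⊗ P, since that is a kernel; the injectivity over F ⊗ P then shows that
    the lift satisfies the remaining equation. *)
Lemma cot_assocVE t :
    iskernel (cot_incl M N ⊗₁ idb P) (cot_diff M N ⊗₁ idb P) ->
    injective (cot_incl M N ⊗₁ idb (F ⊗ P)) ->
  cot_incl_l M N P (cot_assocV M N P t) = cot_incl_r M N P t.
Proof.
move=> [inj_iP exP] inj_iFP; move: t; apply: corestr_lift.
  move=> x y; rewrite !cot_incl_lE => /tassoc_inj /inj_iP.
  exact: (cot_incl_iskernel _ _).1.
move=> t; set u := cot_incl M (N □ P) t.
have u0 : cot_diff M (N □ P) u = 0 by apply/(cot_incl_iskernel _ _).2; exists t.
have [v iv] : exists v, (cot_incl M N ⊗₁ idb P) v =
    tassocV M N P ((idb M ⊗₁ cot_incl N P) u).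
  apply/exP; apply: (@tassoc_inj _ _ _ _ _ M (D ⊗ N) P).
  by apply: (@tens_tassoc_inj _ _ _ _ _ _ M D N P); rewrite -cot_diff_natr u0 !raddf0.
have v0 : cot_diff (M □ N) P v = 0.
  apply: inj_iFP; apply: tassoc_inj; rewrite cot_diff_natl iv tassocVK !raddf0.
  by rewrite -tens_compr; apply: tens_mapr0 => x; apply/(cot_incl_iskernel _ _).2; exists x.
have [y yv] := ((cot_incl_iskernel (M □ N) P).2 v).1 v0.
by exists y; rewrite cot_incl_lE yv iv tassocVK.
Qed.

Lemma cot_assocE t :
    iskernel (idb M ⊗₁ cot_incl N P) (idb M ⊗₁ cot_diff N P) ->
    injective (idb M ⊗₁ (idb D ⊗₁ cot_incl N P)) ->
  cot_incl_r M N P (cot_assoc M N P t) = cot_incl_l M N P t.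
Proof.
move=> [inj_iP exP] inj_iFP; move: t; apply: corestr_lift.
  by move=> x y; rewrite !cot_incl_rE => /inj_iP; exact: (cot_incl_iskernel _ _).1.
move=> t; set u := cot_incl (M □ N) P t.
have u0 : cot_diff (M □ N) P u = 0 by apply/(cot_incl_iskernel _ _).2; exists t.
have [v iv] : exists v, (idb M ⊗₁ cot_incl N P) v =
    tassoc M N P ((cot_incl M N ⊗₁ idb P) u).
  by apply/exP; rewrite -cot_diff_natl u0 !raddf0.
have v0 : cot_diff M (N □ P) v = 0.
  apply: inj_iFP; rewrite cot_diff_natr iv tassocK !raddf0.
  rewrite -tens_compl [X in tassoc _ _ _ X](_ : _ = 0) ?raddf0 //.
  by apply: tens_mapl0 => x; apply/(cot_incl_iskernel _ _).2; exists x.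
have [y yv] := ((cot_incl_iskernel M (N □ P)).2 v).1 v0.
by exists y; rewrite cot_incl_rE yv iv.
Qed.
End CotensorAssociator.

(** * Cotensor products of colinear maps *)

Section CotensorMaps.
Variables (k : comPzRingType) (A B E : kalg k).
Variables (C : coring A) (D : coring B) (F : coring E).

Lemma idb_rcolinear (M : bimod A B) (rho : bihom M (M ⊗ D)) :
  is_rcolinear rho rho (idb M).
Proof. by move=> x; rewrite !bicompE tens_map_id. Qed.

Lemma idb_lcolinear (M : bimod A B) (lam : bihom M (C ⊗ M)) :
  is_lcolinear lam lam (idb M).
Proof. by move=> x; rewrite !bicompE tens_map_id. Qed.

Lemma cot_mapE (M M' : prebicomod C D) (N N' : prebicomod D F)
    (f : bihom M M') (g : bihom N N') t :
    is_rcolinear (rcoact M) (rcoact M') f -> is_lcolinear (lcoact N) (lcoact N') g ->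
  cot_incl M' N' ((f □₁ g) t) = (f ⊗₁ g) (cot_incl M N t).
Proof. by move=> fP gP; exact: (cotens_map_ofE fP gP t). Qed.

(** The left coaction touches only M and the right one only N, so they commute in C ⊗ (M ⊗ N) ⊗ F;
    the injectivity brings this back to M □ N. *)
Lemma cotens_compat (M : bicomod C D) (N : bicomod D F) :
    (forall t, (idb C ⊗₁ cot_incl M N) (lcoact (M □ N) t) =
       tassoc C M N ((lcoact M ⊗₁ idb N) (cot_incl M N t))) ->
    (forall t, (cot_incl M N ⊗₁ idb F) (rcoact (M □ N) t) =
       tassocV M N F ((idb M ⊗₁ rcoact N) (cot_incl M N t))) ->
    injective (idb C ⊗₁ (cot_incl M N ⊗₁ idb F)) ->
  coact_compat (M □ N).
Proof.
move=> lE rE inj t; apply: inj; set i := cot_incl M N.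
have lEt v : ((idb C ⊗₁ i) ⊗₁ idb F) ((lcoact (M □ N) ⊗₁ idb F) v) =
    (tassoc C M N ⊗₁ idb F) (((lcoact M ⊗₁ idb N) ⊗₁ idb F) ((i ⊗₁ idb F) v)).
  by rewrite -!tens_compl; exact: tens_mapl.
have rEt v : (idb C ⊗₁ (i ⊗₁ idb F)) ((idb C ⊗₁ rcoact (M □ N)) v) =
    (idb C ⊗₁ tassocV M N F) ((idb C ⊗₁ (idb M ⊗₁ rcoact N)) ((idb C ⊗₁ i) v)).
  by rewrite -!tens_compr; exact: tens_mapr.
rewrite -tassoc_natm lEt rE rEt lE -tassoc_natr -tens_map_swap -tassocV_natl.
exact: tassocV_pentagon.
Qed.
End CotensorMaps.

(** * The comatrix coring *)

Section ComatrixCoring.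
Variables (k : comPzRingType) (A B : kalg k) (C : coring A) (D : coring B).
Variables (X : bicomod C D) (L : bicomod D C) (b : bool).
Let E := L □ X.
Let Y := X □ L.
Let i : bihom E (L ⊗ X) := cot_incl L X.
Let y : bihom Y (X ⊗ L) := cot_incl X L.

Hypothesis i_good : good_kernel b i (cot_diff L X).
Hypothesis y_good : good_kernel b y (cot_diff X L).
Hypotheses (C_good : good_left b C) (D_good : good_left b D).
Hypotheses (X_good : good_left b X) (L_good : good_left b L) (E_good : good_left b E).
(** Y □ X and X □ E occur under [idb L □₁ _] in the coproduct. These two hypotheses make their left
    C-coactions genuine, hence the maps into them provably colinear. *)
Hypothesis YX_ker : iskernel (idb C ⊗₁ cot_incl Y X) (idb C ⊗₁ cot_diff Y X).
Hypothesis XE_ker : iskernel (idb C ⊗₁ cot_incl X E) (idb C ⊗₁ cot_diff X E).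

Let i_tensl (A' : kalg k) (P : bimod A' B) : iskernel (idb P ⊗₁ i) (idb P ⊗₁ cot_diff L X).
Proof. apply: (good_kernel_iskernel (b := b)); exact: good_kernel_tensl. Qed.
Let i_tensr (B' : kalg k) (Q : bimod B B') :
  good_left b Q -> iskernel (i ⊗₁ idb Q) (cot_diff L X ⊗₁ idb Q).
Proof. by move=> ?; apply: (good_kernel_iskernel (b := b)); apply: good_kernel_tensr i_good. Qed.

Let lcoactE t : (idb D ⊗₁ i) (lcoact E t) = tassoc D L X ((lcoact L ⊗₁ idb X) (i t)).
Proof. by apply: lcoact_cotensE; [exact: bicomod_compat | exact: i_tensl]. Qed.
Let rcoactE t : (i ⊗₁ idb D) (rcoact E t) = tassocV L X D ((idb L ⊗₁ rcoact X) (i t)).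
Proof. by apply: rcoact_cotensE; [exact: bicomod_compat | exact: i_tensr]. Qed.

Let lcoactY t : (idb C ⊗₁ y) (lcoact Y t) = tassoc C X L ((lcoact X ⊗₁ idb L) (y t)).
Proof.
apply: lcoact_cotensE; first exact: bicomod_compat.
apply: (good_kernel_iskernel (b := b)); exact: good_kernel_tensl.
Qed.
Let rcoactY t : (y ⊗₁ idb C) (rcoact Y t) = tassocV X L C ((idb X ⊗₁ rcoact L) (y t)).
Proof.
apply: rcoact_cotensE; first exact: bicomod_compat.
by apply: (good_kernel_iskernel (b := b)); apply: good_kernel_tensr y_good.
Qed.

Let Y_compat : coact_compat Y.
Proof.
apply: cotens_compat => //.
apply: (proj1 (good_kernel_iskernel (b := b)
  (h := idb C ⊗₁ (cot_diff X L ⊗₁ idb C)) _)).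
by apply: good_kernel_tensl; apply: good_kernel_tensr y_good.
Qed.

Let lcoactYX t : (idb C ⊗₁ cot_incl Y X) (lcoact (Y □ X) t) =
  tassoc C Y X ((lcoact Y ⊗₁ idb X) (cot_incl Y X t)).
Proof. exact: (lcoact_cotensE _ Y_compat YX_ker). Qed.
Let lcoactXE t : (idb C ⊗₁ cot_incl X E) (lcoact (X □ E) t) =
  tassoc C X E ((lcoact X ⊗₁ idb E) (cot_incl X E t)).
Proof. apply: lcoact_cotensE; [exact: bicomod_compat | exact: XE_ker]. Qed.

Let lcoactCX t : (idb C ⊗₁ cot_incl (coring_bicomod C) X) (lcoact (coring_bicomod C □ X) t) =
  tassoc C C X ((cdelta C ⊗₁ idb X) (cot_incl (coring_bicomod C) X t)).
Proof.
apply: (lcoact_cotensE (M := coring_bicomod C)); first exact: bicomod_compat.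
exact/split_kernel_iskernel/split_kernel_tensl/cot_lunit_split.
Qed.

Let asE t : cot_incl_r X L X (cot_assoc X L X t) = cot_incl_l X L X t.
Proof.
apply: cot_assocE => //.
apply: (proj1 (good_kernel_iskernel (b := b) (h := idb X ⊗₁ (idb D ⊗₁ cot_diff L X)) _)).
by do 2!apply: good_kernel_tensl.
Qed.

Let asVE (G : kalg k) (H : coring G) (P : prebicomod D H) t :
    (forall t, (idb C ⊗₁ cot_incl X P) (lcoact (X □ P) t) =
       tassoc C X P ((lcoact X ⊗₁ idb P) (cot_incl X P t))) ->
    good_left b P ->
  cot_incl_l L X P (cot_assocV L X P t) = cot_incl_r L X P t.
Proof.
by move=> lE gP; apply: cot_assocVE => //; [exact: i_tensr |
  apply: (proj1 (i_tensr _)); exact: good_left_tensor].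
Qed.

(** Needed to compute [idb L □₁ cot_assoc X L X], which restricts L ⊗ [cot_assoc X L X] because the
    latter is left colinear. Both coactions are that of the first X, so they agree in C ⊗ (X ⊗ (L ⊗
    X)). *)
Let as_lcolinear :
  is_lcolinear (lcoact (Y □ X)) (lcoact (X □ E)) (cot_assoc X L X).
Proof.
move=> u; rewrite !bicompE.
have inj : injective (idb C ⊗₁ cot_incl_r X L X).
  move=> s t; rewrite !tens_compr => e.
  apply: (proj1 XE_ker); move: e.
  apply: (proj1 (good_kernel_iskernel (b := b) (h := idb C ⊗₁ (idb X ⊗₁ cot_diff L X)) _)).
  by do 2!apply: good_kernel_tensl.
apply: inj; rewrite [RHS](tens_comprE _ asE).
rewrite /cot_incl_l !tens_compr lcoactXE lcoactYX.
rewrite -tassoc_natr -tens_map_swap -cot_incl_rE asE cot_incl_lE.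
rewrite -tassoc_natl tassoc_pentagon -!tassoc_natm; congr (_ (tassoc _ _ _ _)).
have e v : (tassoc C X L ⊗₁ idb X) (((lcoact X ⊗₁ idb L) ⊗₁ idb X) ((y ⊗₁ idb X) v))
    = ((idb C ⊗₁ y) ⊗₁ idb X) ((lcoact Y ⊗₁ idb X) v).
  by rewrite -!tens_compl; apply: tens_mapl => v'; rewrite !bicompE -lcoactY.
exact: e.
Qed.

Variables (psi : bihom (coring_bicomod C) Y) (omega : bihom E (coring_bicomod D)).
Hypotheses (psi_bicolinear : is_bicolinear psi) (omega_bicolinear : is_bicolinear omega).
Hypothesis L_eq : (omega □₁ idb L) ∘ cot_assocV L X L ∘ (idb L □₁ psi) ∘ cot_runit L
              =1 cot_lunit L.
Hypothesis X_eq : (idb X □₁ omega) ∘ cot_assoc X L X ∘ (psi □₁ idb X) ∘ cot_lunit X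
              =1 cot_runit X.

Let psit : bihom C (X ⊗ L) := y ∘ psi.

Let psit_lcolinear c :
  tassoc C X L ((lcoact X ⊗₁ idb L) (psit c)) = (idb C ⊗₁ psit) (cdelta C c).
Proof.
rewrite bicompE -lcoactY tens_compr; congr (_ _).
by case: psi_bicolinear => h _; exact: h.
Qed.

Let psiX_incl t :
  cot_incl Y X ((psi □₁ idb X) t) =
  (psi ⊗₁ idb X) (cot_incl (coring_bicomod C) X t).
Proof.
by apply: cot_mapE; [case: psi_bicolinear | exact: idb_lcolinear].
Qed.

Let psiX_lcolinear :
  is_lcolinear (lcoact (coring_bicomod C □ X)) (lcoact (Y □ X)) (psi □₁ idb X).
Proof.
move=> t; rewrite !bicompE; apply: (proj1 YX_ker).
rewrite lcoactYX psiX_incl.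
rewrite [RHS](tens_comprE
  (h := (psi ⊗₁ idb X) ∘ cot_incl (coring_bicomod C) X) _ psiX_incl) tens_compr.
rewrite lcoactCX -tassoc_natm; congr (tassoc _ _ _ _).
rewrite !tens_map_comp; apply: eq_tens_map => // c.
by case: psi_bicolinear => h _; exact: h.
Qed.

Let lunit_lcolinear :
  is_lcolinear (lcoact X) (lcoact (coring_bicomod C □ X)) (cot_lunit X).
Proof.
move=> x; rewrite !bicompE.
have inj : injective (idb C ⊗₁ cot_incl (coring_bicomod C) X).
  exact: (proj1 (split_kernel_iskernel (split_kernel_tensl _ (cot_lunit_split X)))).
apply: inj; rewrite lcoactCX [RHS](tens_comprE _ (@cot_lunit_incl _ _ _ _ _ X)).
by rewrite cot_lunit_incl lcoactA.
Qed.

(* w makes X a right comodule over E = L □ X, and the coproduct of E is the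
   restriction of L ⊗ w; its coassociativity thus reduces to that of w. *)
Let w : bihom X (X ⊗ E) :=
  cot_incl X E ∘ cot_assoc X L X ∘ (psi □₁ idb X) ∘ cot_lunit X.
Let W : bihom X (X ⊗ (L ⊗ X)) := tassoc X L X ∘ (psit ⊗₁ idb X) ∘ lcoact X.

Let w_incl x : (idb X ⊗₁ i) (w x) = W x.
Proof.
rewrite /w /W !bicompE -cot_incl_rE asE cot_incl_lE psiX_incl.
by rewrite cot_lunit_incl -tens_compl.
Qed.

(** The triangle identity [X_eq] followed by the inclusion into X ⊗ D: omega turns the E-coaction of
    X into its D-coaction. It gives the right counit law, as [z_omega] gives the left one. *)
Let w_omega x : (idb X ⊗₁ omega) (w x) = rcoact X x.
Proof.
rewrite -[RHS]cot_runit_incl -X_eq !bicompE.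
symmetry; apply: cot_mapE; [exact: idb_rcolinear | by case: omega_bicolinear].
Qed.

(* Likewise, z makes L a left comodule over E. *)
Let z : bihom L (E ⊗ L) :=
  cot_incl E L ∘ cot_assocV L X L ∘ (idb L □₁ psi) ∘ cot_runit L.

Let z_incl l : tassoc L X L ((i ⊗₁ idb L) (z l)) = (idb L ⊗₁ psit) (rcoact L l).
Proof.
rewrite /z !bicompE -cot_incl_lE asVE ?cot_incl_rE //.
rewrite cot_mapE; [|exact: idb_rcolinear|by case: psi_bicolinear].
by rewrite cot_runit_incl -tens_compr.
Qed.

Let z_omega l : (omega ⊗₁ idb L) (z l) = lcoact L l.
Proof.
rewrite -[RHS]cot_lunit_incl -L_eq !bicompE.
symmetry; apply: cot_mapE; [by case: omega_bicolinear | exact: idb_lcolinear].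
Qed.

Definition comatrix_delta : bihom E (E ⊗ E) :=
    cot_incl (L □ X) (L □ X)
    ∘ cot_assocV L X (L □ X)
    ∘ (idb L □₁ cot_assoc X L X)
    ∘ (idb L □₁ (psi □₁ idb X))
    ∘ (idb L □₁ cot_lunit X).

Lemma comatrix_deltaE t :
  tassoc L X E ((i ⊗₁ idb E) (comatrix_delta t)) = (idb L ⊗₁ w) (i t).
Proof.
rewrite /comatrix_delta !bicompE -cot_incl_lE asVE ?cot_incl_rE //.
do 3![rewrite cot_mapE; [|exact: idb_rcolinear|by []]].
by rewrite -!tens_compr.
Qed.

(** A second description of the coproduct, as the restriction of z ⊗ X. By the cotensor relation of
    E, the element of C fed to psi may be split off L instead of X. *)
Lemma comatrix_delta_iE t :
  (idb E ⊗₁ i) (comatrix_delta t) = tassoc E L X ((z ⊗₁ idb X) (i t)).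
Proof.
apply: (proj1 (i_tensr (good_left_tensor L_good X_good))).
apply: (@tassoc_inj _ _ _ _ _ L X (L ⊗ X)).
rewrite tens_map_swap tassoc_natr comatrix_deltaE -tassoc_natl.
rewrite (tens_comprE _ w_incl) tassoc_pentagon.
have e1 v : (tassoc L X L ⊗₁ idb X) (((i ⊗₁ idb L) ⊗₁ idb X) ((z ⊗₁ idb X) v)) =
   ((idb L ⊗₁ psit) ⊗₁ idb X) ((rcoact L ⊗₁ idb X) v).
  rewrite -!tens_compl; apply: tens_mapl => l; exact: z_incl.
rewrite e1 tassoc_natm cot_inclE -!tens_compr.
exact: tens_mapr.
Qed.

Let comatrix_eps : bihom E (regular_bimod B) := ceps D ∘ omega.

(** Here omega acts on the left copy of E, so the description of the coproduct by [z] is the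
    suitable one: omega turns [z] into the coaction of L. *)
Lemma comatrix_counitl t :
  lunit E ((comatrix_eps ⊗₁ idb E) (comatrix_delta t)) = t.
Proof.
apply: (proj1 (good_kernel_iskernel i_good)).
rewrite lunit_nat -tens_map_swap comatrix_delta_iE -tassoc_natl lunit_tassoc.
rewrite !tens_map_comp -[RHS]tens_map_id; apply: eq_tens_map => // l.
by rewrite !bicompE tens_compl z_omega lcoact_counit.
Qed.

Lemma comatrix_counitr t :
  runit E ((idb E ⊗₁ comatrix_eps) (comatrix_delta t)) = t.
Proof.
apply: (proj1 (good_kernel_iskernel i_good)).
rewrite runit_nat tens_map_swap -runit_tassoc tassoc_natr comatrix_deltaE.
rewrite !tens_map_comp -[RHS]tens_map_id; apply: eq_tens_map => // x.
by rewrite !bicompE tens_compr w_omega rcoact_counit.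
Qed.

Let W_coassoc x :
  (idb X ⊗₁ tassoc L X (L ⊗ X)) (tassoc X (L ⊗ X) (L ⊗ X) ((W ⊗₁ idb (L ⊗ X)) (W x))) =
  (idb X ⊗₁ (idb L ⊗₁ W)) (W x).
Proof.
(* Left colinearity of psi: coacting on the X-factor of psi(c) amounts to splitting c by the
   coproduct of C. *)
have psi2 c : (W ⊗₁ idb L) (psit c) =
    (tassoc X L X ⊗₁ idb L) (tassocV (X ⊗ L) X L ((psit ⊗₁ psit) (cdelta C c))).
  rewrite /W !tens_compl -[X in ((_ ⊗₁ _) ⊗₁ _) X](tassocK (M := C)) psit_lcolinear.
  by rewrite -tassocV_natl -tens_map_lr.
(* Both sides are rebracketings of psi(x_(-2)) ⊗ psi(x_(-1)) ⊗ x_(0), which is [q]; [q'] has the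
   second psi already split into its two factors. *)
pose q := ((psit ⊗₁ psit) ⊗₁ idb X) ((cdelta C ⊗₁ idb X) (lcoact X x)).
pose q' := (tassocV (X ⊗ L) X L ⊗₁ idb X) q.
have qE : q = (tassoc (X ⊗ L) X L ⊗₁ idb X) q'.
  rewrite /q' -tens_compl -[LHS]tens_map_id; apply: eq_tens_map => // u.
  by rewrite bicompE tassocVK.
have -> : (W ⊗₁ idb (L ⊗ X)) (W x) =
    tassoc (X ⊗ (L ⊗ X)) L X (((tassoc X L X ⊗₁ idb L) ⊗₁ idb X) q').
  rewrite /q' /q -!tens_compl -tassoc_natl; congr (tassoc _ _ _ _).
  by rewrite -tens_compl; apply: tens_mapl => c; exact: psi2.
have -> : (idb X ⊗₁ (idb L ⊗₁ W)) (W x) =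
    tassoc X L _ ((idb (X ⊗ L) ⊗₁ tassoc X L X) (tassoc (X ⊗ L) (X ⊗ L) X q)).
  rewrite -tassoc_natr; congr (tassoc _ _ _ _).
  rewrite -tens_map_swap !tens_compr -lcoactA -tassoc_natm tens_map_swap.
  rewrite -tassoc_natl /q; congr (_ (tassoc _ _ _ _)).
  by rewrite -tens_compl; apply: tens_mapl => u; rewrite bicompE -tens_map_lr.
by rewrite qE -tassoc_pentagon tassoc_natl -tassoc_pentagon.
Qed.

(** Embedding the middle copy of E turns [comatrix_delta] into L ⊗ [w]; embedding the last copy
    turns [w] into [W]. What remains is [W_coassoc]. *)
Let w_coassoc x :
  tassoc X E E ((w ⊗₁ idb E) (w x)) = (idb X ⊗₁ comatrix_delta) (w x).
Proof.
apply: (proj1 (good_kernel_iskernel (b := b) (h := idb X ⊗₁ (cot_diff L X ⊗₁ idb E)) _)).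
  by apply: good_kernel_tensl; apply: good_kernel_tensr i_good.
rewrite -tassoc_natm (tens_complE _ w_incl).
apply: (@tens_tassoc_inj _ _ _ _ _ _ X L X E).
have e1 v : (idb X ⊗₁ tassoc L X E) ((idb X ⊗₁ (i ⊗₁ idb E))
    ((idb X ⊗₁ comatrix_delta) v)) = (idb X ⊗₁ (idb L ⊗₁ w)) ((idb X ⊗₁ i) v).
  by rewrite -!tens_compr; apply: tens_mapr => t; exact: comatrix_deltaE.
rewrite e1.
apply: (proj1 (good_kernel_iskernel (b := b)
  (j := idb X ⊗₁ (idb L ⊗₁ (idb X ⊗₁ i)))
  (h := idb X ⊗₁ (idb L ⊗₁ (idb X ⊗₁ cot_diff L X))) _)).
  by do 3!apply: good_kernel_tensl.
have e2 v : (idb X ⊗₁ (idb L ⊗₁ (idb X ⊗₁ i))) ((idb X ⊗₁ (idb L ⊗₁ w)) v) =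
    (idb X ⊗₁ (idb L ⊗₁ W)) v.
  apply: tens_comprE => u; apply: tens_comprE; exact: w_incl.
have e3 v : (idb X ⊗₁ (idb L ⊗₁ (idb X ⊗₁ i))) ((idb X ⊗₁ tassoc L X E) v) =
    (idb X ⊗₁ tassoc L X (L ⊗ X)) ((idb X ⊗₁ (idb (L ⊗ X) ⊗₁ i)) v).
  by rewrite -!tens_compr; apply: tens_mapr => u; rewrite !bicompE tassoc_natr.
by rewrite e2 e3 -tassoc_natr -tens_map_swap w_incl W_coassoc.
Qed.

Lemma comatrix_coassoc t :
  tassoc E E E ((comatrix_delta ⊗₁ idb E) (comatrix_delta t)) =
  (idb E ⊗₁ comatrix_delta) (comatrix_delta t).
Proof.
apply: (proj1 (i_tensr (good_left_tensor E_good E_good))).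
apply: tassoc_inj; rewrite -tassoc_natl tassoc_pentagon tens_map_swap tassoc_natr.
rewrite comatrix_deltaE.
have e1 v : (tassoc L X E ⊗₁ idb E) (((i ⊗₁ idb E) ⊗₁ idb E)
   ((comatrix_delta ⊗₁ idb E) v)) = ((idb L ⊗₁ w) ⊗₁ idb E) ((i ⊗₁ idb E) v).
  rewrite -!tens_compl; apply: tens_mapl => u; exact: comatrix_deltaE.
rewrite e1 tassoc_natm comatrix_deltaE -!tens_compr.
by apply: tens_mapr => x; exact: w_coassoc.
Qed.

Lemma comatrix_is_coring : is_coring comatrix_delta comatrix_eps.
Proof.
by split=> t; [exact: comatrix_coassoc|exact: comatrix_counitl|exact: comatrix_counitr].
Qed.
End ComatrixCoring.

(** * Coseparable corings *)

Section Coseparable.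
Variables (k : comPzRingType) (A B E : kalg k).
Variables (F : coring A) (C : coring B) (G : coring E).

(** The cointegral [pi] makes [s0] a left colinear retraction of the coaction of N, and then (M ⊗
    s0)(ρ ⊗ N) projects M ⊗ N onto the cotensor product. M and N are prebicomodules so that cotensor
    products can be inserted for them. *)
Lemma coseparable_split_kernel (M : prebicomod F C) (N : prebicomod C G) :
    coseparable C ->
    (forall x, tassoc M C C ((rcoact M ⊗₁ idb C) (rcoact M x)) =
       (idb M ⊗₁ cdelta C) (rcoact M x)) ->
    is_lcoaction (lcoact N) ->
  split_kernel (cot_incl M N) (cot_diff M N).
Proof.
move=> [p [pl pr] pK] rhoA [lamA lamK].
pose pi : bihom (C ⊗ C) (regular_bimod B) := ceps C ∘ p.
(* Bicolinearity recovers p from [pi] on either side: c_(1) pi(c_(2) ⊗ c') = p(c ⊗ c') = pi(c ⊗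
   c'_(1)) c'_(2). *)
have p_pir t : p t = runit C ((idb C ⊗₁ pi) (tassoc C C C ((cdelta C ⊗₁ idb C) t))).
  case: (coringP C) => _ _ eK; rewrite -[LHS]eK !bicompE tens_compr.
  by congr (runit _ (_ _)); exact: pl.
have p_pil t : p t = lunit C ((pi ⊗₁ idb C) (tassocV C C C ((idb C ⊗₁ cdelta C) t))).
  case: (coringP C) => _ eK _; rewrite -[LHS]eK !bicompE tens_compl.
  by congr (lunit _ (_ _)); exact: pr.
(* The contracting homotopy m ⊗ c ⊗ n |-> m ⊗ pi (c ⊗ n_(-1)) n_(0). *)
pose s0 : bihom (C ⊗ N) N :=
  lunit N ∘ (pi ⊗₁ idb N) ∘ tassocV C C N ∘ (idb C ⊗₁ lcoact N).
(* q(c ⊗ n) = p(c ⊗ n_(-1)) ⊗ n_(0) is the common value of the two sides of the colinearity of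
   [s0]. *)
pose q u := (p ⊗₁ idb N) (tassocV C C N ((idb C ⊗₁ lcoact N) u)).
have lam_s0 u : lcoact N (s0 u) = q u.
  pose v := tassocV C C N ((idb C ⊗₁ lcoact N) u).
  have vE : (idb C ⊗₁ lcoact N) u = tassoc C C N v by rewrite tassocVK.
  rewrite /s0 !bicompE lunit_nat -tens_map_swap -tassocV_natr.
  have -> : (idb C ⊗₁ (idb C ⊗₁ lcoact N)) ((idb C ⊗₁ lcoact N) u) =
      (idb C ⊗₁ tassoc C C N) ((idb C ⊗₁ (cdelta C ⊗₁ idb N)) ((idb C ⊗₁ lcoact N) u)).
    by rewrite -!tens_compr; apply: tens_mapr => n; exact/esym/lamA.
  rewrite vE -tassoc_natm /q -/v.
  have -> t : tassocV C C (C ⊗ N) ((idb C ⊗₁ tassoc C C N) (tassoc C (C ⊗ C) N t)) =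
      tassoc (C ⊗ C) C N ((tassocV C C C ⊗₁ idb N) t).
    apply: (@tassoc_inj _ _ _ _ _ C C (C ⊗ N)); rewrite tassocVK tassoc_pentagon.
    congr (_ (tassoc _ _ _ _)); rewrite -tens_compl -[LHS]tens_map_id.
    by apply: eq_tens_map => // x; rewrite bicompE tassocVK.
  rewrite -tassoc_natl lunit_tassoc -!tens_compl; apply: tens_mapl => t.
  by rewrite !bicompE -p_pil.
have s0_delta u : (idb C ⊗₁ s0) (tassoc C C N ((cdelta C ⊗₁ idb N) u)) = q u.
  pose v := tassocV C C N ((idb C ⊗₁ lcoact N) u).
  have vE : (idb C ⊗₁ lcoact N) u = tassoc C C N v by rewrite tassocVK.
  rewrite /s0 !tens_compr -tassoc_natr -tens_map_swap.
  rewrite vE /q -/v -tassoc_natl tassoc_pentagon.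
  have -> t : (idb C ⊗₁ tassocV C C N) ((idb C ⊗₁ tassoc C C N) t) = t.
    rewrite -tens_compr -[RHS]tens_map_id.
    by apply: eq_tens_map => // x; rewrite bicompE tassocK.
  rewrite -tassoc_natm unit_triangle -!tens_compl; apply: tens_mapl => t.
  by rewrite !bicompE -p_pir.
have s0K n : s0 (lcoact N n) = n.
  have lamA' : (idb C ⊗₁ lcoact N) (lcoact N n) =
    tassoc C C N ((cdelta C ⊗₁ idb N) (lcoact N n)) by exact/esym/lamA.
  rewrite /s0 !bicompE lamA' tassocK -[RHS]lamK !bicompE; congr (lunit _ _).
  by apply: tens_complE => c; rewrite !bicompE; congr (ceps C _); exact: pK.
pose s : bihom (M ⊗ (C ⊗ N)) (M ⊗ N) := idb M ⊗₁ s0.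
pose e : bihom (M ⊗ N) (M ⊗ N) := s ∘ tassoc M C N ∘ (rcoact M ⊗₁ idb N).
(* Colinearity of [s0] and coassociativity on M put the image of [e] into the cotensor product. *)
have e_ker t : cot_diff M N (e t) = 0.
  apply/eqP; rewrite cot_diffE subr_eq0; apply/eqP; rewrite /e /s !bicompE.
  pose t' := tassoc M C N ((rcoact M ⊗₁ idb N) t).
  have qE : (idb M ⊗₁ lcoact N) ((idb M ⊗₁ s0) t') =
      (idb M ⊗₁ (idb C ⊗₁ s0)) ((idb M ⊗₁ tassoc C C N)
         ((idb M ⊗₁ (cdelta C ⊗₁ idb N)) t')).
    by rewrite -!tens_compr; apply: tens_mapr => u; rewrite !bicompE lam_s0 s0_delta.
  rewrite qE tens_map_swap tassoc_natr /t' -tassoc_natm; congr (_ _).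
  rewrite -tassoc_natl tassoc_pentagon; congr (_ (tassoc _ _ _ _)).
  by rewrite -!tens_compl; apply: tens_mapl => m; rewrite !bicompE rhoA.
pose r : bihom (M ⊗ N) (M □ N) := corestr (cot_incl M N) e.
have rE t : cot_incl M N (r t) = e t.
  by move: t; apply: corestr_kerE.
(* The sign is dictated by [cot_diff] = ρ - λ: sρ - s(ρ - λ) = sλ, which is the identity by
   [s0K]. *)
apply: (split_kernelI (r := r) (s := bihom_sub (bihom0 _ _) s)).
  exact: cot_incl_iskernel.
move=> t; rewrite rE [bihom_sub _ _ _]sub0r cot_diffE bihomB opprB /e !bicompE.
rewrite addrC subrK /s -tens_compr -[RHS]tens_map_id.
by apply: eq_tens_map => // n; exact: s0K.
Qed.
End Coseparable.

Section CotensorComodule.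
Variables (k : comPzRingType) (A B E : kalg k).
Variables (C : coring A) (D : coring B) (F : coring E).
Variables (M : bicomod C D) (N : bicomod D F).

Lemma rcoact_cotensA t :
    (forall t, (cot_incl M N ⊗₁ idb F) (rcoact (M □ N) t) =
       tassocV M N F ((idb M ⊗₁ rcoact N) (cot_incl M N t))) ->
    injective (cot_incl M N ⊗₁ idb (F ⊗ F)) ->
  tassoc _ F F ((rcoact (M □ N) ⊗₁ idb F) (rcoact (M □ N) t)) =
  (idb (M □ N) ⊗₁ cdelta F) (rcoact (M □ N) t).
Proof.
move=> rE inj; apply: inj; set i := cot_incl M N; apply: (@tassoc_inj _ _ _ _ _ M N).
have e1 v : ((i ⊗₁ idb F) ⊗₁ idb F) ((rcoact (M □ N) ⊗₁ idb F) v) =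
    (tassocV M N F ⊗₁ idb F) (((idb M ⊗₁ rcoact N) ⊗₁ idb F) ((i ⊗₁ idb F) v)).
  by rewrite -!tens_compl; exact: tens_mapl.
rewrite -tassoc_natl e1 tens_map_swap rE -tassocV_natm -tassocV_natr tassocVK.
have -> : (idb M ⊗₁ (idb N ⊗₁ cdelta F)) ((idb M ⊗₁ rcoact N) (i t)) =
    (idb M ⊗₁ tassoc N F F) ((idb M ⊗₁ (rcoact N ⊗₁ idb F)) ((idb M ⊗₁ rcoact N) (i t))).
  by rewrite -!tens_compr; apply: tens_mapr => n; exact/esym/rcoactA.
rewrite tassoc_pentagon; congr (_ _).
rewrite -[RHS](tassocVK (M := M)); congr (tassoc _ _ _ _).
rewrite -tens_compl -[RHS]tens_map_id; apply: eq_tens_map => // x.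
by rewrite bicompE tassocVK.
Qed.

Lemma lcoact_cotensP :
    (forall t, (idb C ⊗₁ cot_incl M N) (lcoact (M □ N) t) =
       tassoc C M N ((lcoact M ⊗₁ idb N) (cot_incl M N t))) ->
    injective (idb C ⊗₁ (idb C ⊗₁ cot_incl M N)) ->
  is_lcoaction (lcoact (M □ N)).
Proof.
move=> lE inj; set i := cot_incl M N; split=> t; last first.
  apply: (proj1 (cot_incl_iskernel M N)).
  rewrite bicompE lunit_nat bicompE -tens_map_swap lE -tassoc_natl lunit_tassoc.
  rewrite -!tens_compl -[RHS]tens_map_id; apply: eq_tens_map => // m.
  exact: lcoact_counit.
apply: inj; rewrite !bicompE -tassoc_natr -tens_map_swap lE -tassoc_natl tassoc_pentagon.
have e1 v : (idb C ⊗₁ (idb C ⊗₁ i)) ((idb C ⊗₁ lcoact (M □ N)) v) =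
   (idb C ⊗₁ tassoc C M N) ((idb C ⊗₁ (lcoact M ⊗₁ idb N)) ((idb C ⊗₁ i) v)).
  by rewrite -!tens_compr; exact: tens_mapr.
rewrite e1 lE -tassoc_natm; congr (_ (tassoc _ _ _ _)).
by rewrite -!tens_compl; apply: tens_mapl => m; exact: lcoactA.
Qed.
End CotensorComodule.

Lemma bicomod_split_kernel (k : comPzRingType) (A B E : kalg k) (C : coring A)
    (D : coring B) (F : coring E) (X : bicomod C D) (L : bicomod D F) :
  coseparable D -> split_kernel (cot_incl X L) (cot_diff X L).
Proof.
move=> cD; apply: coseparable_split_kernel => //; first exact: rcoactA.
by case: (bicomodP L).
Qed.

Section CoseparableCase.
Variables (k : comPzRingType) (A B : kalg k) (C : coring A) (D : coring B).

Lemma bicomod_cotensl_split_kernel (X : bicomod C D) (L : bicomod D C) :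
    coseparable C -> coseparable D ->
  split_kernel (cot_incl (X □ L) X) (cot_diff (X □ L) X).
Proof.
move=> cC cD; have sk := bicomod_split_kernel X L cD.
apply: coseparable_split_kernel => //; last by case: (bicomodP X).
move=> t; apply: rcoact_cotensA.
  move=> u; apply: rcoact_cotensE; first exact: bicomod_compat.
  exact/split_kernel_iskernel/split_kernel_tensr.
exact: (proj1 (split_kernel_iskernel (split_kernel_tensr _ sk))).
Qed.

Lemma bicomod_cotensr_split_kernel (X : bicomod C D) (L : bicomod D C) :
    coseparable C -> coseparable D ->
  split_kernel (cot_incl X (L □ X)) (cot_diff X (L □ X)).
Proof.
move=> cC cD; have sk := bicomod_split_kernel L X cC.
apply: coseparable_split_kernel => //; first exact: rcoactA.
apply: lcoact_cotensP.
  move=> u; apply: lcoact_cotensE; first exact: bicomod_compat.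
  exact/split_kernel_iskernel/split_kernel_tensl.
apply: (proj1 (split_kernel_iskernel (h := idb D ⊗₁ (idb D ⊗₁ cot_diff L X)) _)).
by do 2!apply: split_kernel_tensl.
Qed.
End CoseparableCase.

(** * Coflat comodules *)

Section TensorComodule.
Variables (k : comPzRingType) (A B D : kalg k) (C : coring D).
Variables (M : bimod B D) (rho : bihom M (M ⊗ C)).

Definition tens_rcoact (P : bimod A B) : bihom (P ⊗ M) (P ⊗ M ⊗ C) :=
  tassocV P M C ∘ (idb P ⊗₁ rho).

Lemma tens_rcoactP (P : bimod A B) : is_rcoaction rho -> is_rcoaction (tens_rcoact P).
Proof.
move=> [rhoA rhoK]; rewrite /tens_rcoact; split=> t; rewrite !bicompE.
  apply: (@tassoc_inj _ _ _ _ _ P M (C ⊗ C)).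
  rewrite -tassocV_natr tassocVK tens_compl.
  rewrite -tassocV_natm tassoc_pentagon.
  rewrite -[RHS]tens_compr -(eq_tens_map (frefl _) rhoA) !tens_compr.
  congr (_ _); rewrite -[RHS](tassocVK (M := P)); congr (tassoc _ _ _ _).
  rewrite -tens_compl -[RHS]tens_map_id; apply: eq_tens_map => // x.
  by rewrite bicompE tassocVK.
rewrite -tassocV_natr -runit_tassoc tassocVK -!tens_compr -[RHS]tens_map_id.
exact: tens_mapr.
Qed.

Lemma tens_rcolinear (P Q : bimod A B) (f : bihom P Q) :
  is_rcolinear (tens_rcoact P) (tens_rcoact Q) (f ⊗₁ idb M).
Proof. by move=> t; rewrite !bicompE -tens_map_swap tassocV_natl. Qed.

(** P ⊗ M carries the coaction of M, so the equation of (P ⊗ M) □ N is P ⊗ that of M □ N. This is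
    how coflatness, a statement about comodules, bears on the purity of a kernel. *)
Lemma tens_cotens_diff (E : kalg k) (N : bimod D E) (lam : bihom N (C ⊗ N))
    (P : bimod A B) t :
  tassoc P M (C ⊗ N) (cotens_diff (tens_rcoact P) lam t) =
  (idb P ⊗₁ cotens_diff rho lam) (tassoc P M N t).
Proof.
have diffE v : (idb P ⊗₁ cotens_diff rho lam) v =
    (idb P ⊗₁ tassoc M C N) ((idb P ⊗₁ (rho ⊗₁ idb N)) v)
    - (idb P ⊗₁ (idb M ⊗₁ lam)) v.
  by rewrite [LHS]tens_map_subr ?tens_compr.
rewrite diffE -tassoc_natr -tassoc_natm.
have -> : cotens_diff (tens_rcoact P) lam t =
  tassoc (P ⊗ M) C N ((tens_rcoact P ⊗₁ idb N) t) - (idb (P ⊗ M) ⊗₁ lam) t by [].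
have e1 : (tassoc P M C ⊗₁ idb N) ((tens_rcoact P ⊗₁ idb N) t) =
    ((idb P ⊗₁ rho) ⊗₁ idb N) t.
  by apply: tens_complE => u; rewrite /tens_rcoact bicompE tassocVK.
by rewrite bihomB tassoc_pentagon e1.
Qed.
End TensorComodule.

Section Coflat.
Variables (k : comPzRingType) (A B : kalg k) (C : coring A) (X : bimod A B).
Variable lam : bihom X (C ⊗ X).

(** Coflatness in terms of elements of tensor products, free of [cotens_map_of]: a solution of the
    cotensor equation killed by g lifts to a solution. *)
Lemma coflat_exact (P Q S : bimod (base_kalg k) A)
    (rhoP : bihom P (P ⊗ C)) (rhoQ : bihom Q (Q ⊗ C)) (rhoS : bihom S (S ⊗ C))
    (f : bihom P Q) (g : bihom Q S) (u : Q ⊗ X) :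
    coflat lam ->
    is_rcoaction rhoP -> is_rcoaction rhoQ -> is_rcoaction rhoS ->
    is_rcolinear rhoP rhoQ f -> is_rcolinear rhoQ rhoS g -> exact_pair f g ->
    cotens_diff rhoQ lam u = 0 -> (g ⊗₁ idb X) u = 0 ->
  exists2 v, cotens_diff rhoP lam v = 0 & (f ⊗₁ idb X) v = u.
Proof.
move=> fl cP cQ cS fP gP ex u_ker gu.
have kerP (V : bimod (base_kalg k) A) (rhoV : bihom V (V ⊗ C)) :=
  ker_iskernel (cotens_diff rhoV lam).
have [z zu] := ((kerP _ rhoQ).2 u).1 u_ker.
have mapE (V V' : bimod (base_kalg k) A) (rhoV : bihom V (V ⊗ C))
    (rhoV' : bihom V' (V' ⊗ C)) (e : bihom V V') t :
    is_rcolinear rhoV rhoV' e ->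
    cotens_incl rhoV' lam (cotens_map_of rhoV rhoV' lam lam e (idb X) t) =
    (e ⊗₁ idb X) (cotens_incl rhoV lam t).
  by move=> eP; apply: (cotens_map_ofE eP); exact: idb_lcolinear.
have [|z' z'z] := (fl _ _ _ _ _ _ _ _ cP cQ cS fP gP ex z).1.
  apply: (proj1 (kerP _ rhoS)); rewrite raddf0.
  by apply: etrans (mapE _ _ _ _ _ _ gP) _; rewrite [cotens_incl _ _ _]zu.
exists (cotens_incl rhoP lam z'); first by apply/(kerP _ rhoP).2; exists z'.
by rewrite -(mapE _ _ _ _ _ _ fP) z'z.
Qed.

(* (V ⊗ C) □ X retracts onto V ⊗ X, by the counit. *)
Lemma coflat_lflat : lflat C -> is_lcoaction lam -> coflat lam -> lflat X.
Proof.
move=> flC [lamA lamK] fl P Q S f g ex t; split=> [gt|[s <-]]; last first.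
  by rewrite -tens_compl; apply: tens_mapl0 => x; apply/ex; exists x.
pose rho (V : bimod (base_kalg k) A) := tens_rcoact (cdelta C) V.
have cP (V : bimod (base_kalg k) A) : is_rcoaction (rho V).
  by apply: tens_rcoactP; case: (coringP C).
pose th (V : bimod (base_kalg k) A) : bihom (V ⊗ X) (V ⊗ C ⊗ X) :=
  tassocV V C X ∘ (idb V ⊗₁ lam).
pose eta (V : bimod (base_kalg k) A) : bihom (V ⊗ C ⊗ X) (V ⊗ X) :=
  (idb V ⊗₁ (lunit X ∘ (ceps C ⊗₁ idb X))) ∘ tassoc V C X.
have thK V u : eta V (th V u) = u.
  rewrite !bicompE tassocVK -tens_compr -[RHS]tens_map_id; exact: tens_mapr.
have thN (V V' : bimod (base_kalg k) A) (e : bihom V V') u :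
    ((e ⊗₁ idb C) ⊗₁ idb X) (th V u) = th V' ((e ⊗₁ idb X) u).
  by rewrite !bicompE -tassocV_natl tens_map_swap.
have etaN (V V' : bimod (base_kalg k) A) (e : bihom V V') u :
    eta V' (((e ⊗₁ idb C) ⊗₁ idb X) u) = (e ⊗₁ idb X) (eta V u).
  by rewrite !bicompE tassoc_natl -tens_map_swap.
have th_ker u : cotens_diff (rho Q) lam (th Q u) = 0.
  apply: tassoc_inj; rewrite tens_cotens_diff raddf0 tassocVK.
  by rewrite -tens_compr; apply: tens_mapr0 => x; apply/eqP; rewrite subr_eq0; apply/eqP/lamA.
(* Coflatness is applied to the cofree comodules V ⊗ C, whose sequence is exact because C is left
   flat. *)
have [|v _ vt] := coflat_exact fl (cP P) (cP Q) (cP S) (tens_rcolinear _ f)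
  (tens_rcolinear _ g) (flC _ _ _ _ _ ex) (th_ker t).
  by rewrite thN gt raddf0.
by exists (eta P v); rewrite -etaN vt thK.
Qed.
End Coflat.

(** * Submodules and images *)

Record submodule (k : comPzRingType) (A B : kalg k) (M : bimod A B) := Submodule {
  sub_mem : M -> Prop;
  sub_mem0 : sub_mem 0;
  sub_memB : forall x y, sub_mem x -> sub_mem y -> sub_mem (x - y);
  sub_mem_lact : forall a x, sub_mem x -> sub_mem (a *> x);
  sub_mem_ract : forall x b, sub_mem x -> sub_mem (x <* b)
}.

Section Submodule.
Variables (k : comPzRingType) (A B : kalg k) (M : bimod A B) (S : submodule M).

Definition sub_pred : {pred M} := fun x => `[< sub_mem S x >].

Fact sub_pred_closed : zmod_closed sub_pred.
Proof.
split=> [|x y]; rewrite !unfold_in; first exact/asboolP/sub_mem0.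
by move=> /asboolP Sx /asboolP Sy; exact/asboolP/sub_memB.
Qed.
HB.instance Definition _ := GRing.isZmodClosed.Build M sub_pred sub_pred_closed.

Record sub_sort := SubElt { sub_val : M; _ : sub_val \in sub_pred }.
HB.instance Definition _ := [isSub for sub_val].
HB.instance Definition _ := [Choice of sub_sort by <:].
HB.instance Definition _ := [SubChoice_isSubZmodule of sub_sort by <:].

Lemma sub_valP (x : sub_sort) : sub_mem S (val x).
Proof. exact/asboolP/(valP x). Qed.

Fact sub_lact_subproof a (x : sub_sort) : a *> val x \in sub_pred.
Proof. exact/asboolP/sub_mem_lact/sub_valP. Qed.
Fact sub_ract_subproof (x : sub_sort) b : val x <* b \in sub_pred.
Proof. exact/asboolP/sub_mem_ract/sub_valP. Qed.
Definition sub_lact a x := SubElt (sub_lact_subproof a x).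
Definition sub_ract x b := SubElt (sub_ract_subproof x b).

Fact sub_bimodP : bimod_axioms sub_lact sub_ract.
Proof.
split; [split|split| |].
- by move=> a x y; apply: val_inj; rewrite /= lactDr.
- by move=> a b x; apply: val_inj; rewrite /= lactDl.
- by move=> a b x; apply: val_inj; rewrite /= lactM.
- by move=> x; apply: val_inj; rewrite /= lact1.
- by move=> a x y; apply: val_inj; rewrite /= ractDl.
- by move=> a b x; apply: val_inj; rewrite /= ractDr.
- by move=> a b x; apply: val_inj; rewrite /= ractM.
- by move=> x; apply: val_inj; rewrite /= ract1.
- by move=> a x b; apply: val_inj; rewrite /= lractA.
- by move=> c x; apply: val_inj; rewrite /= lract_base.
Qed.
Definition sub_bimod : bimod A B := Bimod sub_bimodP.

Definition sub_incl : bihom sub_bimod M :=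
  @Bihom _ _ _ sub_bimod M val (fun _ _ => erefl) (fun _ _ => erefl) (fun _ _ => erefl).

Lemma sub_incl_inj : injective sub_incl.
Proof. exact: val_inj. Qed.

Lemma sub_inclP x : (exists y, sub_incl y = x) <-> sub_mem S x.
Proof.
split=> [[y <-]|Sx]; first exact: sub_valP.
have xP : x \in sub_pred by exact/asboolP.
by exists (SubElt xP).
Qed.
End Submodule.

Section Image.
Variables (k : comPzRingType) (A B : kalg k) (M N : bimod A B) (f : bihom M N).

Definition image_sub : submodule N.
Proof.
apply: (@Submodule _ _ _ N (fun y => exists x, f x = y)).
- by exists 0; exact: raddf0.
- by move=> _ _ [x <-] [y <-]; exists (x - y); exact: raddfB.
- by move=> a _ [x <-]; exists (a *> x); exact: bihom_lact.
- by move=> _ a [x <-]; exists (x <* a); exact: bihom_ract.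
Defined.

Definition image_proj : bihom M (sub_bimod image_sub) := corestr (sub_incl image_sub) f.
Lemma image_projE x : sub_incl image_sub (image_proj x) = f x.
Proof.
move: x; apply: corestr_lift; first exact: sub_incl_inj.
by move=> x; apply/sub_inclP; exists x.
Qed.
Lemma image_proj_surj (y : sub_bimod image_sub) : exists x, image_proj x = y.
Proof.
have [|x xy] := (sub_inclP image_sub (sub_incl image_sub y)).1; first by exists y.
by exists x; apply: (@sub_incl_inj _ _ _ _ image_sub); rewrite image_projE.
Qed.
End Image.

(** * Finite free modules *)

Section FiniteFree.
Variables (k : comPzRingType) (A : kalg k) (n : nat).

Definition free_lact (c : base_kalg k) (f : {ffun 'I_n -> A}) : {ffun 'I_n -> A} :=
  [ffun j => kalg_map A c * f j].
Definition free_ract (f : {ffun 'I_n -> A}) (a : A) : {ffun 'I_n -> A} :=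
  [ffun j => f j * a].
Fact free_bimodP : @bimod_axioms k (base_kalg k) A _ free_lact free_ract.
Proof.
split; [split|split| |].
- by move=> a x y; apply/ffunP=> j; rewrite !ffunE mulrDr.
- by move=> a b x; apply/ffunP=> j; rewrite !ffunE raddfD mulrDl.
- by move=> a b x; apply/ffunP=> j; rewrite !ffunE rmorphM mulrA.
- by move=> x; apply/ffunP=> j; rewrite !ffunE rmorph1 mul1r.
- by move=> b x y; apply/ffunP=> j; rewrite !ffunE mulrDl.
- by move=> x b c; apply/ffunP=> j; rewrite !ffunE mulrDr.
- by move=> x b c; apply/ffunP=> j; rewrite !ffunE mulrA.
- by move=> x; apply/ffunP=> j; rewrite !ffunE mulr1.
- by move=> a x b; apply/ffunP=> j; rewrite !ffunE mulrA.
- by move=> c x; apply/ffunP=> j; rewrite !ffunE kalg_central.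
Qed.
Definition free_bimod : bimod (base_kalg k) A := Bimod free_bimodP.

Definition free_delta (j : 'I_n) : free_bimod := [ffun l => (l == j)%:R] : {ffun 'I_n -> A}.

Section FreeMap.
Variables (P : bimod (base_kalg k) A) (p : 'I_n -> P).
Definition free_fun (f : free_bimod) : P := \sum_(j < n) p j <* ((f : {ffun 'I_n -> A}) j).
Fact free_funD : {morph free_fun : x y / x + y}.
Proof.
move=> x y; rewrite /free_fun -big_split; apply: eq_bigr => j _.
by rewrite -[RHS]/(_ + _) -ractDr; congr (_ <* _); exact: ffunE.
Qed.
Fact free_fun_lact c x : free_fun (c *> x) = c *> free_fun x.
Proof.
rewrite /free_fun (big_morph _ (lactDr c) (lact0 _ c)); apply: eq_bigr => j _.
rewrite lractA -[c *> p j]/(kalg_map (base_kalg k) c *> p j) lract_base -ractM.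
by congr (_ <* _); exact: ffunE.
Qed.
Fact free_fun_ract x a : free_fun (x <* a) = free_fun x <* a.
Proof.
rewrite /free_fun (big_morph _ (ractDl a) (ract0 _ a)); apply: eq_bigr => j _.
by rewrite -ractM; congr (_ <* _); exact: ffunE.
Qed.
Definition free_map : bihom free_bimod P := Bihom free_funD free_fun_lact free_fun_ract.
Lemma free_map_delta j : free_map (free_delta j) = p j.
Proof.
rewrite [LHS](bigD1 j) //= big1 => [|l nlj].
  by rewrite addr0 ffunE eqxx ract1.
rewrite ffunE (negbTE nlj); apply: (addrI (p l <* 0)).
by rewrite -ractDr !addr0.
Qed.
End FreeMap.

Section FreeTensor.
Variables (B : kalg k).
Implicit Type M : bimod A B.

Fact free_coord_bal M j :
  balanced (fun (f : free_bimod) (x : M) => ((f : {ffun 'I_n -> A}) j) *> x).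
Proof.
split=> [f f' x|f x y|f a x]; last 1 [rewrite -lactM; congr (_ *> _); exact: ffunE].
- by rewrite -lactDl; congr (_ *> _); exact: ffunE.
- exact: lactDr.
Qed.
Definition free_coord M j (t : free_bimod ⊗ M) : M :=
  tens_lift (fun (f : free_bimod) (x : M) => ((f : {ffun 'I_n -> A}) j) *> x) t.
Lemma free_coordE M j (f : free_bimod) (x : M) :
  free_coord j (f ⊗' x) = ((f : {ffun 'I_n -> A}) j) *> x.
Proof. exact: tens_liftE (free_coord_bal M j) f x. Qed.
Lemma free_coordD M j : {morph @free_coord M j : s t / s + t}.
Proof. exact: tens_liftD (free_coord_bal M j). Qed.
Lemma free_coord0 M j : @free_coord M j 0 = 0.
Proof. exact: tens_lift0 (free_coord_bal M j). Qed.

Lemma free_coord_nat M N (h : bihom M N) j t :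
  h (free_coord j t) = free_coord j ((idb _ ⊗₁ h) t).
Proof.
move: t; apply: tens_ext => [s t|s t|f x].
- by rewrite free_coordD bihomD.
- by rewrite bihomD free_coordD.
by rewrite free_coordE tens_mapE free_coordE bihom_lact.
Qed.

Lemma free_expand M t : t = \sum_(j < n) (free_delta j ⊗' @free_coord M j t).
Proof.
move: t; apply: tens_ext => [//|s t|f x].
  rewrite -big_split; apply: eq_bigr => j _.
  by rewrite free_coordD -[RHS]/(_ + _); exact: pure_tensDr.
transitivity ((\sum_(j < n) free_delta j <* (f : {ffun 'I_n -> A}) j) ⊗' x).
  congr (_ ⊗' x); apply/ffunP => l.
  rewrite sum_ffunE (bigD1 l) //= big1 => [|j njl].
    by rewrite !ffunE eqxx mul1r addr0.
  by rewrite !ffunE eq_sym (negbTE njl) mul0r.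
rewrite (big_morph (fun u => u ⊗' x) (fun u v => pure_tensDl u v x) (pure_tens0l _ x)).
by apply: eq_bigr => j _; rewrite free_coordE; exact: pure_tens_bal.
Qed.

(** Tensoring with a free module of rank n gives n copies, so the kernel is checked coordinate by
    coordinate. *)
Lemma free_iskernel K M N (j : bihom K M) (h : bihom M N) :
  iskernel j h -> iskernel (idb free_bimod ⊗₁ j) (idb free_bimod ⊗₁ h).
Proof.
move=> [inj_j ex]; split.
  apply: bihom_inj => t jt; rewrite (free_expand t) big1 // => l _.
  suff -> : free_coord l t = 0 by exact: pure_tens0r.
  by apply: inj_j; rewrite free_coord_nat jt free_coord0 raddf0.
move=> t; split=> [ht|[s <-]].
  have /choice[c cE] l : exists y, j y = free_coord l t.
    by apply/ex; rewrite free_coord_nat ht free_coord0.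
  exists (\sum_(l < n) (free_delta l ⊗' c l)).
  rewrite (big_morph _ (bihomD _) (raddf0 _)) [RHS](free_expand t); apply: eq_bigr => l _.
  by rewrite tens_mapE cE.
by rewrite -tens_compr; apply: tens_mapr0 => x; apply/ex; exists x.
Qed.
End FreeTensor.
End FiniteFree.

(** A tensor is a finite sum of pure tensors; [p] sends a basis to their left entries. *)
Lemma tens_free_lift (k : comPzRingType) (A B : kalg k) (P : bimod (base_kalg k) A)
    (M : bimod A B) (t : P ⊗ M) :
  exists n, exists p : 'I_n -> P, exists s : free_bimod A n ⊗ M,
    (free_map p ⊗₁ idb M) s = t.
Proof.
(* [d] is only the default of [nth], never reached for indices below [size r]. *)
pose d : P * M := (0, 0); pose r := repr t.
exists (size r), (fun l => (nth d r l).1),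
  (\sum_(l < size r) (free_delta A l ⊗' (nth d r l).2)).
rewrite (big_morph _ (bihomD _) (raddf0 _)) [RHS]tens_reprE -/r (big_nth d) big_mkord.
apply: eq_bigr => l _.
by rewrite tens_mapE free_map_delta.
Qed.

(** * Purity of the cotensor kernel of a coflat comodule *)

Section CoflatPurity.
Variables (k : comPzRingType) (A B E : kalg k) (C : coring A).
Variables (M : bimod E A) (rho : bihom M (M ⊗ C)).
Variables (X : bimod A B) (lam : bihom X (C ⊗ X)).
Hypotheses (rhoP : is_rcoaction rho) (X_coflat : coflat lam).
Hypotheses (M_flat : lflat M) (C_flat : lflat C) (X_flat : lflat X).
Let j := cotens_incl rho lam.
Let h := cotens_diff rho lam.

Let tens_coaction (P : bimod (base_kalg k) E) : is_rcoaction (tens_rcoact rho P).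
Proof. exact: tens_rcoactP. Qed.

Let h_j (P : bimod (base_kalg k) E) t : (idb P ⊗₁ h) ((idb P ⊗₁ j) t) = 0.
Proof.
by rewrite -tens_compr; apply: tens_mapr0 => x; exact: ker_valK.
Qed.

(** Left flatness of M makes the sequence of comodules P ⊗ M, Q ⊗ M, S ⊗ M exact, and coflatness of
    X is applied to it. *)
Let coflat_lift (P Q S : bimod (base_kalg k) E) (f : bihom P Q) (g : bihom Q S) t :
    exact_pair f g -> (idb Q ⊗₁ h) t = 0 -> (g ⊗₁ idb _) t = 0 ->
  exists2 s, (idb P ⊗₁ h) s = 0 & (f ⊗₁ idb _) s = t.
Proof.
move=> ex ht gt.
have [||s hs st] := coflat_exact (u := tassocV Q M X t) X_coflat (tens_coaction P)
  (tens_coaction Q) (tens_coaction S) (tens_rcolinear _ f) (tens_rcolinear _ g)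
  (M_flat ex).
- by apply: tassoc_inj; rewrite tens_cotens_diff tassocVK ht raddf0.
- by rewrite -tassocV_natl gt raddf0.
exists (tassoc P M X s); first by rewrite -tens_cotens_diff hs raddf0.
by rewrite -tassoc_natl st tassocVK.
Qed.

(* P ⊗ (M □ X) = (P ⊗ M) □ X holds for P finite free; coflatness lifts elements
   of the right-hand side along a map from a finite free module. *)
Let coflat_pure_exact (P : bimod (base_kalg k) E) t :
  (idb P ⊗₁ h) t = 0 -> exists s, (idb P ⊗₁ j) s = t.
Proof.
move=> ht; have [n [p [u ut]]] := tens_free_lift t.
pose g := image_proj (free_map p); pose im := sub_incl (image_sub (free_map p)).
have gE x : im (g x) = free_map p x by exact: image_projE.
pose t0 := (g ⊗₁ idb (M ⊗ X)) u.
have t0E : (im ⊗₁ idb (M ⊗ X)) t0 = t by rewrite (tens_complE _ gE).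
(* The equation for [t0] is tested in P ⊗ (M ⊗ (C ⊗ X)), where the image embeds because M ⊗ (C ⊗ X)
   is left flat. *)
have ht0 : (idb _ ⊗₁ h) t0 = 0.
  apply: (lflat_inj (lflat_tensor M_flat (lflat_tensor C_flat X_flat)) (@sub_incl_inj _ _ _ _ _)).
  by rewrite tens_map_swap t0E ht raddf0.
(* Surjectivity of [g] written as exactness before a zero map, so that [coflat_lift] applies; its
   third condition then holds trivially. *)
have ex : exact_pair g (bihom0 (sub_bimod (image_sub (free_map p))) P).
  by move=> y; split=> // _; exact: image_proj_surj.
have [|v hv vt0] := coflat_lift ex ht0; first exact: tens_mapl0.
have [_ /(_ v) [/(_ hv) [s sv] _]] := free_iskernel n (ker_iskernel h).
have jv : (idb _ ⊗₁ j) s = v by exact: sv.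
exists ((free_map p ⊗₁ idb _) s).
by rewrite -tens_map_swap jv -(tens_complE _ gE) vt0 t0E.
Qed.

(** For injectivity, lift t to t0 over a finite free module F mapping to P. If t dies in P ⊗ (M ⊗
    X), then [coflat_lift] and exactness bring t0 from ker(F -> P) ⊗ (M □ X), the comparison being
    injective over F; so t = 0. *)
Lemma coflat_pure_kernel : pure_kernel j h.
Proof.
move=> P; split; last first.
  by move=> t; split=> [/coflat_pure_exact //|[s <-]]; exact: h_j.
apply: bihom_inj => t jt; have [n [p [t0 t0E]]] := tens_free_lift t.
have ex : exact_pair (ker_incl (free_map p)) (free_map p).
  by case: (ker_iskernel (free_map p)).
have [|u hu us] := coflat_lift (t := (idb _ ⊗₁ j) t0) ex (h_j t0).
  by rewrite tens_map_swap t0E jt.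
have [v vu] := coflat_pure_exact hu.
have -> : t = (free_map p ⊗₁ idb _) ((ker_incl (free_map p) ⊗₁ idb _) v).
  rewrite -t0E; congr (_ _).
  apply: (proj1 (free_iskernel n (ker_iskernel h))).
  by apply: etrans (esym us) _; rewrite -vu tens_map_swap.
by rewrite -tens_compl; apply: tens_mapl0 => x; exact: ker_valK.
Qed.

(** An element of Q ⊗ (M □ X) killed by g lifts to an element of P ⊗ (M ⊗ X) in the kernel of P ⊗
    [h], which comes from P ⊗ (M □ X) by purity. *)
Lemma coflat_cotens_lflat : lflat (cotens_bimod rho lam).
Proof.
move=> P Q S f g ex t; split=> [gt|[s <-]]; last first.
  by rewrite -tens_compl; apply: tens_mapl0 => x; apply/ex; exists x.
have [|s hs st] := coflat_lift (t := (idb Q ⊗₁ j) t) ex (h_j t).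
  by rewrite tens_map_swap gt raddf0.
have [v vs] := coflat_pure_exact hs; exists v.
by apply: (proj1 (coflat_pure_kernel Q)); rewrite -tens_map_swap vs.
Qed.
End CoflatPurity.

(** * Restriction of right scalars to k *)

Section ForgetRight.
Variables (k : comPzRingType) (A B E : kalg k).

Section Object.
Variable M : bimod A E.
Definition forget_ract (x : M) (c : base_kalg k) : M := x <* kalg_map E c.
Fact forget_bimodP : @bimod_axioms k A (base_kalg k) M (@lact k A E M) forget_ract.
Proof.
rewrite /forget_ract; split; [split|split| |].
- by move=> a x y; rewrite lactDr.
- by move=> a b x; rewrite lactDl.
- by move=> a b x; rewrite lactM.
- exact: lact1.
- by move=> a x y; rewrite ractDl.
- by move=> x a b; rewrite raddfD ractDr.
- by move=> x a b; rewrite rmorphM ractM.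
- by move=> x; rewrite rmorph1 ract1.
- by move=> a x b; rewrite lractA.
- by move=> c x; rewrite lract_base.
Qed.
Definition forget_right : bimod A (base_kalg k) := Bimod forget_bimodP.
End Object.

Definition forget_right_map (M N : bimod A E) (f : bihom M N) :
    bihom (forget_right M) (forget_right N) :=
  @Bihom _ _ _ (forget_right M) (forget_right N) f
    (bihomD f) (bihom_lact f) (fun x c => bihom_ract f x (kalg_map E c)).

Section TensorIso.
Variables (P : bimod B A).
Implicit Types M N : bimod A E.

Lemma forget_bal (M : bimod A E) :
  balanced (fun (x : P) (y : forget_right M) => x ⊗' (y : M)).
Proof.
by split=> *; [exact: pure_tensDl | exact: pure_tensDr | exact: pure_tens_bal].
Qed.
Lemma forgetV_bal (M : bimod A E) :
  balanced (fun (x : P) (y : M) => x ⊗' (y : forget_right M)).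
Proof.
split=> [x x' y|x y y'|x b y]; first exact: pure_tensDl.
  exact: (@pure_tensDr _ _ _ _ P (forget_right M)).
exact: (@pure_tens_bal _ _ _ _ P (forget_right M)).
Qed.
Definition forget_tens (M : bimod A E) (t : P ⊗ forget_right M) : P ⊗ M :=
  tens_lift (fun (x : P) (y : forget_right M) => x ⊗' (y : M)) t.
Definition forgetV_tens (M : bimod A E) (t : P ⊗ M) : P ⊗ forget_right M :=
  tens_lift (fun (x : P) (y : M) => x ⊗' (y : forget_right M)) t.

Lemma forget_tensD M : {morph @forget_tens M : s t / s + t}.
Proof. exact: tens_liftD (forget_bal M). Qed.
Lemma forgetV_tensD M : {morph @forgetV_tens M : s t / s + t}.
Proof. exact: tens_liftD (forgetV_bal M). Qed.
Lemma forget_tensE M (x : P) (y : M) :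
  forget_tens (@pure_tens _ _ _ _ P (forget_right M) x y) = x ⊗' y.
Proof. exact: tens_liftE (forget_bal M) x y. Qed.
Lemma forgetV_tensE M (x : P) (y : M) :
  forgetV_tens (x ⊗' y) = @pure_tens _ _ _ _ P (forget_right M) x y.
Proof. exact: tens_liftE (forgetV_bal M) x y. Qed.

Lemma forget_tensK M : cancel (@forget_tens M) (@forgetV_tens M).
Proof.
apply: tens_ext => [s t|//|x y]; first by rewrite forget_tensD forgetV_tensD.
by rewrite forget_tensE forgetV_tensE.
Qed.
Lemma forgetV_tensK M : cancel (@forgetV_tens M) (@forget_tens M).
Proof.
apply: tens_ext => [s t|//|x y]; first by rewrite forgetV_tensD forget_tensD.
by rewrite forgetV_tensE forget_tensE.
Qed.
Lemma forget_tens_nat M N (f : bihom M N) t :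
  (idb P ⊗₁ f) (forget_tens t) = forget_tens ((idb P ⊗₁ forget_right_map f) t).
Proof.
move: t; apply: tens_ext => [s t|s t|x y].
- by rewrite forget_tensD bihomD.
- by rewrite bihomD forget_tensD.
by rewrite forget_tensE !tens_mapE forget_tensE.
Qed.

(** [rflat] speaks of (A, k)-bimodules, so the right action of E is restricted to k and the result
    carried back along [forget_tens]. *)
Lemma rflat_iskernel (K M N : bimod A E) (j : bihom K M) (h : bihom M N) :
  rflat P -> iskernel j h -> iskernel (idb P ⊗₁ j) (idb P ⊗₁ h).
Proof.
move=> flP [inj_j ex].
have : iskernel (idb P ⊗₁ forget_right_map j) (idb P ⊗₁ forget_right_map h).
  by split; [exact: rflat_inj | exact: flP].
apply: (@iskernel_iso _ _ _ _ _ _ _ _ _ _ (@forget_tens K) (@forgetV_tens K)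
  (@forget_tens M) (@forgetV_tens M) (@forget_tens N)).
- exact: forgetV_tensK.
- exact: forget_tensK.
- exact: forgetV_tensK.
- exact: can_inj (@forget_tensK N).
- exact: tens_lift0 (forget_bal N).
- exact: forget_tens_nat.
- exact: forget_tens_nat.
Qed.
End TensorIso.
End ForgetRight.

(** * Von Neumann regular algebras *)

Section RightExact.
Variables (k : comPzRingType) (A B D : kalg k).
Variables (P Q S : bimod D A) (M : bimod A B).
Variables (f : bihom P Q) (g : bihom Q S).
Hypotheses (ex : exact_pair f g) (g_surj : forall y, exists x, g x = y).

Let gm (q : Q * M) : S * M := (g q.1, q.2).
Let sum (s : seq (Q * M)) : Q ⊗ M := \sum_(q <- s) (q.1 ⊗' q.2).
Let im (t : Q ⊗ M) := exists u, (f ⊗₁ idb M) u = t.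

Let imD s t : im s -> im t -> im (s + t).
Proof. by move=> [u <-] [v <-]; exists (u + v); rewrite bihomD. Qed.
Let imN s : im s -> im (- s).
Proof. by move=> [u <-]; exists (- u); rewrite raddfN. Qed.
Let im0 : im 0.
Proof. by exists 0; rewrite raddf0. Qed.
Let im_pure x y : g x = 0 -> im (x ⊗' y).
Proof. by move=> /ex [p <-]; exists (p ⊗' y); rewrite tens_mapE. Qed.
Let im_diff x x' y : g x = g x' -> im (x ⊗' y - x' ⊗' y).
Proof. by move=> e; rewrite -pure_tensBl; apply: im_pure; rewrite bihomB e subrr. Qed.

Let sum_cat s t : sum (s ++ t) = sum s + sum t.
Proof. exact: big_cat. Qed.

Let im_refl s t : map gm s = map gm t -> im (sum s - sum t).
Proof.
elim: s t => [|[x y] s IHs] [|[x' y'] t] //=; first by rewrite subrr => _; exact: im0.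
move=> [e ey /IHs st]; rewrite /sum !big_cons /= ey opprD addrACA.
by apply: imD => //; exact: im_diff.
Qed.

Let map_catE s s1 s2 : map gm s = s1 ++ s2 ->
  exists2 s1', exists2 s2', s = s1' ++ s2' & map gm s2' = s2 & map gm s1' = s1.
Proof.
move=> e; exists (take (size s1) s); last by rewrite map_take e take_size_cat.
exists (drop (size s1) s); first by rewrite cat_take_drop.
by rewrite map_drop e drop_size_cat.
Qed.

(** Induction on a derivation of the congruence over S, for arbitrary lifts of its two ends to Q:
    each rule changes the sum of the lift by an element of the image of P ⊗ M. *)
Let im_eqv s t : tens_eqv s t -> forall s' t', map gm s' = s -> map gm t' = t ->
  im (sum s' - sum t').
Proof.
elim=> {s t} [s|s t _ IH|s t u _ IHs _ IHt|s s' t t' _ IHs _ IHt|s t|y|x x' y|x y y'|x b y] s0 t0.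
- by move=> <- e; exact: im_refl.
- by move=> es et; rewrite -opprB; apply: imN; exact: IH.
(* Transitivity introduces a middle sequence, which has a lift because g is onto. *)
- have /choice[g' gK] := g_surj.
  pose t1 := map (fun q => (g' q.1, q.2)) t.
  have et1 : map gm t1 = t.
    by rewrite -map_comp map_id_in // => -[x y] _; rewrite /gm /= gK.
  move=> es eu; rewrite -(subrK (sum t1) (sum s0)) -addrA.
  by apply: imD; [exact: IHs | exact: IHt].
- move=> /map_catE [a [b -> eb] ea] /map_catE [c [d -> ed] ec].
  by rewrite !sum_cat opprD addrACA; apply: imD; [exact: IHs | exact: IHt].
- move=> /map_catE [a [b -> eb] ea] /map_catE [c [d -> ed] ec].
  rewrite !sum_cat opprD [- sum c - _]addrC addrACA.
  by apply: imD; apply: im_refl; rewrite ?ea ?eb ?ec ?ed.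
- case: s0 => [|[q z] [|]] //= -[e ez]; case: t0 => //= _.
  by rewrite /sum big_seq1 big_nil subr0; exact: im_pure.
- case: s0 => [|[q z] [|]] //= -[e ->].
  case: t0 => [|[q1 z1] [|[q2 z2] [|]]] //= -[e1 -> e2 ->].
  rewrite /sum big_seq1 big_cons big_seq1 /= -[X in _ - X]pure_tensDl.
  by apply: im_diff; rewrite bihomD e1 e2.
- case: s0 => [|[q z] [|]] //= -[e ->].
  case: t0 => [|[q1 z1] [|[q2 z2] [|]]] //= -[e1 -> e2 ->].
  rewrite /sum big_seq1 big_cons big_seq1 /= [X in X - _](pure_tensDr q) opprD addrACA.
  by apply: imD; apply: im_diff; rewrite e ?e1 ?e2.
- case: s0 => [|[q z] [|]] //= -[e ->].
  case: t0 => [|[q1 z1] [|]] //= -[e1 ->].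
  rewrite /sum !big_seq1 /= -[X in _ - X]pure_tens_bal.
  by apply: im_diff; rewrite bihom_ract e1.
Qed.

Lemma tens_right_exact t : (g ⊗₁ idb M) t = 0 -> exists u, (f ⊗₁ idb M) u = t.
Proof.
move=> gt; pose s := repr t; have tE : t = sum s by exact: tens_reprE.
have : tens_eqv (map gm s) [::].
  apply/tens_piP; rewrite !tens_piE big_nil big_map -[RHS]gt tE.
  rewrite (big_morph _ (bihomD _) (raddf0 _)); apply: eq_bigr => q _.
  by rewrite tens_mapE.
move=> /im_eqv /(_ s [::] erefl erefl).
by rewrite {2}/sum big_nil subr0 -tE.
Qed.
End RightExact.

Section FiniteSupport.
Variables (k : comPzRingType) (A B D : kalg k) (Q : bimod D A) (M : bimod A B).

(* A derivation in the tensor product involves finitely many elements of Q. *)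
Lemma tens_eqv_finite (s t : seq (Q * M)) : tens_eqv s t ->
  exists L : seq Q, forall (P : bimod D A) (j : bihom P Q),
    injective j -> (forall x, x \in L -> exists y, j y = x) ->
  forall s' t', map (fun z => (j z.1, z.2)) s' = s ->
    map (fun z => (j z.1, z.2)) t' = t -> tens_eqv s' t'.
Proof.
pose jm (P : bimod D A) (j : bihom P Q) (z : P * M) : Q * M := (j z.1, z.2).
have jm_inj P (j : bihom P Q) : injective j -> injective (jm P j).
  by move=> inj_j [x y] [x' y'] [/inj_j -> ->].
have map_catE P j s0 s1 s2 : map (jm P j) s0 = s1 ++ s2 ->
    exists2 s1', exists2 s2', s0 = s1' ++ s2' & map (jm P j) s2' = s2 & map (jm P j) s1' = s1.
  move=> e; exists (take (size s1) s0); last by rewrite map_take e take_size_cat.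
  exists (drop (size s1) s0); first by rewrite cat_take_drop.
  by rewrite map_drop e drop_size_cat.
elim=> {s t} [s|s t _ [L IH]|s t u _ [L IHs] _ [L' IHt]
  |s s' t t' _ [L IHs] _ [L' IHt]|s t|y|x x' y|x y y'|x b y].
- exists [::] => P j inj_j _ s' t' <- e.
  by rewrite -(inj_map (jm_inj _ _ inj_j) e); exact: tens_refl.
- by exists L => P j inj_j LP s' t' es et; apply: tens_sym; exact: IH LP _ _ et es.
(* The left entries of the middle sequence join the list, so that this sequence too lifts along j;
   the value 0 serves elements outside it. *)
- exists (L ++ L' ++ map fst t) => P j inj_j LP s' u' es eu.
  have /choice[j' jK] (x : Q) : exists y, x \in map fst t -> j y = x.
    have [xt|_] := boolP (x \in map fst t); last by exists 0.
    by have [|y yx] := LP x; [rewrite !mem_cat xt !orbT | exists y].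
  pose t1 := map (fun q => (j' q.1, q.2)) t.
  have et1 : map (jm P j) t1 = t.
    rewrite -map_comp map_id_in // => -[x y] xt; rewrite /jm /= jK //.
    by apply/mapP; exists (x, y).
  apply: (@tens_trans _ _ _ _ _ _ _ t1).
    by apply: (IHs _ _ inj_j) => // x xL; apply: LP; rewrite !mem_cat xL.
  by apply: (IHt _ _ inj_j) => // x xL; apply: LP; rewrite !mem_cat xL orbT.
- exists (L ++ L') => P j inj_j LP _ _ /map_catE [a [b -> eb] ea] /map_catE [c [d -> ed] ec].
  apply: tens_cat.
    by apply: (IHs _ _ inj_j) => // x xL; apply: LP; rewrite !mem_cat xL.
  by apply: (IHt _ _ inj_j) => // x xL; apply: LP; rewrite !mem_cat xL orbT.
- exists [::] => P j inj_j _ _ _ /map_catE [a [b -> eb] ea] /map_catE [c [d -> ed] ec].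
  rewrite -(inj_map (jm_inj _ _ inj_j) (etrans ea (esym ed))).
  rewrite -(inj_map (jm_inj _ _ inj_j) (etrans eb (esym ec))).
  exact: tens_comm.
- exists [::] => P j inj_j _ [|[q z] [|]] //= t' -[e ->]; case: t' => // _.
  have -> : q = 0 by apply: inj_j; rewrite e raddf0.
  exact: tens_zero.
- exists [::] => P j inj_j _ [|[q z] [|]] //= t' -[e ->].
  case: t' => [|[q1 z1] [|[q2 z2] [|]]] //= -[e1 -> e2 ->].
  have -> : q = q1 + q2 by apply: inj_j; rewrite bihomD e e1 e2.
  exact: tens_addl.
- exists [::] => P j inj_j _ [|[q z] [|]] //= t' -[e ->].
  case: t' => [|[q1 z1] [|[q2 z2] [|]]] //= -[e1 -> e2 ->].
  have -> : q1 = q by apply: inj_j; rewrite e e1.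
  have -> : q2 = q by apply: inj_j; rewrite e e2.
  exact: tens_addr.
- exists [::] => P j inj_j _ [|[q z] [|]] //= t' -[e ->].
  case: t' => [|[q1 z1] [|]] //= -[e1 ->].
  have -> : q = q1 <* b by apply: inj_j; rewrite bihom_ract e e1.
  exact: tens_bal.
Qed.
End FiniteSupport.

(** * Direct sums of bimodules *)

Section DirectSum.
Variables (k : comPzRingType) (A B : kalg k) (M N : bimod A B).

Fact dsum_bimodP : @bimod_axioms k A B (M * N)%type
  (fun a u => (a *> u.1, a *> u.2)) (fun u b => (u.1 <* b, u.2 <* b)).
Proof.
split; [split|split| |].
- by move=> a x y; rewrite !lactDr.
- by move=> a b x; rewrite !lactDl.
- by move=> a b x; rewrite !lactM.
- by move=> [x y]; rewrite !lact1.
- by move=> a x y; rewrite !ractDl.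
- by move=> a b x; rewrite !ractDr.
- by move=> a b x; rewrite !ractM.
- by move=> [x y]; rewrite !ract1.
- by move=> a x b; rewrite !lractA.
- by move=> c x; rewrite !lract_base.
Qed.
Definition dsum : bimod A B := Bimod dsum_bimodP.

Fact dsum_inl_D : {morph (fun x => (x, 0) : dsum) : x y / x + y}.
Proof. by move=> x y; congr pair; rewrite addr0. Qed.
Fact dsum_inl_lact a x : ((a *> x, 0) : dsum) = a *> ((x, 0) : dsum).
Proof. by congr pair; rewrite lact0. Qed.
Fact dsum_inl_ract x b : ((x <* b, 0) : dsum) = ((x, 0) : dsum) <* b.
Proof. by congr pair; rewrite ract0. Qed.
Definition dsum_inl : bihom M dsum := Bihom dsum_inl_D dsum_inl_lact dsum_inl_ract.

Definition dsum_fst : bihom dsum M :=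
  @Bihom _ _ _ dsum M fst (fun _ _ => erefl) (fun _ _ => erefl) (fun _ _ => erefl).
Definition dsum_snd : bihom dsum N :=
  @Bihom _ _ _ dsum N snd (fun _ _ => erefl) (fun _ _ => erefl) (fun _ _ => erefl).

Section Copair.
Variables (P : bimod A B) (f : bihom M P) (g : bihom N P).
Fact dsum_copair_D : {morph (fun u : dsum => f u.1 + g u.2) : x y / x + y}.
Proof. by move=> x y; rewrite !bihomD addrACA. Qed.
Fact dsum_copair_lact a (u : dsum) : f (a *> u).1 + g (a *> u).2 = a *> (f u.1 + g u.2).
Proof. by rewrite lactDr -!bihom_lact. Qed.
Fact dsum_copair_ract (u : dsum) b : f (u <* b).1 + g (u <* b).2 = (f u.1 + g u.2) <* b.
Proof. by rewrite ractDl -!bihom_ract. Qed.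
Definition dsum_copair : bihom dsum P :=
  Bihom dsum_copair_D dsum_copair_lact dsum_copair_ract.
End Copair.
End DirectSum.

(** * Flatness of every module over a von Neumann regular algebra *)

Section VonNeumannRegular.
Variables (k : comPzRingType) (A : kalg k).
Hypothesis A_reg : von_neumann_regular A.

(** The classical argument that finitely generated right ideals have a left identity: e = ax fixes
    a, and with z a quasi-inverse of (1 - e)b the correction g = (1 - e)bz(1 - e) kills a and sends
    b to b - eb. *)
Lemma vnr_left_identity (a b : A) : exists x, exists y,
  (a * x + b * y) * a = a /\ (a * x + b * y) * b = b.
Proof.
have [x axa] := A_reg a; pose e := a * x.
have [z bzb] := A_reg (b - e * b); pose g := (b - e * b) * z * (1 - e).
have eg : e + g = a * (x - x * b * z * (1 - e)) + b * (z * (1 - e)).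
  rewrite mulrBr -addrA; congr (_ + _).
  by rewrite /g !mulrBl !mulrA addrC.
exists (x - x * b * z * (1 - e)), (z * (1 - e)); rewrite -eg; split.
  have e0 : (1 - e) * a = 0 by rewrite mulrBl mul1r axa subrr.
  by rewrite mulrDl axa /g -mulrA e0 mulr0 addr0.
have e1 : (1 - e) * b = b - e * b by rewrite mulrBl mul1r.
by rewrite mulrDl /g -mulrA e1 bzb addrC subrK.
Qed.

Definition point_map (P : bimod (base_kalg k) A) (q : P) : bihom (regular_right A) P.
Proof.
apply: (@Bihom _ _ _ (regular_right A) P (fun a : A => q <* a)).
- by move=> x y; exact: ractDr.
- move=> c x; rewrite lractA -[c *> q]/(kalg_map (base_kalg k) c *> q) lract_base.
  exact: ractM.
- by move=> x a; exact: ractM.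
Defined.

Variables (B : kalg k) (M : bimod A B).

Section OneGenerator.
Variables (P Q : bimod (base_kalg k) A) (j : bihom P Q) (q : Q).
Hypothesis j_inj : injective j.

(** Its image is j(P) + qA, the submodule obtained from P by adjoining [q]. *)
Let phi := dsum_copair j (point_map q).

(* N contains the image of ker phi ⊗ M in (P ⊗ M) x M; that it is closed under
   addition uses that finitely many elements of A have a common left identity
   in the right ideal they generate. *)
Let N (v : P ⊗ M) (m : M) :=
  exists p, exists e : A, [/\ j p = q <* e, e *> m = m & v = - (p ⊗' m)].

Let N0 : N 0 0.
Proof.
exists 0, 0; split; last by rewrite pure_tens0l oppr0.
  rewrite raddf0; apply: (addrI (q <* 0)); by rewrite -ractDr !addr0.
exact: lact0.
Qed.

Let ND v m v' m' : N v m -> N v' m' -> N (v + v') (m + m').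
Proof.
move=> [p [e [pe em ->]]] [p' [e' [pe' em' ->]]].
have [x [y [he he']]] := vnr_left_identity e e'; set h := _ + _ in he he'.
(* [ph] lies over q h for the common left identity h, so p = ph e and p ⊗ m = ph ⊗ em = ph ⊗ m;
   likewise for p'. *)
pose ph := p <* x + p' <* y.
have phE : j ph = q <* h by rewrite /ph bihomD !bihom_ract pe pe' -!ractM -ractDr.
exists ph, h; split=> //.
  by rewrite lactDr -em -em' -!lactM he he'.
have -> : p = ph <* e by apply: j_inj; rewrite bihom_ract phE -ractM he.
have -> : p' = ph <* e' by apply: j_inj; rewrite bihom_ract phE -ractM he'.
rewrite (pure_tens_bal _ e) (pure_tens_bal _ e') em em' -opprD.
by congr (- _); exact/esym/pure_tensDr.
Qed.

Let act (t : regular_right A ⊗ M) : M := regular_act t.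

Let N_ker (u : ker phi ⊗ M) :
  N ((dsum_fst _ _ ⊗₁ idb M) ((ker_incl phi ⊗₁ idb M) u))
    (act ((dsum_snd _ _ ⊗₁ idb M) ((ker_incl phi ⊗₁ idb M) u))).
Proof.
have actD : {morph act : s t / s + t} := tens_liftD (regular_act_bal M).
elim/tens_ind: u => [|s t|z m].
- by rewrite !raddf0 /act [regular_act _](tens_lift0 (regular_act_bal M)); exact: N0.
- by rewrite !bihomD actD; exact: ND.
rewrite !tens_mapE /act [regular_act _](tens_liftE (regular_act_bal M)).
have : phi (ker_incl phi z) = 0 by exact: ker_valK.
move: (ker_incl phi z) => [p a] zE.
have jp : j p = - (q <* a) by apply/eqP; rewrite -addr_eq0; apply/eqP.
(* The idempotent ax fixes am, and p = pxa because j is injective and j(p) = -qa; hence p ⊗ m = px ⊗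
   am. *)
have [x axa] := A_reg a.
exists (- (p <* x)), (a * x); split.
- by rewrite bihomN bihom_ract jp ractN opprK -ractM.
- by rewrite -lactM; congr (_ *> _); exact: axa.
have -> : p ⊗' m = (p <* x) ⊗' (a *> m).
  rewrite -pure_tens_bal; congr (_ ⊗' m); apply: j_inj.
  by rewrite !bihom_ract jp !ractN -!ractM mulrA axa.
apply: (addIr ((- (p <* x)) ⊗' (a *> m))).
by rewrite addNr -[LHS]pure_tensDl subrr pure_tens0l.
Qed.

(** By right exactness, the kernel of (P ⊕ A) ⊗ M -> (j(P) + qA) ⊗ M comes from ker phi ⊗ M. An
    element of it whose A ⊗ M component vanishes has m = 0 in the relation [N], so its P ⊗ M
    component vanishes as well. *)
Lemma vnr_one_generator :
  injective ((image_proj phi ∘ dsum_inl _ _) ⊗₁ idb M).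
Proof.
apply: bihom_inj => t; rewrite tens_compl => t0.
have [||u ut] := tens_right_exact (f := ker_incl phi) (g := image_proj phi) _ _ t0.
- move=> x; split=> [x0|].
    by apply/(ker_iskernel phi).2; rewrite -image_projE x0 raddf0.
  move=> /(ker_iskernel phi).2 x0; apply: (@sub_incl_inj _ _ _ _ (image_sub phi)).
  by rewrite image_projE x0 raddf0.
- exact: image_proj_surj.
have [p [e [_ _]]] := N_ker u.
rewrite ut -tens_compl.
have -> : ((dsum_fst P (regular_right A) ∘ dsum_inl P (regular_right A)) ⊗₁ idb M) t = t.
  by rewrite -[RHS]tens_map_id; apply: tens_mapl.
move=> ->; rewrite -tens_compl [(_ ⊗₁ _) t](_ : _ = 0); last first.
  exact: tens_mapl0.
rewrite /act [regular_act _](tens_lift0 (regular_act_bal M)).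
by rewrite pure_tens0r oppr0.
Qed.
End OneGenerator.

(** Adjoin the elements of [L] one at a time; each step is injective after tensoring by
    [vnr_one_generator]. *)
Lemma vnr_chain (Q : bimod (base_kalg k) A) (L : seq Q) (P : bimod (base_kalg k) A)
    (j : bihom P Q) : injective j ->
  exists P' : bimod (base_kalg k) A, exists i : bihom P P', exists j' : bihom P' Q,
    [/\ injective j', forall x, j' (i x) = j x, injective (i ⊗₁ idb M)
      & forall x, x \in L -> exists y, j' y = x].
Proof.
elim: L P j => [|q L IH] P j inj_j.
  exists P, (idb P), j; split=> //.
  by move=> s t; rewrite !tens_map_id.
pose phi := dsum_copair j (point_map q).
have [P' [i [j' [inj_j' ij inj_i LP]]]] := IH _ _ (@sub_incl_inj _ _ _ _ (image_sub phi)).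
exists P', (i ∘ (image_proj phi ∘ dsum_inl _ _)), j'; split=> //.
- move=> x; rewrite !bicompE ij image_projE.
  rewrite [LHS]/(j x + q <* 0); rewrite -[RHS]addr0; congr (_ + _).
  by apply: (addrI (q <* 0)); rewrite -ractDr !addr0.
- move=> s t; rewrite !(tens_compl _ i) => /inj_i; exact: vnr_one_generator.
move=> x; rewrite inE => /orP[/eqP ->|]; last exact: LP.
exists (i (image_proj phi ((0, 1 : A) : dsum P (regular_right A)))).
have j0 : j 0 = 0 by exact: raddf0.
rewrite ij image_projE; suff <- : j 0 + q <* 1 = q by [].
by rewrite j0 add0r ract1.
Qed.

(** If t dies in Q ⊗ M, the derivation of this fact uses finitely many elements of Q and so takes
    place in some P' between P and Q, obtained by adjoining them. Thus t dies in P' ⊗ M, into which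
    P ⊗ M injects. *)
Lemma vnr_tens_inj (P Q : bimod (base_kalg k) A) (j : bihom P Q) :
  injective j -> injective (j ⊗₁ idb M).
Proof.
move=> inj_j; apply: bihom_inj => t jt; pose s := repr t.
have tE : t = \pi_(tens_sort P M)%qT s by rewrite reprK.
have : tens_eqv (map (fun z => (j z.1, z.2)) s) [::].
  apply/tens_piP; rewrite !tens_piE big_nil big_map -[RHS]jt tE tens_piE.
  rewrite (big_morph _ (bihomD _) (raddf0 _)); apply: eq_bigr => z _.
  by rewrite tens_mapE.
move=> /tens_eqv_finite [L LP].
have [P' [i [j' [inj_j' ij inj_i P'L]]]] := vnr_chain L inj_j.
apply: inj_i; rewrite raddf0.
have /tens_piP : tens_eqv (map (fun z => (i z.1, z.2)) s) [::].
  apply: (LP P' j' inj_j' P'L _ [::]) => //.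
  by rewrite -map_comp; apply: eq_map => z /=; rewrite ij.
rewrite !tens_piE big_nil big_map => <-.
rewrite {1}tE tens_piE (big_morph _ (bihomD _) (raddf0 _)); apply: eq_bigr => z _.
by rewrite tens_mapE.
Qed.

(** Right exactness settles the sequence that ends in the image of g, and the image tensored by M
    embeds in S ⊗ M. *)
Lemma vnr_lflat : lflat M.
Proof.
move=> P Q S f g ex t; split=> [gt|[u <-]]; last first.
  by rewrite -tens_compl; apply: tens_mapl0 => x; apply/ex; exists x.
apply: (tens_right_exact (g := image_proj g)).
- move=> x; split=> [x0|].
    by apply/ex; rewrite -image_projE x0 raddf0.
  move=> /ex x0; apply: (@sub_incl_inj _ _ _ _ (image_sub g)).
  by rewrite image_projE x0 raddf0.
- exact: image_proj_surj.
apply: (vnr_tens_inj (@sub_incl_inj _ _ _ _ (image_sub g))).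
by rewrite (tens_complE _ (image_projE g)) gt raddf0.
Qed.
End VonNeumannRegular.

(** * Right flatness by passage to the opposite algebra *)

Section OppositeAlgebra.
Variables (k : comPzRingType) (A : kalg k).

Definition op_map (c : k) : GRing.converse A := kalg_map A c.
Fact op_map_zmod : zmod_morphism op_map.
Proof. by move=> x y; rewrite /op_map raddfB. Qed.
Fact op_map_monoid : monoid_morphism op_map.
Proof.
split; first exact: (rmorph1 (kalg_map A)).
by move=> x y; rewrite /op_map mulrC; exact: (rmorphM (kalg_map A)).
Qed.
HB.instance Definition _ :=
  GRing.isZmodMorphism.Build k (GRing.converse A) op_map op_map_zmod.
HB.instance Definition _ :=
  GRing.isMonoidMorphism.Build k (GRing.converse A) op_map op_map_monoid.
Fact op_central (c : k) (x : GRing.converse A) : op_map c * x = x * op_map c.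
Proof. exact/esym/(kalg_central (k := k)). Qed.
Definition op_kalg : kalg k := @KAlg k (GRing.converse A) op_map op_central.
End OppositeAlgebra.

Section OppositeBimod.
Variables (k : comPzRingType).

Section Object.
Variables (A B : kalg k) (P : bimod B A).
Definition op_lact (a : op_kalg A) (x : P) : P := x <* (a : A).
Definition op_ract (x : P) (b : op_kalg B) : P := (b : B) *> x.
Fact op_bimodP : bimod_axioms op_lact op_ract.
Proof.
rewrite /op_lact /op_ract; split; [split|split| |].
- by move=> a x y; rewrite ractDl.
- by move=> a b x; exact: ractDr.
- by move=> a b x; exact: ractM.
- by move=> x; exact: ract1.
- by move=> a x y; rewrite lactDr.
- by move=> x a b; exact: lactDl.
- by move=> x a b; exact: lactM.
- by move=> x; exact: lact1.
- by move=> a x b; rewrite lractA.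
- by move=> c x; exact/esym/lract_base.
Qed.
Definition op_bimod : bimod (op_kalg A) (op_kalg B) := Bimod op_bimodP.
End Object.

(* Left modules become right modules over the opposite algebra; the action of
   the commutative ring k is kept as it is. *)
Section Module.
Variables (A : kalg k) (U : bimod A (base_kalg k)).
Definition op_mod_lact (c : base_kalg k) (x : U) : U := x <* c.
Definition op_mod_ract (x : U) (a : op_kalg A) : U := (a : A) *> x.
Fact op_mod_bimodP : bimod_axioms op_mod_lact op_mod_ract.
Proof.
rewrite /op_mod_lact /op_mod_ract; split; [split|split| |].
- by move=> a x y; rewrite ractDl.
- by move=> a b x; exact: ractDr.
- by move=> a b x; rewrite mulrC; exact: ractM.
- by move=> x; exact: ract1.
- by move=> a x y; rewrite lactDr.
- by move=> x a b; exact: lactDl.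
- by move=> x a b; exact: lactM.
- by move=> x; exact: lact1.
- by move=> a x b; rewrite lractA.
- by move=> c x; exact/esym/lract_base.
Qed.
Definition op_mod : bimod (base_kalg k) (op_kalg A) := Bimod op_mod_bimodP.
End Module.

Definition op_mod_map (A : kalg k) (U V : bimod A (base_kalg k)) (f : bihom U V) :
    bihom (op_mod U) (op_mod V) :=
  @Bihom _ _ _ (op_mod U) (op_mod V) f
    (bihomD f) (fun c x => bihom_ract f x c) (fun x a => bihom_lact f a x).

Section Swap.
Variables (A B : kalg k) (P : bimod B A).
Implicit Types U V : bimod A (base_kalg k).

Fact swap_bal U :
  balanced (fun (x : P) (u : U) => @pure_tens _ _ _ _ (op_mod U) (op_bimod P) u x).
Proof.
split=> [x x' u|x u u'|x a u].
- exact: (@pure_tensDr _ _ _ _ (op_mod U) (op_bimod P)).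
- exact: (@pure_tensDl _ _ _ _ (op_mod U) (op_bimod P)).
- exact/esym/(@pure_tens_bal _ _ _ _ (op_mod U) (op_bimod P) u a x).
Qed.
Fact swapV_bal U :
  balanced (fun (u : op_mod U) (x : op_bimod P) => @pure_tens _ _ _ _ P U x u).
Proof.
split=> [x x' u|x u u'|u a x].
- exact: (@pure_tensDr _ _ _ _ P U).
- exact: (@pure_tensDl _ _ _ _ P U).
- exact/esym/(@pure_tens_bal _ _ _ _ P U).
Qed.
Definition swap U (t : P ⊗ U) : op_mod U ⊗ op_bimod P :=
  tens_lift (fun (x : P) (u : U) => @pure_tens _ _ _ _ (op_mod U) (op_bimod P) u x) t.
Definition swapV U (t : op_mod U ⊗ op_bimod P) : P ⊗ U :=
  tens_lift (fun (u : op_mod U) (x : op_bimod P) => @pure_tens _ _ _ _ P U x u) t.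
Lemma swapD U : {morph @swap U : s t / s + t}.
Proof. exact: tens_liftD (swap_bal U). Qed.
Lemma swapVD U : {morph @swapV U : s t / s + t}.
Proof. exact: tens_liftD (swapV_bal U). Qed.
Lemma swapE U (x : P) (u : U) :
  swap (x ⊗' u) = @pure_tens _ _ _ _ (op_mod U) (op_bimod P) u x.
Proof. exact: tens_liftE (swap_bal U) x u. Qed.
Lemma swapVE U (x : P) (u : U) :
  swapV (@pure_tens _ _ _ _ (op_mod U) (op_bimod P) u x) = x ⊗' u.
Proof. exact: tens_liftE (swapV_bal U) u x. Qed.
Lemma swapK U : cancel (@swap U) (@swapV U).
Proof.
apply: tens_ext => [s t|//|x y]; first by rewrite swapD swapVD.
by rewrite swapE swapVE.
Qed.
Lemma swapVK U : cancel (@swapV U) (@swap U).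
Proof.
apply: tens_ext => [s t|//|x y]; first by rewrite swapVD swapD.
by rewrite swapVE swapE.
Qed.
Lemma swapV_nat U V (f : bihom U V) t :
  (idb P ⊗₁ f) (swapV t) = swapV ((op_mod_map f ⊗₁ idb (op_bimod P)) t).
Proof.
move: t; apply: tens_ext => [s t|s t|x y].
- by rewrite swapVD bihomD.
- by rewrite bihomD swapVD.
by rewrite swapVE !tens_mapE swapVE.
Qed.

Lemma op_lflat_rflat : lflat (op_bimod P) -> rflat P.
Proof.
move=> fl U V W f g ex t.
have ext := fl _ _ _ (op_mod_map f) (op_mod_map g) ex (swap t).
split=> [gt|[s <-]].
  have [|u us] := ext.1.
    by rewrite -[LHS]swapVK -swapV_nat swapK gt /swap (tens_lift0 (swap_bal _)).
  by exists (swapV u); rewrite swapV_nat us swapK.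
by rewrite -tens_compr; apply: tens_mapr0 => x; apply/ex; exists x.
Qed.
End Swap.

(** Regularity is left-right symmetric, so the opposite algebra is regular and left flatness over it
    is right flatness over A. *)
Lemma vnr_rflat (A B : kalg k) (P : bimod B A) : von_neumann_regular A -> rflat P.
Proof.
move=> A_reg; apply: op_lflat_rflat; apply: vnr_lflat => a.
by have [b aba] := A_reg a; exists b; rewrite -[RHS]aba; exact: (@mulrA A a b a).
Qed.
End OppositeBimod.

(** * The coring structure under each of the three conditions *)

Theorem theorem3p1p1 (k : comPzRingType) (A B : kalg k)
    (C : coring A) (D : coring B) (X : bicomod C D) (Λ : bicomod D C)
    (hyp : [\/ [/\ lflat C, lflat D, rflat C & rflat D]
                 /\ coflat (lcoact X) /\ coflat (lcoact Λ),
               von_neumann_regular A /\ von_neumann_regular B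
             | [/\ lflat C, lflat D, coseparable C & coseparable D]])
    (psi : bihom (coring_bicomod C) (X □ Λ))
    (omega : bihom (Λ □ X) (coring_bicomod D))
    (psi_bicolinear : is_bicolinear psi)
    (omega_bicolinear : is_bicolinear omega)
    (Λ_eq : (omega □₁ idb Λ) ∘ cot_assocV Λ X Λ ∘ (idb Λ □₁ psi) ∘ cot_runit Λ
              =1 cot_lunit Λ)
    (X_eq : (idb X □₁ omega) ∘ cot_assoc X Λ X ∘ (psi □₁ idb X) ∘ cot_lunit X
              =1 cot_runit X) :
  let Delta :=
    cot_incl (Λ □ X) (Λ □ X)
    ∘ cot_assocV Λ X (Λ □ X)
    ∘ (idb Λ □₁ cot_assoc X Λ X)
    ∘ (idb Λ □₁ (psi □₁ idb X))
    ∘ (idb Λ □₁ cot_lunit X) in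
  let eps := ceps D ∘ omega in
  is_coring (C := Λ □ X) Delta eps.
Proof.
move=> Delta eps.
suff [b [i_good y_good C_good D_good X_good] [L_good E_good YX_ker XE_ker]] : exists2 b : bool,
    [/\ good_kernel b (cot_incl Λ X) (cot_diff Λ X),
        good_kernel b (cot_incl X Λ) (cot_diff X Λ),
        good_left b C, good_left b D & good_left b X]
  & [/\ good_left b Λ, good_left b (Λ □ X),
        iskernel (idb C ⊗₁ cot_incl (X □ Λ) X) (idb C ⊗₁ cot_diff (X □ Λ) X)
      & iskernel (idb C ⊗₁ cot_incl X (Λ □ X)) (idb C ⊗₁ cot_diff X (Λ □ X))].
  exact: (comatrix_is_coring (b := b)).
case: hyp => [[[flC flD rfC rfD] [cfX cfL]]|[regA regB]|[flC flD csC csD]].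
- have [lX rX _] := bicomodP X; have [lL rL _] := bicomodP Λ.
  have flX := coflat_lflat flC lX cfX; have flL := coflat_lflat flD lL cfL.
  exists false; split; try by right.
  + exact: coflat_pure_kernel.
  + exact: coflat_pure_kernel.
  + right; exact: coflat_cotens_lflat.
  (* For the two iterated kernels the left tensor factor is C itself, so right flatness of C applies
     directly. *)
  + exact: rflat_iskernel (cot_incl_iskernel _ _).
  + exact: rflat_iskernel (cot_incl_iskernel _ _).
- exists false; split; try by right; exact: vnr_lflat.
  + by move=> P; apply: rflat_iskernel (cot_incl_iskernel _ _); exact: vnr_rflat.
  + by move=> P; apply: rflat_iskernel (cot_incl_iskernel _ _); exact: vnr_rflat.
  + by apply: rflat_iskernel (cot_incl_iskernel _ _); exact: vnr_rflat.
  + by apply: rflat_iskernel (cot_incl_iskernel _ _); exact: vnr_rflat.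
- exists true; split; try by left.
  + exact: bicomod_split_kernel.
  + exact: bicomod_split_kernel.
  + exact/split_kernel_iskernel/split_kernel_tensl/bicomod_cotensl_split_kernel.
  + exact/split_kernel_iskernel/split_kernel_tensl/bicomod_cotensr_split_kernel.
Qed.
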